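(* Let $G$ be an unweighted multigraph on $n$ vertices, let $T$ be a tight T-tree of $G$, and let $\lambda$ be a parameter. There is an algorithm $\mathrm{TreeCut}(G,T,\lambda)$ with the following guarantee: if the minimum $k$-cut in $G$ has size at most $\lambda$, then $\mathrm{TreeCut}$ outputs a minimum $k$-cut of $G$. The running time of $\mathrm{TreeCut}$ is $k^{O(k)}\lambda^k n^{o(k)}$.
   Context: For a graph $G=(V,E)$ and vertex-disjoint sets $S_1,\ldots,S_\ell$, $E[S_1,\ldots,S_\ell]$ denotes the set of edges whose endpoints lie in distinct sets $S_i,S_j$ ($i\ne j$). A $k$-cut is a partition $S_1,\ldots,S_k$ of $V$ into $k$ nonempty parts, of size $|E[S_1,\ldots,S_k]|$; a minimum $k$-cut is one of minimum size. A spanning tree $T$ of $G$ is an $\ell$-T-tree if there is a minimum $k$-cut $S^*_1,\ldots,S^*_k$ of $G$ with $|E_T[S^*_1,\ldots,S^*_k]|\le \ell$ (edges of $T$ crossing between distinct parts); it is a tight T-tree if $\ell=k-1$ (the minimum possible). *)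

(* Defs.v *)
From mathcomp Require Import all_boot.

Set Implicit Arguments.
Unset Strict Implicit.
Unset Printing Implicit Defensive.

(** * Multigraphs, k-cuts and T-trees *)

(* Parallel edges are distinct elements of [edge]; loops are allowed (they never
   cross a partition).  The order of the two endpoints carries no meaning. *)
Record multigraph (n : nat) := Multigraph {
  edge : finType;
  ends : edge -> 'I_n * 'I_n
}.

Section Graph.
Variables (n : nat) (G : multigraph n).
Implicit Types (F T : {set edge G}) (P Q : {set {set 'I_n}}).

Definition joins (e : edge G) (u v : 'I_n) : bool :=
  (ends e == (u, v)) || (ends e == (v, u)).

(* E_F[S_1, ..., S_l] for P = {S_1, ..., S_l}. *)
Definition crossing F P : {set edge G} :=
  [set e in F | [exists A in P, exists B in P,
     [&& A != B, (ends e).1 \in A & (ends e).2 \in B]]].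

Definition is_kcut (k : nat) P : bool :=
  partition P [set: 'I_n] && (#|P| == k).

Definition cut_size P : nat := #|crossing [set: edge G] P|.

Definition is_min_kcut (k : nat) P : Prop :=
  is_kcut k P /\ forall Q, is_kcut k Q -> cut_size P <= cut_size Q.

Definition adjacent F (u v : 'I_n) : bool := [exists e in F, joins e u v].

(* [:: (v_1, e_1); ...; (v_m, e_m)] with m > 0, distinct vertices, distinct
   edges, and e_i joining v_i to v_(i+1) cyclically.  A loop is a cycle with
   m = 1, a pair of parallel edges a cycle with m = 2. *)
Definition is_cycle F (c : seq ('I_n * edge G)) : bool :=
  [&& c != [::], uniq (map fst c), uniq (map snd c),
      all (mem F) (map snd c) & cycle (fun p q => joins p.2 p.1 q.1) c].

Definition spanning_tree T : Prop :=
  (forall u v : 'I_n, connect (adjacent T) u v) /\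
  (forall c, ~~ is_cycle T c).

Definition is_T_tree (k l : nat) T : Prop :=
  spanning_tree T /\ exists P, is_min_kcut k P /\ #|crossing T P| <= l.

Definition is_tight_T_tree (k : nat) T : Prop := is_T_tree k k.-1 T.

End Graph.

(** * Random access machine *)

(* A structured unit-cost RAM: finitely many registers named in the program
   text, and an indirectly addressed memory.  The only arithmetic is addition
   and truncated subtraction; with multiplication or shifts at unit cost on
   unbounded integers the model would be unreasonably powerful. *)
Inductive expr :=
  | Lit of nat
  | Reg of nat
  | Read of expr
  | Add of expr & expr
  | Sub of expr & expr.

Inductive prog :=
  | Skip
  | Set_ of nat & expr
  | Store of expr & expr
  | Seq of prog & prog
  | If of expr & prog & prog
  | While of expr & prog.

Record state := State { reg : nat -> nat; mem : nat -> nat }.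

Definition upd (f : nat -> nat) (a v : nat) : nat -> nat :=
  fun b => if b == a then v else f b.

Fixpoint eval (s : state) (e : expr) : nat :=
  match e with
  | Lit v => v
  | Reg x => reg s x
  | Read a => mem s (eval s a)
  | Add e1 e2 => eval s e1 + eval s e2
  | Sub e1 e2 => eval s e1 - eval s e2
  end.

Fixpoint ecost (e : expr) : nat :=
  match e with
  | Lit _ | Reg _ => 1
  | Read a => (ecost a).+1
  | Add e1 e2 | Sub e1 e2 => (ecost e1 + ecost e2).+1
  end.

(* [exec p s t s'] : p started in s halts in s' after t units of time.  Tests
   succeed on nonzero values. *)
Inductive exec : prog -> state -> nat -> state -> Prop :=
  | ExecSkip s : exec Skip s 1 s
  | ExecSet x e s :
      exec (Set_ x e) s (ecost e).+1 (State (upd (reg s) x (eval s e)) (mem s))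
  | ExecStore a e s :
      exec (Store a e) s (ecost a + ecost e).+1
        (State (reg s) (upd (mem s) (eval s a) (eval s e)))
  | ExecSeq p q s t s' t' s'' :
      exec p s t s' -> exec q s' t' s'' -> exec (Seq p q) s (t + t') s''
  | ExecIfTrue e p q s t s' :
      eval s e != 0 -> exec p s t s' -> exec (If e p q) s ((ecost e).+1 + t) s'
  | ExecIfFalse e p q s t s' :
      eval s e = 0 -> exec q s t s' -> exec (If e p q) s ((ecost e).+1 + t) s'
  | ExecWhileFalse e p s :
      eval s e = 0 -> exec (While e p) s (ecost e).+1 s
  | ExecWhileTrue e p s t s' t' s'' :
      eval s e != 0 -> exec p s t s' -> exec (While e p) s' t' s'' ->
      exec (While e p) s ((ecost e).+1 + t + t') s''.

Lemma exec_det p s t1 s1 t2 s2 :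
  exec p s t1 s1 -> exec p s t2 s2 -> t1 = t2 /\ s1 = s2.
Proof.
move=> H; move: t2 s2; induction H => t2 s2 H2; inversion H2; subst => //;
  repeat match goal with
  | z : eval ?s ?e = 0, nz : is_true (eval ?s ?e != 0) |- _ =>
      by rewrite z in nz
  | IH : forall t s, exec ?p ?s0 t s -> _, E : exec ?p ?s0 _ _ |- _ =>
      case: (IH _ _ E) => ? ?; clear IH; subst
  end; by [].
Qed.

(** * Input and output *)

Section Encoding.
Variables (n : nat) (G : multigraph n).

(* Row-major matrix of edge multiplicities of the subgraph (V, F). *)
Definition adjacency (F : {set edge G}) : seq nat :=
  [seq #|[set e in F | joins e u v]| | u <- enum 'I_n, v <- enum 'I_n].

(* Registers 0, 1, 2 hold n, k, lambda; memory holds the adjacency matrix of G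
   at addresses [0, n^2) and that of T at [n^2, 2n^2); all else is zero. *)
Definition input (k lam : nat) (T : {set edge G}) : state :=
  State (nth 0 [:: n; k; lam]) (nth 0 (adjacency [set: edge G] ++ adjacency T)).

End Encoding.

(* Address v < n holds a label of vertex v; parts are the classes of vertices
   with equal label. *)
Definition output (n : nat) (s : state) : {set {set 'I_n}} :=
  preim_partition (fun v : 'I_n => mem s v) [set: 'I_n].

(* g(k) = o(k), with epsilon ranging over 1/c. *)
Definition little_o_id (g : nat -> nat) : Prop :=
  forall c : nat, exists K : nat, forall k : nat, K <= k -> c * g k <= k.

(* Main.v *)
(** Root T at the vertex 0 and name a tree edge by its lower end v; let D v be the set of
    edges of G leaving the subtree of v.  A set F of J = k - 1 tree edges yields a k-cut,
    two vertices being in the same part when the same subtrees of F contain them, and the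
    size of this cut is the cardinality of the union of the D v, v in F.  A tight T-tree
    thus reduces the problem to minimising this union, where only tree edges with
    #|D v| <= lam matter.

    Split F into components, linked by common edges of the sets D v.  The topmost cuts of a
    connected set are found from a cut c by exploration: some leaf below the next one is an
    end of an edge in D w for a cut w which is already known, so there are 2 lam choices
    for it, and (2 lam)^J k^O(k) guesses in all.  A guess locates each topmost cut up to its
    position on a chain of tree edges; the best positions are found by a minimum cut, with
    at most lam + 1 unit augmentations, in which the cuts to be placed below and beside a
    position enter through a table of the optimal values of smaller problems.  The values
    so obtained are never below the true cost, and for connected sets they attain it.

    An explicit optimal component is recovered by deleting tree edges as long as the value
    does not increase.  The components are packed one after the other: the cheapest
    candidate among the available tree edges is taken, unless it meets a later component of
    the target; then one of its elements is guessed to belong to that component.  At most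
    2J such steps are needed, hence k^O(k) outer guesses. *)

Require Import Defs.
From mathcomp Require Import all_boot zify.
From Stdlib Require Import Classical ClassicalEpsilon FunctionalExtensionality.

Set Implicit Arguments.
Unset Strict Implicit.
Unset Printing Implicit Defensive.

(** * A language of arrays and counting loops *)

(** The exponent of [lam] has to be k. Guessing the leaves costs (2 lam)^J and the augmentations one
    more factor lam + 1, so nothing else nested in these loops may depend on [lam]. For this reason
    the problems below and beside a cut are read from a table instead of being guessed recursively,
    and an outer guess names an element of an explicit candidate of at most J cuts instead of a
    vertex.

    The exploration need not find every topmost cut. A cut that it misses shares no edge with the
    starting cut or with a known top edge; by linkage it then lies under one of these top edges and
    does not interact with the other chains. This is the origin of the problem beside a position. In
    a disconnected set the exploration could stall, hence the components.

    The table depends on the available tree edges and is recomputed after each deletion. This only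
    costs a power of n, whose degree is read off the program text; so the exponent of n is a
    constant, in particular o(k). *)

Inductive ex :=
  | XLit of nat
  | XVar of nat
  | XArr of nat & ex
  | XAdd of ex & ex
  | XSub of ex & ex
  | XIte of ex & ex & ex
  | XSum of nat & nat & ex.

Fixpoint ev (rg : nat -> nat) (ar : nat -> nat -> nat) (e : ex) : nat :=
  match e with
  | XLit v => v
  | XVar r => rg r
  | XArr a i => ar a (ev rg ar i)
  | XAdd e1 e2 => ev rg ar e1 + ev rg ar e2
  | XSub e1 e2 => ev rg ar e1 - ev rg ar e2
  | XIte e1 e2 e3 => if ev rg ar e1 != 0 then ev rg ar e2 else ev rg ar e3
  | XSum x l b => \sum_(i < rg l) ev (upd rg x i) ar b
  end.

Record st := St { rg : nat -> nat; ar : nat -> nat -> nat }.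

Inductive cmd :=
  | CNop
  | CSet of nat & ex
  | CSto of nat & ex & ex
  | CSeq of cmd & cmd
  | CIf of ex & cmd & cmd
  | CFor of nat & nat & cmd.

Definition setr (s : st) x v := St (upd (rg s) x v) (ar s).
Definition seta (s : st) a i v :=
  St (rg s) (fun b j => if (b == a) && (j == i) then v else ar s b j).
Definition evs s e := ev (rg s) (ar s) e.

Fixpoint run (c : cmd) (s : st) : st :=
  match c with
  | CNop => s
  | CSet r e => setr s r (evs s e)
  | CSto a i e => seta s a (evs s i) (evs s e)
  | CSeq c1 c2 => run c2 (run c1 s)
  | CIf e c1 c2 => if evs s e != 0 then run c1 s else run c2 s
  | CFor x l b => iteri (rg s l) (fun i s' => setr (run b s') x i.+1) (setr s x 0)
  end.

(* Registers below 70 are program variables, 70 to 99 bound variables of sums,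
   and those from 100 on the evaluation stack. *)
Fixpoint wfE (bs : seq nat) (e : ex) : bool :=
  match e with
  | XLit _ => true
  | XVar r => (r < 70) || (r \in bs)
  | XArr a i => (a < 32) && wfE bs i
  | XAdd e1 e2 | XSub e1 e2 => wfE bs e1 && wfE bs e2
  | XIte e1 e2 e3 => [&& wfE bs e1, wfE bs e2 & wfE bs e3]
  | XSum x l b => [&& 70 <= x < 100, x \notin bs, l < 70 & wfE (x :: bs) b]
  end.

Fixpoint limsE (e : ex) : seq nat :=
  match e with
  | XLit _ | XVar _ => [::]
  | XArr _ i => limsE i
  | XAdd e1 e2 | XSub e1 e2 => limsE e1 ++ limsE e2
  | XIte e1 e2 e3 => limsE e1 ++ limsE e2 ++ limsE e3
  | XSum _ l b => l :: limsE b
  end.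

(** [ro] bounds the registers that limit loops, and both branches of a conditional are charged. The
    constants are costs of the code below: 25 is 20 for [mul32] and 5 for the indexed read. *)
Fixpoint tE (ro : nat -> nat) (e : ex) : nat :=
  match e with
  | XLit _ | XVar _ => 2
  | XArr _ i => tE ro i + 25
  | XAdd e1 e2 | XSub e1 e2 => tE ro e1 + tE ro e2 + 4
  | XIte e1 e2 e3 => tE ro e1 + tE ro e2 + tE ro e3 + 2
  | XSum _ l b => 8 + ro l * (tE ro b + 12)
  end.

Fixpoint wrC (c : cmd) : seq nat :=
  match c with
  | CNop | CSto _ _ _ => [::]
  | CSet r _ => [:: r]
  | CSeq c1 c2 | CIf _ c1 c2 => wrC c1 ++ wrC c2
  | CFor x _ b => x :: wrC b
  end.

Fixpoint waC (c : cmd) : seq nat :=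
  match c with
  | CNop | CSet _ _ => [::]
  | CSto a _ _ => [:: a]
  | CSeq c1 c2 | CIf _ c1 c2 => waC c1 ++ waC c2
  | CFor _ _ b => waC b
  end.

Fixpoint limsC (c : cmd) : seq nat :=
  match c with
  | CNop => [::]
  | CSet _ e => limsE e
  | CSto _ i e => limsE i ++ limsE e
  | CSeq c1 c2 => limsC c1 ++ limsC c2
  | CIf e c1 c2 => limsE e ++ limsC c1 ++ limsC c2
  | CFor _ l b => l :: limsC b
  end.

(** The compiled loop compares limit and counter anew at each turn, whereas [run] fixes the number
    of turns at the start. The two agree because the body may write neither register. *)
Fixpoint wfC (c : cmd) : bool :=
  match c with
  | CNop => true
  | CSet r e => (r < 70) && wfE [::] e
  | CSto a i e => [&& a < 32, wfE [::] i & wfE [::] e]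
  | CSeq c1 c2 => wfC c1 && wfC c2
  | CIf e c1 c2 => [&& wfE [::] e, wfC c1 & wfC c2]
  | CFor x l b => [&& x < 70, l < 70, x != l, x \notin wrC b, l \notin wrC b & wfC b]
  end.

Fixpoint tC (ro : nat -> nat) (c : cmd) : nat :=
  match c with
  | CNop => 1
  | CSet _ e => tE ro e + 2
  | CSto _ i e => tE ro i + tE ro e + 25
  | CSeq c1 c2 => tC ro c1 + tC ro c2
  | CIf e c1 c2 => tE ro e + tC ro c1 + tC ro c2 + 2
  | CFor _ l b => 6 + ro l * (tC ro b + 8)
  end.

(** * Compilation to the random access machine *)

Definition dbl t := Set_ t (Add (Reg t) (Reg t)).
(** The machine only adds and subtracts, so the factor 32 is five doublings. Interleaving the arrays
    modulo 32 lets each of them grow without a bound known to the program. *)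
Definition mul32 t := Seq (dbl t) (Seq (dbl t) (Seq (dbl t) (Seq (dbl t) (dbl t)))).

Fixpoint codeE (e : ex) (t : nat) : prog :=
  match e with
  | XLit v => Set_ t (Lit v)
  | XVar r => Set_ t (Reg r)
  | XArr a i => Seq (codeE i t) (Seq (mul32 t) (Set_ t (Read (Add (Reg t) (Lit a)))))
  | XAdd e1 e2 => Seq (codeE e1 t) (Seq (codeE e2 t.+1) (Set_ t (Add (Reg t) (Reg t.+1))))
  | XSub e1 e2 => Seq (codeE e1 t) (Seq (codeE e2 t.+1) (Set_ t (Defs.Sub (Reg t) (Reg t.+1))))
  | XIte e1 e2 e3 => Seq (codeE e1 t) (If (Reg t) (codeE e2 t) (codeE e3 t))
  | XSum x l b => Seq (Set_ t (Lit 0)) (Seq (Set_ x (Lit 0))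
      (While (Defs.Sub (Reg l) (Reg x)) (Seq (codeE b t.+1)
         (Seq (Set_ t (Add (Reg t) (Reg t.+1))) (Set_ x (Add (Reg x) (Lit 1)))))))
  end.

Fixpoint codeC (c : cmd) : prog :=
  match c with
  | CNop => Skip
  | CSet r e => Seq (codeE e 100) (Set_ r (Reg 100))
  | CSto a i e => Seq (codeE i 100) (Seq (codeE e 101)
      (Seq (mul32 100) (Store (Add (Reg 100) (Lit a)) (Reg 101))))
  | CSeq c1 c2 => Seq (codeC c1) (codeC c2)
  | CIf e c1 c2 => Seq (codeE e 100) (If (Reg 100) (codeC c1) (codeC c2))
  | CFor x l b => Seq (Set_ x (Lit 0))
      (While (Defs.Sub (Reg l) (Reg x)) (Seq (codeC b) (Set_ x (Add (Reg x) (Lit 1)))))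
  end.

(** * Total correctness with time bounds *)

Definition runs (p : prog) (s : state) (b : nat) (Q : state -> Prop) :=
  exists t s', [/\ exec p s t s', t <= b & Q s'].

Lemma runs_set x e s (Q : state -> Prop) :
  Q (State (upd (reg s) x (eval s e)) (Defs.mem s)) -> runs (Set_ x e) s (ecost e).+1 Q.
Proof. by move=> H; exists (ecost e).+1; eexists; split; [exact: ExecSet| |exact: H]. Qed.

Lemma runs_store a e s (Q : state -> Prop) :
  Q (State (reg s) (upd (Defs.mem s) (eval s a) (eval s e))) ->
  runs (Store a e) s (ecost a + ecost e).+1 Q.
Proof. by move=> H; eexists; eexists; split; [exact: ExecStore| |exact: H]. Qed.

Lemma runs_seq p q s b1 b2 (Q R : state -> Prop) :
  runs p s b1 Q -> (forall s', Q s' -> runs q s' b2 R) -> runs (Seq p q) s (b1 + b2) R.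
Proof.
move=> [t1 [s1 [e1 l1 q1]]] /(_ _ q1) [t2 [s2 [e2 l2 q2]]].
by exists (t1 + t2), s2; split; [exact: ExecSeq e1 e2|exact: leq_add|].
Qed.

Lemma runs_weak p s b b' (Q R : state -> Prop) :
  runs p s b Q -> b <= b' -> (forall s', Q s' -> R s') -> runs p s b' R.
Proof.
move=> [t [s' [e l q]]] lb QR; exists t, s'; split=> //; [exact: leq_trans lb|exact: QR].
Qed.

Lemma runs_if e p q s b1 b2 (Q : state -> Prop) :
  (eval s e != 0 -> runs p s b1 Q) -> (eval s e = 0 -> runs q s b2 Q) ->
  runs (If e p q) s ((ecost e).+1 + (b1 + b2)) Q.
Proof.
have [e0|e0] := eqVneq (eval s e) 0; move=> H1 H2.
  have [t [s' [x l q']]] := H2 e0; exists ((ecost e).+1 + t), s'; split=> //.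
    exact: ExecIfFalse.
  by rewrite leq_add2l (leq_trans l) ?leq_addl.
have [t [s' [x l q']]] := H1 isT; exists ((ecost e).+1 + t), s'; split=> //.
  exact: ExecIfTrue.
by rewrite leq_add2l (leq_trans l) ?leq_addr.
Qed.

(* A counting loop: [I i] holds when the test is reached for the i-th time. *)
Lemma runs_for e p s b m (I : nat -> state -> Prop) :
  I 0 s -> (forall i s', I i s' -> eval s' e = m - i) ->
  (forall i s', i < m -> I i s' -> runs p s' b (I i.+1)) ->
  runs (While e p) s ((ecost e).+1 + m * (b + (ecost e).+1)) (I m).
Proof.
move=> I0 Ie Ib.
suff H j : forall i s', i + j = m -> I i s' ->
    runs (While e p) s' ((ecost e).+1 + j * (b + (ecost e).+1)) (I m).
  exact: H (add0n m) I0.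
elim: j => [|j IHj] i s' ij Ii.
  rewrite addn0 in ij; subst i; exists (ecost e).+1, s'; split=> //.
  - by apply: ExecWhileFalse; rewrite (Ie _ _ Ii) subnn.
  - by rewrite mul0n addn0.
have im : i < m by lia.
have [t1 [s1 [e1 l1 q1]]] := Ib _ _ im Ii.
have [||t2 [s2 [e2 l2 q2]]] := IHj i.+1 s1 => //; first lia.
exists ((ecost e).+1 + t1 + t2), s2; split=> //.
  by apply: ExecWhileTrue e1 e2; rewrite (Ie _ _ Ii); lia.
rewrite mulSn; lia.
Qed.

Lemma runs_mul32 t s (Q : state -> Prop) :
  (forall r', r' t = 32 * reg s t -> (forall r, r != t -> r' r = reg s r) -> Q (State r' (Defs.mem s))) ->
  runs (mul32 t) s 20 Q.
Proof.
move=> H; rewrite /mul32 -[20]/(4 + (4 + (4 + (4 + 4)))).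
do 4! (apply: (runs_seq (Q := eq _)); [exact: runs_set erefl|move=> _ <-]).
apply: runs_set; apply: H => [|r /negbTE rt]; rewrite /= /upd ?eqxx ?rt //; lia.
Qed.

Definition memrel (ar : nat -> nat -> nat) (m : nat -> nat) :=
  forall a i, a < 32 -> m (32 * i + a) = ar a i.

(** Registers from 100 up to [t] hold pending intermediate results and must survive. The valuation
    [g] stands in for the register file, because the body of a sum is evaluated under an updated
    bound variable while [ro] still has to bound the limits. *)
Lemma codeE_ok ro mm a : memrel a mm -> forall e bs t g s, wfE bs e -> 100 <= t ->
  Defs.mem s = mm ->
  (forall r, (r < 70) || (r \in bs) -> reg s r = g r) ->
  {in bs, forall r, 70 <= r < 100} ->
  (forall l, l \in limsE e -> g l <= ro l) ->
  runs (codeE e t) s (tE ro e) (fun s' => [/\ reg s' t = ev g a e, Defs.mem s' = mm &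
    forall r, (r < 70) || (r \in bs) || (100 <= r < t) -> reg s' r = reg s r]).
Proof.
move=> ma; elim=> [v|r|b i IH|e1 IH1 e2 IH2|e1 IH1 e2 IH2|e1 IH1 e2 IH2 e3 IH3|x l b IH]
  bs t g s /= wf t100 ms gs bss lims.
- apply: runs_set; split=> //=; first by rewrite /upd eqxx.
  move=> r h; rewrite /upd; case: eqP => // ?; subst r.
  by case/orP: h => [/orP[|/bss]|]; lia.
- apply: runs_set; split=> //=; first by rewrite /upd eqxx gs.
  move=> r' h; rewrite /upd; case: eqP => // ?; subst r'.
  by case/orP: h => [/orP[|/bss]|]; lia.
- case/andP: wf => b32 wf.
  apply: (runs_seq (IH bs t g s wf t100 ms gs bss lims)) => s1 [r1 m1 o1].
  rewrite -[25]/(20 + 5); apply: (runs_seq (Q := fun s' => [/\ reg s' t = 32 * ev g a i, Defs.mem s' = mm & forall r, r != t -> reg s' r = reg s1 r])).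
    by apply: runs_mul32 => r' h1 h2; split=> //=; rewrite h1 r1.
  move=> s2 [r2 m2 o2]; apply: runs_set; split=> //=.
    by rewrite /upd eqxx r2 m2 ma.
  move=> r h; rewrite /upd; have tr: r != t.
    by apply/eqP => ?; subst r; case/orP: h => [/orP[|/bss]|]; lia.
  by rewrite (negbTE tr) o2 // o1.
- case/andP: wf => wf1 wf2; rewrite -addnA.
  apply: (runs_seq (IH1 bs t g s wf1 t100 ms gs bss _)) => [l h|s1 [r1 m1 o1]].
    by apply: lims; rewrite mem_cat h.
  apply: (runs_seq (IH2 bs t.+1 g s1 wf2 _ m1 _ bss _)) => [|r h|l h|s2 [r2 m2 o2]].
  + lia.
  + by rewrite o1 ?gs // h.
  + by apply: lims; rewrite mem_cat h orbT.
  apply: runs_set; split=> //=.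
    by rewrite /upd eqxx r2 o2 ?r1 //; lia.
  move=> r h; rewrite /upd; have tr: r != t.
    by apply/eqP => ?; subst r; case/orP: h => [/orP[|/bss]|]; lia.
  by rewrite (negbTE tr) o2 ?o1 //; case/orP: h => [->|]//; lia.
- case/andP: wf => wf1 wf2; rewrite -addnA.
  apply: (runs_seq (IH1 bs t g s wf1 t100 ms gs bss _)) => [l h|s1 [r1 m1 o1]].
    by apply: lims; rewrite mem_cat h.
  apply: (runs_seq (IH2 bs t.+1 g s1 wf2 _ m1 _ bss _)) => [|r h|l h|s2 [r2 m2 o2]].
  + lia.
  + by rewrite o1 ?gs // h.
  + by apply: lims; rewrite mem_cat h orbT.
  apply: runs_set; split=> //=.
    by rewrite /upd eqxx r2 o2 ?r1 //; lia.
  move=> r h; rewrite /upd; have tr: r != t.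
    by apply/eqP => ?; subst r; case/orP: h => [/orP[|/bss]|]; lia.
  by rewrite (negbTE tr) o2 ?o1 //; case/orP: h => [->|]//; lia.
- case/and3P: wf => wf1 wf2 wf3.
  have -> : tE ro e1 + tE ro e2 + tE ro e3 + 2 = tE ro e1 + (2 + (tE ro e2 + tE ro e3)) by lia.
  apply: (runs_seq (IH1 bs t g s wf1 t100 ms gs bss _)) => [l h|s1 [r1 m1 o1]].
    by apply: lims; rewrite mem_cat h.
  have g1 r : (r < 70) || (r \in bs) -> reg s1 r = g r by move=> h; rewrite o1 ?gs ?h.
  apply: (runs_if (b1 := tE ro e2) (b2 := tE ro e3)); rewrite /= r1.
    move=> ->; apply: (runs_weak (IH2 bs t g s1 wf2 t100 m1 g1 bss _)) => // [l h|s' [-> -> o']].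
      by apply: lims; rewrite !mem_cat h orbT.
    by split=> // r h; rewrite o' // o1.
  move=> ->; apply: (runs_weak (IH3 bs t g s1 wf3 t100 m1 g1 bss _)) => // [l h|s' [-> -> o']].
    by apply: lims; rewrite !mem_cat h !orbT.
  by split=> // r h; rewrite o' // o1.
case/and4P: wf => x70 xbs l70 wf.
have lro : g l <= ro l by apply: lims; rewrite inE eqxx.
apply: (@runs_weak _ _ (2 + (2 + (4 + g l * (tE ro b + 8 + 4)))) _
  (fun s' => [/\ reg s' t = ev g a (XSum x l b), Defs.mem s' = mm, reg s' x = g l &
    forall r, ((r < 70) || (r \in bs) || (100 <= r < t)) && (r != x) -> reg s' r = reg s r])).
- apply: (runs_seq (Q := fun s' => [/\ reg s' t = 0, Defs.mem s' = mm & forall r, r != t -> reg s' r = reg s r])).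
    by apply: runs_set; split=> //= [|r /negbTE h]; rewrite /upd ?eqxx ?h.
  move=> s1 [r1 m1 o1].
  apply: (runs_seq (Q := fun s' => [/\ reg s' t = 0, reg s' x = 0, Defs.mem s' = mm & forall r, r != t -> r != x -> reg s' r = reg s r])).
    apply: runs_set; split=> //= [||r h1 /negbTE h2]; rewrite /upd ?eqxx //.
    - by case: eqP => // ?; lia.
    - by rewrite h2 o1.
  move=> s2 [r2 r2' m2 o2].
  pose I i (s' : state) := [/\ reg s' t = \sum_(j < i) ev (upd g x j) a b, reg s' x = i, Defs.mem s' = mm &
    forall r, ((r < 70) || (r \in bs) || (100 <= r < t)) && (r != x) -> reg s' r = reg s r].
  have nt r : (r < 70) || (r \in bs) || (100 <= r < t) -> r != t.
    by move=> h; apply/eqP => ?; subst r; case/orP: h => [/orP[|/bss]|]; lia.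
  apply: (runs_weak (b := 4 + g l * (tE ro b + 8 + 4)) (Q := I (g l))); first last.
  + by move=> s' [].
  + by lia.
  apply: (@runs_for _ _ _ _ _ I).
  + split=> //; first by rewrite big_ord0.
    by move=> r /andP[h1 h2]; rewrite o2 // nt.
  + move=> i s' [h1 h2 h3 h4] /=; rewrite h2 h4 ?gs ?l70 //=.
    by apply/eqP => ?; lia.
  + move=> i s' il [h1 h2 h3 h4]; rewrite -[8]/(4 + 4).
    apply: (runs_seq (IH (x :: bs) t.+1 (upd g x i) s' wf _ h3 _ _ _)).
    * lia.
    * move=> r; rewrite inE /upd; case: eqP => [->|/eqP nx] //= h.
      by rewrite h4 ?gs // h nx.
    * by move=> r; rewrite inE => /orP[/eqP->|/bss].
    (* Limit registers are below 70 and bound variables are not, so updating [x] changes no limit of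
       the body. *)
    * move=> l' h; rewrite /upd; case: eqP => [?|_].
        subst l'; have : x < 70.
          have F : forall e bs', wfE bs' e -> forall z, z \in limsE e -> z < 70.
            elim=> //= [? ? F1 ? /andP[_ h']|? F1 ? F2 ? /andP[h1' h2']|? F1 ? F2 ? /andP[h1' h2']|? F1 ? F2 ? F3 ? /and3P[h1' h2' h3']|? ? ? F1 ? /and4P[_ _ h1' h2']] z.
            - exact: F1 h' _.
            - by rewrite mem_cat => /orP[]; [exact: F1 h1' _|exact: F2 h2' _].
            - by rewrite mem_cat => /orP[]; [exact: F1 h1' _|exact: F2 h2' _].
            - by rewrite !mem_cat => /or3P[]; [exact: F1 h1' _|exact: F2 h2' _|exact: F3 h3' _].
            - by rewrite inE => /orP[/eqP->//|]; exact: F1 h2' _.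
          exact: F wf _ h.
        lia.
      by apply: lims; rewrite inE h orbT.
    move=> s3 [r3 m3 o3].
    apply: (runs_seq (Q := fun s' => [/\ reg s' t = \sum_(j < i.+1) ev (upd g x j) a b, Defs.mem s' = mm, reg s' x = i & forall r, ((r < 70) || (r \in bs) || (100 <= r < t)) && (r != x) -> reg s' r = reg s r])).
      apply: runs_set; split=> //=.
      - rewrite /upd eqxx r3 o3; last lia.
        by rewrite h1 big_ord_recr.
      - rewrite /upd; case: eqP => [|_]; first lia.
        by rewrite o3 ?inE ?eqxx ?orbT.
      - move=> r h; have /andP[h' h''] := h.
        rewrite /upd (negbTE (nt _ h')) o3 ?h4 // inE.
        by case/orP: h' => [/orP[-> //|->]|h3']; rewrite ?orbT //; lia.
    move=> s4 [r4 m4 x4 o4]; apply: runs_set; split=> //=.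
    * by rewrite /upd; case: eqP => [|_]; [lia|].
    * by rewrite /upd eqxx x4 addn1.
    * by move=> r h; rewrite /upd; have /andP[_ /negbTE ->] := h; exact: o4.
- by have := leq_mul lro (leqnn (tE ro b + 12)); lia.
- move=> s' [h1 h2 h3 h4]; split=> // r h; apply: h4; rewrite h /=.
  apply/eqP => ?; subst r; case/orP: h => [/orP[|]|]; last lia.
  + lia.
  + by move/negP: xbs.
Qed.

Lemma run_rg c s r : r \notin wrC c -> rg (run c s) r = rg s r.
Proof.
elim: c s => //= [x e|c1 IH1 c2 IH2|e c1 IH1 c2 IH2|x l b IH] s.
- by rewrite inE /upd => /negbTE ->.
- by rewrite mem_cat => /norP[h1 h2]; rewrite IH2 // IH1.
- by rewrite mem_cat => /norP[h1 h2]; case: ifP => _; [exact: IH1|exact: IH2].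
rewrite inE => /norP[/negbTE h1 h2].
elim: (rg s l) => [|m IHm] /=; first by rewrite /upd h1.
by rewrite /upd h1 IH.
Qed.

Lemma run_ar c s a i : a \notin waC c -> ar (run c s) a i = ar s a i.
Proof.
elim: c s => //= [b j e|c1 IH1 c2 IH2|e c1 IH1 c2 IH2|x l b IH] s.
- by rewrite inE => /negbTE ->.
- by rewrite mem_cat => /norP[h1 h2]; rewrite IH2 // IH1.
- by rewrite mem_cat => /norP[h1 h2]; case: ifP => _; [exact: IH1|exact: IH2].
by move=> h; elim: (rg s l) => [|m IHm] //=; rewrite IH.
Qed.

Definition sim (s : st) (m : state) :=
  (forall r, r < 70 -> reg m r = rg s r) /\ memrel (ar s) (Defs.mem m).

(** [W] contains the registers written by the whole program. The limits lie outside [W] and keep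
    their initial values, so bounding them in the initial state is enough for the time bound. *)
Lemma codeC_ok ro (W : seq nat) c : wfC c -> {subset wrC c <= W} ->
  (forall l, l \in limsC c -> l \notin W) ->
  forall s m, sim s m -> (forall l, l \in limsC c -> rg s l <= ro l) ->
  runs (codeC c) m (tC ro c) (sim (run c s)).
Proof.
elim: c => /= [|x e|a i e|c1 IH1 c2 IH2|e c1 IH1 c2 IH2|x l b IH] wf sW lW s m sm lims.
- by exists 1, m; split=> //; exact: ExecSkip.
- case/andP: wf => x70 wf; have [sr sa] := sm.
  have h := @codeE_ok ro _ _ sa e [::] 100 (rg s) m wf isT erefl _ _ lims.
  apply: (runs_seq (h _ _)) => // [r|s1 [r1 m1 o1]]; first by rewrite orbF; exact: sr.
  apply: runs_set; split=> /= [r r70|]; last by rewrite m1.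
  rewrite /upd; case: eqP => // _; rewrite o1 ?sr ?r70 //.
- case/and3P: wf => a32 wf1 wf2; have [sr sa] := sm.
  have -> : tE ro i + tE ro e + 25 = tE ro i + (tE ro e + (20 + 5)) by lia.
  have h1 := @codeE_ok ro _ _ sa i [::] 100 (rg s) m wf1 isT erefl.
  apply: (runs_seq (h1 _ _ _)) => // [r|l h|s1 [r1 m1 o1]].
  + by rewrite orbF; exact: sr.
  + by apply: lims; rewrite mem_cat h.
  have h2 := @codeE_ok ro _ _ sa e [::] 101 (rg s) s1 wf2 isT m1.
  apply: (runs_seq (h2 _ _ _)) => // [r|l h|s2 [r2 m2 o2]].
  + by move=> h; rewrite o1 ?h //; apply: sr; rewrite orbF in h.
  + by apply: lims; rewrite mem_cat h orbT.
  apply: (runs_seq (Q := fun s' => [/\ reg s' 100 = 32 * evs s i, Defs.mem s' = Defs.mem m & forall r, r != 100 -> reg s' r = reg s2 r])).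
    by apply: runs_mul32 => r' q1 q2; split=> //=; rewrite q1 o2 ?r1.
  move=> s3 [r3 m3 o3]; apply: runs_store; split=> /= [r r70|].
    by rewrite o3 ?o2 ?o1 ?sr ?r70 //; case: eqP => // ?; lia.
  move=> b j b32; rewrite /= /upd r3 o3 // r2 m3.
  rewrite (_ : (32 * j + b == 32 * evs s i + a) = (b == a) && (j == evs s i)).
    by case: ifP => // _; exact: sa.
  by apply/eqP/andP => [h|[/eqP-> /eqP->]//]; split; apply/eqP; lia.
- case/andP: wf => wf1 wf2.
  apply: (runs_seq (IH1 wf1 _ _ s m sm _)) => [r h|l h|l h|s1 sm1].
  + by apply: sW; rewrite mem_cat h.
  + by apply: lW; rewrite mem_cat h.
  + by apply: lims; rewrite mem_cat h.
  apply: (IH2 wf2) => // [r h|l h|l h].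
  + by apply: sW; rewrite mem_cat h orbT.
  + by apply: lW; rewrite mem_cat h orbT.
  have lin : l \in limsC c1 ++ limsC c2 by rewrite mem_cat h orbT.
  rewrite run_rg; first exact: lims.
  by apply: contra (lW _ lin) => h'; apply: sW; rewrite mem_cat h'.
- case/and3P: wf => wf wf1 wf2; have [sr sa] := sm.
  have h := @codeE_ok ro _ _ sa e [::] 100 (rg s) m wf isT erefl.
  have -> : tE ro e + tC ro c1 + tC ro c2 + 2 = tE ro e + (2 + (tC ro c1 + tC ro c2)) by lia.
  apply: (runs_seq (h _ _ _)) => // [r|l h'|s1 [r1 m1 o1]].
  + by rewrite orbF; exact: sr.
  + by apply: lims; rewrite mem_cat h'.
  have sm1 : sim s s1.
    by split=> [r r70|]; [rewrite o1 ?r70 // sr|rewrite m1].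
  apply: (runs_if (b1 := tC ro c1) (b2 := tC ro c2)); rewrite /= r1 -/(evs s e).
  + move=> ->; apply: IH1 => // [r h'|l h'|l h'].
    * by apply: sW; rewrite mem_cat h'.
    * by apply: lW; rewrite !mem_cat h' orbT.
    * by apply: lims; rewrite !mem_cat h' orbT.
  + move=> -> /=; apply: IH2 => // [r h'|l h'|l h'].
    * by apply: sW; rewrite mem_cat h' orbT.
    * by apply: lW; rewrite !mem_cat h' !orbT.
    * by apply: lims; rewrite !mem_cat h' !orbT.
case/and5P: wf => x70 l70 xl xb /andP[lb wf].
have lro : rg s l <= ro l by apply: lims; rewrite inE eqxx.
pose f i (s' : st) := setr (run b s') x i.+1.
pose I i (m' : state) := sim (iteri i f (setr s x 0)) m'.
have Ix i : rg (iteri i f (setr s x 0)) x = i.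
  by case: i => [|i] /=; rewrite /upd eqxx.
have Iw i r : r \notin x :: wrC b -> rg (iteri i f (setr s x 0)) r = rg s r.
  rewrite inE => /norP[/negbTE h1 h2].
  by elim: i => [|i IHi] /=; rewrite /upd h1 // run_rg.
apply: (@runs_weak _ _ (2 + (4 + rg s l * (tC ro b + 4 + 4))) _ (I (rg s l))) => //; last first.
  by have := leq_mul lro (leqnn (tC ro b + 8)); lia.
have [sr sa] := sm.
apply: (runs_seq (Q := I 0)).
  apply: runs_set; split=> //= r r70; rewrite /upd; case: eqP => // _; exact: sr.
move=> s1 I0; apply: (@runs_for _ _ _ _ _ I) => // [i s' [h1 h2]|i s' il Ii].
  by rewrite /= (h1 _ l70) (h1 _ x70) Ix Iw // inE negb_or eq_sym xl.
apply: (runs_seq (IH wf _ _ _ _ Ii _)) => [r h|l' h|l' h|s2 [h1 h2]].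
- by apply: sW; rewrite inE h orbT.
- by apply: lW; rewrite inE h orbT.
- have lin : l' \in l :: limsC b by rewrite inE h orbT.
  rewrite Iw; first exact: lims.
  by apply: contra (lW _ lin); exact: sW.
apply: runs_set; split=> //= r r70; rewrite /upd; case: eqP => [_|_]; last exact: h1.
by rewrite h1 // run_rg // Ix addn1.
Qed.

(** No loop limit is assigned anywhere in the same program; this is why the constants are computed
    by separate programs that run beforehand. *)
Definition okC c := wfC c && all (fun l => l \notin wrC c) (limsC c).

Lemma okC_ok ro c s m : okC c -> sim s m -> (forall l, l \in limsC c -> rg s l <= ro l) ->
  runs (codeC c) m (tC ro c) (sim (run c s)).
Proof. by case/andP=> wf /allP h; exact: codeC_ok (fun _ => id) h _ _. Qed.

(** * Certificates *)

Lemma card_bigcup_disjoint (I T : finType) (P : pred I) (S : I -> {set T}) :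
  (forall i j, P i -> P j -> i != j -> [disjoint S i & S j]) ->
  #|\bigcup_(i | P i) S i| = \sum_(i | P i) #|S i|.
Proof.
move=> H; rewrite big_mkcond [RHS]big_mkcond /= -sum1_card.
rewrite partition_disjoint_bigcup => [|i j ij].
  by apply: eq_bigr => i _; rewrite sum1_card; case: ifP; rewrite ?cards0.
case: ifP => hi; last by rewrite -setI_eq0 set0I.
by case: ifP => hj; [exact: H|rewrite -setI_eq0 setI0].
Qed.

Section Certificates.

Variables (V E : finType) (es et : E -> V) (anc : rel V) (root : V).
Hypothesis anc_refl : reflexive anc.
Hypothesis anc_trans : transitive anc.
Hypothesis anc_anti : antisymmetric anc.
Hypothesis anc_tot : forall v w x, anc v x -> anc w x -> anc v w || anc w v.

Definition sep f e := anc f (es e) != anc f (et e).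
Definition D f := [set e | sep f e].
Definition DX (X : {set V}) := \bigcup_(f in X) D f.

(** If one end were below [h], then [h] and [f] would have a common descendant and be comparable, so
    [h] would lie above [f] and above both ends. *)
Lemma sep_outside f h e : ~~ anc f h -> anc f (es e) -> anc f (et e) -> e \notin D h.
Proof.
move=> fh f1 f2; rewrite inE negbK; apply/eqP; apply/idP/idP => h1.
  by case/orP: (anc_tot h1 f1) => [hf|/(negP fh)//]; exact: anc_trans hf f2.
by case/orP: (anc_tot h1 f2) => [hf|/(negP fh)//]; exact: anc_trans hf f1.
Qed.

Definition isend e y := (es e == y) || (et e == y).

Lemma D_end g e : e \in D g -> exists2 y, isend e y & anc g y.
Proof.
rewrite inE /sep; case h1: (anc g (es e)) => h2.
  by exists (es e); rewrite // /isend eqxx.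
exists (et e); first by rewrite /isend eqxx orbT.
by case: (anc g (et e)) h2.
Qed.

Lemma D_ends w e y z : isend e y -> isend e z -> anc w y -> ~~ anc w z -> e \in D w.
Proof.
by rewrite inE /sep => /orP[] /eqP <- /orP[] /eqP <- a1 /negbTE a2; rewrite ?a1 ?a2 //;
  rewrite a1 in a2.
Qed.

Lemma D_inside g f e : e \in D g -> anc f g -> e \notin D f -> anc f (es e) /\ anc f (et e).
Proof.
move=> eg fg; have [y ye gy] := D_end eg; have fy := anc_trans fg gy.
rewrite inE negbK /sep => /eqP h; case/orP: ye => /eqP ye; move: fy; rewrite -ye.
  by move=> h1; rewrite -h h1.
by move=> h1; rewrite h h1.
Qed.

Definition incomp f g := ~~ anc f g && ~~ anc g f.

Lemma incomp_disj f g y : incomp f g -> anc f y -> ~~ anc g y.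
Proof.
move=> /andP[h1 h2] fy; apply/negP => gy.
by case/orP: (anc_tot fy gy) => h; [rewrite h in h1|rewrite h in h2].
Qed.

Lemma incompC f g : incomp f g = incomp g f. Proof. exact: andbC. Qed.

Lemma incomp_below f g f' g' : incomp f g -> anc f f' -> anc g g' -> incomp f' g'.
Proof.
move=> i ff gg; apply/andP; split; apply/negP => h.
  by move/negP: (incomp_disj i (anc_trans ff h)); apply.
by move: i; rewrite incompC => i; move/negP: (incomp_disj i (anc_trans gg h)); apply.
Qed.

Lemma D_incomp f g e : incomp f g -> e \in D f -> e \in D g ->
  exists y z, [/\ isend e y, isend e z, anc f y & anc g z].
Proof.
move=> i /D_end[y ye fy] /D_end[z ze gz]; by exists y, z.
Qed.

Variable lam : nat.
Definition okv v := (v != root) && (#|D v| <= lam).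
(** All that is required of these functions: [top x x'] lies above every admissible cut separating
    [x] from [x'], and [vsel w] reaches all ends of edges of [D w], two for each of at most [lam]
    edges. *)
Variables (top : V -> V -> V) (vsel : V -> nat -> V).
Hypothesis top_ok : forall x x' f, okv f -> anc f x -> ~~ anc f x' ->
  [/\ okv (top x x'), anc (top x x') x, ~~ anc (top x x') x' & anc (top x x') f].
Definition vis w y := [exists e in D w, isend e y].
Hypothesis vsel_ok : forall w y, #|D w| <= lam -> vis w y ->
  exists2 t, t < 2 * lam & vsel w t = y.

(* Slot i of a guess: dg holds, in blocks of length J, the flags "used", the
   pair of known leaves whose top edge is explored, the leaf bounding the chain,
   and the numbers of further cuts below and beside the chain; dt holds the
   number of the boundary vertex. *)
Variable J : nat.
Implicit Types (dg dt : nat -> nat).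

Definition dused dg i := dg i != 0.
Definition da dg i := dg (J + i).
Definition db dg i := dg (J + (J + i)).
Definition dp dg i := dg (J + (J + (J + i))).
Definition dbel dg i := dg (J + (J + (J + (J + i)))).
Definition dbes dg i := dg (J + (J + (J + (J + (J + i))))).

(** Index 0 stands for the starting cut [c]; the leaf found in slot i therefore has number i + 1. *)
Definition src c dg (s : seq V) i :=
  if da dg i == 0 then c else top (nth c s (da dg i)) (nth c s (db dg i)).

Fixpoint xsq c dg dt i : seq V :=
  if i is i'.+1 then
    rcons (xsq c dg dt i') (vsel (src c dg (xsq c dg dt i') i') (dt i'))
  else [:: c].

Definition leaf c dg dt i := nth c (xsq c dg dt J) i.
Definition ctop c dg dt i := top (leaf c dg dt i.+1) (leaf c dg dt (dp dg i)).

Definition guess_ok dg dt :=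
  (forall i, i < 6 * J -> dg i < J.+1) /\ (forall i, i < J -> dt i < 2 * lam).

Definition slot_ok u c dg dt i :=
  let w := ctop c dg dt i in
  [&& w != root, anc w (leaf c dg dt i.+1), anc u w, ~~ anc w c &
      (u == c) || ~~ anc c w].

Definition valid s u c dg dt :=
  [/\ forall i : 'I_J, dused dg i -> slot_ok u c dg dt i,
      forall i j : 'I_J, dused dg i -> dused dg j -> i != j ->
        ~~ anc (ctop c dg dt i) (ctop c dg dt j)
    & \sum_(i < J | dused dg i) (1 + dbel dg i + dbes dg i) = s].

(* A cut at the very top of the chain leaves no room beside it. *)
Definition on_chain c dg dt i p :=
  [&& anc (ctop c dg dt i) p, anc p (leaf c dg dt i.+1), okv p &
      (ctop c dg dt i != p) || (dbes dg i == 0)].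

Definition front dg (p : 'I_J -> V) := [set p i | i : 'I_J & dused dg i].

(* A certificate places one cut p i on each of the chains described by a guess, and
   recursively the remaining cuts below and beside these. *)
Inductive Cert : nat -> V -> V -> {set V} -> nat -> Prop :=
  | Cert0 u c : Cert 0 u c set0 0
  | CertS s u c dg dt p XB XG vB vG :
      0 < s -> guess_ok dg dt -> valid s u c dg dt ->
      (forall i : 'I_J, dused dg i -> on_chain c dg dt i (p i)) ->
      (forall i : 'I_J, dused dg i -> Cert (dbel dg i) (p i) (p i) (XB i) (vB i)) ->
      (forall i : 'I_J, dused dg i ->
         Cert (dbes dg i) (ctop c dg dt i) (p i) (XG i) (vG i)) ->
      Cert s u c (\bigcup_(i < J | dused dg i) (p i |: (XB i :|: XG i)))
        (#|DX (front dg p) :\: D c| + \sum_(i < J | dused dg i) (vB i + vG i)).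

(** For [anc u c] one pair encodes both kinds of subproblem: if [u == c], the cuts strictly below
    [c]; otherwise the cuts below [u] that are incomparable with [c]. *)
Definition region u c (X : {set V}) := forall g, g \in X ->
  [&& okv g, anc u g, ~~ anc g c & (u == c) || ~~ anc c g].

Lemma DXP (X : {set V}) e : reflect (exists2 f, f \in X & e \in D f) (e \in DX X).
Proof. exact: bigcupP. Qed.

(** The chain tops are pairwise incomparable, so the pieces are disjoint and their sizes add up. For
    the cost a union bound suffices: an edge may be charged several times, which only makes the
    value too large. *)
Lemma cert_sound s u c X v : Cert s u c X v -> anc u c ->
  [/\ #|X| = s, region u c X & #|DX X :\: D c| <= v].
Proof.
elim=> {s u c X v} [u c _|s u c dg dt p XB XG vB vG s0 gd [va1 va2 va3] ch cB IB cG IG uc].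
  split=> [|g|]; rewrite ?cards0 ?inE //.
  by rewrite /DX big_set0 set0D cards0.
pose w i := ctop c dg dt i.
have wp (i : 'I_J) : dused dg i -> anc (w i) (p i) by move=> h; case/and4P: (ch i h).
have winc (i j : 'I_J) : dused dg i -> dused dg j -> i != j -> incomp (w i) (w j).
  by move=> hi hj ij; rewrite /incomp va2 // va2 // eq_sym.
have {}IB (i : 'I_J) (h : dused dg i) := IB i h (anc_refl (p i)).
have {}IG (i : 'I_J) (h : dused dg i) := IG i h (wp i h).
pose S (i : 'I_J) := p i |: (XB i :|: XG i).
have below (i : 'I_J) g : dused dg i -> g \in XB i -> anc (p i) g && ~~ anc g (p i).
  by move=> h gB; have [_ r _] := IB i h; case/and4P: (r _ gB) => _ -> ->.
have beside (i : 'I_J) g : dused dg i -> g \in XG i -> incomp g (p i).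
  move=> h gG; have [cG' r _] := IG i h; case/and4P: (r _ gG) => _ _ h1.
  (* If the position is the top of its chain, the pair ([w i], [p i]) would be read as the problem
     below [p i]; [on_chain] makes the piece empty in that case. *)
  case/and4P: (ch i h) => _ _ _; case/orP => [/negbTE wnp|/eqP g0].
    by rewrite -/(w i) in wnp; rewrite wnp /= /incomp h1.
  by move: cG'; rewrite g0 => /cards0_eq XG0; rewrite XG0 inE in gG.
have wS (i : 'I_J) g : dused dg i -> g \in S i -> anc (w i) g.
  move=> h; rewrite !inE => /or3P[/eqP->|gB|gG]; first exact: wp.
    by have /andP[h' _] := below _ _ h gB; exact: anc_trans (wp i h) h'.
  by have [_ r _] := IG i h; case/and4P: (r _ gG).
have okS (i : 'I_J) g : dused dg i -> g \in S i -> okv g.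
  move=> h; rewrite !inE => /or3P[/eqP->|gB|gG]; first by case/and4P: (ch i h).
    by have [_ r _] := IB i h; case/and4P: (r _ gB).
  by have [_ r _] := IG i h; case/and4P: (r _ gG).
have cardS (i : 'I_J) : dused dg i -> #|S i| = 1 + dbel dg i + dbes dg i.
  move=> h; have [bc br _] := IB i h; have [gc gr _] := IG i h.
  have e1 : XB i :&: XG i = set0.
    apply/setP => g; rewrite !inE; apply/negP => /andP[gB gG].
    have /andP[h1 _] := below i g h gB; have := beside i g h gG.
    by rewrite /incomp h1 andbF.
  have e2 : p i \notin XB i :|: XG i.
    rewrite in_setU negb_or; apply/andP; split; apply/negP => h1.
      by have := below i _ h h1; rewrite anc_refl.
    by have := beside i _ h h1; rewrite /incomp anc_refl.
  by rewrite cardsU1 e2 cardsU e1 cards0 bc gc; lia.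
split.
- rewrite card_bigcup_disjoint => [|i j hi hj ij]; first by rewrite -va3; exact: eq_bigr.
  rewrite -setI_eq0; apply/eqP/setP => g; rewrite inE [RHS]inE; apply/negP => /andP[/(wS _ _ hi) h1 /(wS _ _ hj)].
  by apply/negP; exact: incomp_disj (winc _ _ hi hj ij) h1.
- move=> g /bigcupP[i h gS]; rewrite (okS _ _ h gS) /=.
  have wg := wS _ _ h gS; case/and5P: (va1 i h) => _ _ uw wc cw.
  rewrite (anc_trans uw wg) /=; apply/andP; split.
    by apply: contra wc; exact: anc_trans.
  case/orP: cw => [->//|cw]; apply/orP; right.
  have i2 : incomp (w i) c by rewrite /incomp wc.
  by have /andP[_] := incomp_below i2 wg (anc_refl c).
have sub : DX (\bigcup_(i < J | dused dg i) S i) :\: D c \subset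
    (DX (front dg p) :\: D c) :|: \bigcup_(i < J | dused dg i) ((DX (XB i) :\: D (p i)) :|: (DX (XG i) :\: D (p i))).
  apply/subsetP => e; rewrite inE => /andP[ec /DXP[g /bigcupP[i h gS] eg]].
  rewrite in_setU in_setD ec /=; case ep: (e \in D (p i)).
    by apply/orP; left; apply/DXP; exists (p i) => //; apply: imset_f; rewrite inE.
  apply/orP; right; apply/bigcupP; exists i => //.
  rewrite in_setU !in_setD ep /=; move: gS; rewrite in_setU1 in_setU.
  case/or3P => [/eqP gp|gB|gG]; first by rewrite gp ep in eg.
    by apply/orP; left; apply/DXP; exists g.
  by apply/orP; right; apply/DXP; exists g.
apply: leq_trans (subset_leq_card sub) _.
apply: leq_trans (leq_card_setU _ _) _; rewrite leq_add2l.
apply: (@leq_trans (\sum_(i < J | dused dg i) #|(DX (XB i) :\: D (p i)) :|: (DX (XG i) :\: D (p i))|)).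
  elim/big_rec2: _ => [|i n X _ h]; first by rewrite cards0.
  by apply: leq_trans (leq_card_setU _ _) _; rewrite leq_add2l.
apply: leq_sum => i h; apply: leq_trans (leq_card_setU _ _) _.
by have [_ _ h1] := IB i h; have [_ _ h2] := IG i h; exact: leq_add.
Qed.

(** With cuts adjacent when they share an edge, this says that every connected component of [c |: X]
    contains [c]. *)
Definition linked c (X : {set V}) := forall Y : {set V}, Y \subset X -> Y != set0 ->
  exists g h e, [/\ g \in Y, h \in c |: (X :\: Y), e \in D g & e \in D h].

(* A list of frontier cuts f with the leaves x below them, found one after the
   other: x_i is a boundary vertex of c or of a top edge of earlier leaves. *)
Definition explored c (F : {set V}) (l : seq (V * V)) :=
  [/\ uniq (map fst l), forall f x, (f, x) \in l -> (f \in F) && anc f x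
    & forall i, i < size l -> exists a b t, [/\ a <= i, b <= i, t < 2 * lam &
        (nth (c, c) l i).2 = vsel (if a == 0 then c else
           top (nth c (c :: map snd l) a) (nth c (c :: map snd l) b)) t]].

Lemma explored_max c F l : explored c F l -> exists2 l', explored c F l' &
  forall f x, ~ explored c F (rcons l' (f, x)).
Proof.
have [m] := ubnP (#|F| - size l); elim: m l => // m IH l lm el.
have [[f [x e]]|none] := classic (exists f x, explored c F (rcons l (f, x))).
  apply: (IH _ _ e); have [u sF _] := e.
  suff : size (rcons l (f, x)) <= #|F| by rewrite size_rcons; lia.
  rewrite -(size_map fst) -(card_uniqP u); apply: subset_leq_card.
  by apply/subsetP => g /mapP[[g' y] /sF/andP[h _] ->].
by exists l => // f x e; apply: none; exists f, x.
Qed.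

Definition frontier (X : {set V}) := [set f in X | [forall g in X, anc g f ==> (g == f)]].

Lemma frontier_above (X : {set V}) g : g \in X -> exists2 f, f \in frontier X & anc f g.
Proof.
move=> gX; pose P f := (f \in X) && anc f g.
have Pg : P g by rewrite /P gX anc_refl.
case: (arg_minnP (fun f => #|[set z | anc z f]|) Pg) => f /andP[fX fg] fmin.
exists f => //; rewrite inE fX /=; apply/forall_inP => h hX; apply/implyP => hf.
have sub : [set z | anc z h] \subset [set z | anc z f].
  by apply/subsetP => z; rewrite !inE => zh; exact: anc_trans zh hf.
have le : #|[set z | anc z f]| <= #|[set z | anc z h]|.
  by apply: fmin; rewrite /P hX; exact: anc_trans hf fg.
have /eqP E2 : [set z | anc z h] == [set z | anc z f] by rewrite eqEcard sub.
apply/eqP; apply: anc_anti; rewrite hf /=.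
by have : f \in [set z | anc z f]; [rewrite inE|rewrite -E2 inE].
Qed.

Lemma frontier_in (X : {set V}) f : f \in frontier X -> f \in X.
Proof. by rewrite inE => /andP[]. Qed.

Lemma frontier_max (X : {set V}) f g : f \in frontier X -> g \in X -> anc g f -> g = f.
Proof. by rewrite inE => /andP[_ /forall_inP h] gX gf; apply/eqP; move: (h _ gX); rewrite gf. Qed.

Lemma frontier_incomp (X : {set V}) f g : f \in frontier X -> g \in frontier X -> f != g -> incomp f g.
Proof.
move=> hf hg fg; apply/andP; split; apply/negP => h.
  by have := frontier_max hg (frontier_in hf) h => E2; rewrite E2 eqxx in fg.
by have := frontier_max hf (frontier_in hg) h => E2; rewrite E2 eqxx in fg.
Qed.

(* Among the top edges of a leaf towards the others, the lowest one separates it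
   from all of them. *)
Lemma lowest_top x f N (P : pred nat) (y : nat -> V) j0 : okv f -> anc f x ->
  j0 < N -> P j0 -> (forall j, j < N -> P j -> ~~ anc f (y j)) ->
  exists j, let w := top x (y j) in
    [/\ j < N, okv w, anc w x, anc w f & forall i, i < N -> P i -> ~~ anc w (y i)].
Proof.
move=> fok fx j0N Pj0 fy; pose tp (j : 'I_N) := top x (y j).
pose P' (j : 'I_N) := P j; have P'0 : P' (Ordinal j0N) by [].
case: (arg_minnP (fun j => #|[set z | anc (tp j) z]|) P'0) => j Pj jmin.
have T (i : 'I_N) (Pi : P i) := top_ok fok fx (fy _ (ltn_ord i) Pi).
have [t1 t2 t3 t4] := T j Pj.
exists j; split=> // i iN Pi; apply/negP => ty; pose oi := Ordinal iN.
have [_ u2 u3 _] := T oi Pi; rewrite /= in u2 u3.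
have no : ~~ anc (tp oi) (tp j).
  by apply: contra u3 => h; exact: anc_trans h ty.
case/orP: (anc_tot t2 u2) => h; last by rewrite /tp /= h in no.
have sub : [set z | anc (tp oi) z] \subset [set z | anc (tp j) z].
  by apply/subsetP => z; rewrite !inE; exact: anc_trans.
have /eqP E2 : [set z | anc (tp oi) z] == [set z | anc (tp j) z].
  by rewrite eqEcard sub jmin.
have : tp j \in [set z | anc (tp j) z] by rewrite inE.
by rewrite -E2 inE (negbTE no).
Qed.

Lemma size_xsq c dg dt i : size (xsq c dg dt i) = i.+1.
Proof. by elim: i => //= i IH; rewrite size_rcons IH. Qed.

(** A slot refers only to leaves produced before it, so the guessed run reproduces [xs] entry by
    entry, and later slots leave this prefix alone. *)
Lemma nth_xsq c dg dt (xs : seq V) m : size xs = m.+1 -> nth c xs 0 = c ->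
  (forall i, i < m -> [/\ da dg i <= i, db dg i <= i &
     nth c xs i.+1 = vsel (src c dg xs i) (dt i)]) ->
  forall i j, m <= i -> j <= m -> nth c (xsq c dg dt i) j = nth c xs j.
Proof.
move=> sx x0 h.
have H1 i : i <= m -> forall j, j <= i -> nth c (xsq c dg dt i) j = nth c xs j.
  elim: i => [|i IH] im j ji; first by move: ji; rewrite leqn0 => /eqP->; rewrite x0.
  rewrite /= nth_rcons size_xsq; case: ltngtP ji => // [ji|->] _; first exact: (IH (ltnW im)).
  have [hda hdb ->] := h _ im; congr vsel; rewrite /src.
  by rewrite !(IH (ltnW im)).
move=> i; elim: i => [|i IH] j mi jm; first by apply: H1; lia.
case: (ltngtP m i.+1) mi => // [mi|<-] _; last exact: H1.
rewrite /= nth_rcons size_xsq; case: ifP => [_|]; first exact: IH.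
lia.
Qed.

(** A block of length [J] followed by the rest; nesting it yields the offsets of [da] to [dbes]. *)
Definition blk (f g : nat -> nat) q := if q < J then f q else g (q - J).
Lemma blk_lt f g i : i < J -> blk f g i = f i. Proof. by rewrite /blk => ->. Qed.
Lemma blk_ge f g i : blk f g (J + i) = g i.
Proof. by rewrite /blk addKn ltnNge leq_addr. Qed.
Lemma blk_bound b f g : (forall i, f i < b) -> (forall i, g i < b) -> forall i, blk f g i < b.
Proof. by move=> hf hg i; rewrite /blk; case: ifP. Qed.

(** Explore until nothing new is found. Linkage puts every missed cut under the lowest top edge of a
    known leaf, and such a cut shares no edge with [c] or with these top edges. The cuts thus split
    into one group for each chain: the frontier cut found, those below it, and the hidden ones
    beside it. Edges charged to different groups are distinct, so nothing is overcharged. *)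
Lemma cert_complete s u c (X : {set V}) : s <= J -> #|X| = s -> anc u c -> #|D c| <= lam ->
  region u c X -> linked c X -> exists2 v, Cert s u c X v & v <= #|DX X :\: D c|.
Proof.
elim/ltn_ind: s u c X => s IH u c X sJ cX uc Dc rX lX.
have [s0|s0] := posnP s.
  by exists 0 => //; rewrite (cards0_eq (etrans cX s0)) s0; exact: Cert0.
pose F := frontier X.
have [l [lu lF le] lmax] : exists2 l, explored c F l & forall f x, ~ explored c F (rcons l (f, x)).
  by apply: (@explored_max _ _ [::]).
pose m := size l; pose xs := c :: map snd l.
pose fi i := (nth (c, c) l i).1; pose xi i := (nth (c, c) l i).2.
have xsS i : i < m -> nth c xs i.+1 = xi i by move=> im; rewrite /= (nth_map (c, c)).
(* Maximality of [l]: a boundary vertex of a known cut that lies below an unfound frontier cut would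
   prolong the exploration. *)
have ext f y a b w : f \in F -> f \notin map fst l -> anc f y -> #|D w| <= lam ->
    vis w y -> a <= m -> b <= m ->
    w = (if a == 0 then c else top (nth c xs a) (nth c xs b)) -> False.
  move=> fF fl fy Dw wy am bm Ew.
  have [t tl Ey] := vsel_ok Dw wy.
  apply: (lmax f y); split.
  - by rewrite map_rcons rcons_uniq fl.
  - move=> f' x'; rewrite mem_rcons inE => /orP[/eqP[-> ->]|/lF //]; rewrite fF; exact: fy.
  - move=> i; rewrite size_rcons ltnS leq_eqVlt => /orP[/eqP->|im].
      exists a, b, t; split=> //; rewrite nth_rcons ltnn eqxx /= -Ey Ew.
      rewrite map_rcons -rcons_cons !nth_rcons /= size_map ltnS !ltnS.
      by rewrite am bm.
    have [a' [b' [t' [h1 h2 h3 h4]]]] := le i im.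
    exists a', b', t'; split=> //; rewrite nth_rcons im h4 map_rcons -rcons_cons !nth_rcons /= size_map.
    by rewrite !ltnS (leq_trans h1 (ltnW im)) (leq_trans h2 (ltnW im)).
have inl i : i < m -> (fi i, xi i) \in l by move=> im; rewrite /fi /xi -surjective_pairing mem_nth.
have fF i : i < m -> fi i \in F by move=> /inl/lF/andP[].
have fX i : i < m -> fi i \in X by move=> /fF/frontier_in.
have fx i : i < m -> anc (fi i) (xi i) by move=> /inl/lF/andP[].
have fok i : i < m -> okv (fi i) by move=> /fX/rX/and4P[].
have finj i j : i < m -> j < m -> i != j -> fi i != fi j.
  move=> im jm; apply: contra => /eqP h; rewrite -(nth_uniq c _ _ lu) ?size_map //.
  by rewrite !(nth_map (c, c)) //; apply/eqP.
have finc i j : i < m -> j < m -> i != j -> incomp (fi i) (fi j).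
  by move=> im jm ij; apply: frontier_incomp (fF _ im) (fF _ jm) (finj _ _ im jm ij).
have mX : m <= #|X|.
  rewrite -[m](size_map fst) -(card_uniqP lu); apply: subset_leq_card.
  by apply/subsetP => g /mapP[[g' y] /lF/andP[/frontier_in h _] ->].
have mJ : m <= J by apply: leq_trans mX _; rewrite cX.
pose known g := has (fun fy => anc fy.1 g) l.
have knownP g : reflect (exists2 i, i < m & anc (fi i) g) (known g).
  apply: (iffP (has_nthP (c, c))) => -[i im h]; by exists i.
have unk g : g \in X -> ~~ known g -> exists f, [/\ f \in F, f \notin map fst l & anc f g].
  move=> gX ng; have [f fF' fg] := frontier_above gX; exists f; split=> //.
  by apply: contra ng => /mapP[fy fyl Ef]; apply/hasP; exists fy; rewrite -?Ef.
have hidc g e : g \in X -> ~~ known g -> e \in D g -> e \in D c -> False.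
  move=> gX ng eg ec; have [f [fF' fl fg]] := unk g gX ng.
  have [y ye gy] := D_end eg.
  apply: (ext f y 0 0 c) => //; first exact: anc_trans fg gy.
  by apply/exists_inP; exists e.
(* Linkage applied to all of [X] gives an edge shared with [c], hence a first leaf. *)
have m0 : 0 < m.
  rewrite lt0n; apply/eqP => m0.
  have Xn : X != set0 by rewrite -card_gt0 cX.
  have [g [h [e [gX hc eg eh]]]] := lX X (subxx _) Xn.
  move: hc; rewrite setDv setU0 inE => /eqP hc; rewrite hc in eh.
  apply: (hidc g e) => //; apply/knownP => -[i]; rewrite m0; lia.
have lam0 : 0 < lam.
  by have [a [b [t [_ _ tl _]]]] := le 0 m0; lia.
(* [pi i] is the number of the leaf whose top edge is lowest, so that this edge separates leaf i + 1
   from [c] and from all other leaves. *)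
have [pi piP] : exists pi : 'I_m -> nat, forall i : 'I_m, let w := top (xi i) (nth c xs (pi i)) in
   [/\ pi i < m.+1, okv w, anc w (xi i), anc w (fi i) &
     forall j, j < m.+1 -> j != i.+1 -> ~~ anc w (nth c xs j)].
  apply: (fin_all_exists (P := fun (i : 'I_m) p => let w := top (xi i) (nth c xs p) in
   [/\ p < m.+1, okv w, anc w (xi i), anc w (fi i) &
     forall j, j < m.+1 -> j != i.+1 -> ~~ anc w (nth c xs j)])) => i.
  have im := ltn_ord i.
  apply: (lowest_top (P := fun j => j != i.+1) (j0 := 0)) => // [||j jm ji]; [exact: fok|exact: fx|].
  case: j jm ji => [|j] jm ji; first by rewrite /=; case/and4P: (rX _ (fX _ im)).
  rewrite eqSS in ji; rewrite xsS //.
  apply/negP => h; rewrite eq_sym in ji.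
  by move/negP: (incomp_disj (finc _ _ im jm ji) h); apply; exact: fx.
pose pin i := if insub i is Some o then pi o else 0.
have pinE (i : 'I_m) : pin i = pi i by rewrite /pin valK.
have [aF aP] : exists aF : 'I_m -> nat * nat * nat, forall i : 'I_m,
   [/\ (aF i).1.1 <= i, (aF i).1.2 <= i, (aF i).2 < 2 * lam &
    xi i = vsel (if (aF i).1.1 == 0 then c else top (nth c xs (aF i).1.1) (nth c xs (aF i).1.2)) (aF i).2].
  apply: (fin_all_exists (P := fun (i : 'I_m) (q : nat * nat * nat) => [/\ q.1.1 <= i, q.1.2 <= i, q.2 < 2 * lam &
    xi i = vsel (if q.1.1 == 0 then c else top (nth c xs q.1.1) (nth c xs q.1.2)) q.2])) => i.
  by have [a [b [t h]]] := le i (ltn_ord i); exists (a, b, t).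
pose aF' i := if insub i is Some o then aF o else (0, 0, 0).
have aFE (i : 'I_m) : aF' i = aF i by rewrite /aF' valK.
pose w i := top (xi i) (nth c xs (pin i)).
have wP i : i < m -> [/\ pin i < m.+1, okv (w i), anc (w i) (xi i), anc (w i) (fi i) &
     forall j, j < m.+1 -> j != i.+1 -> ~~ anc (w i) (nth c xs j)].
  by move=> im; have := piP (Ordinal im); rewrite -pinE.
have winc i j : i < m -> j < m -> i != j -> incomp (w i) (w j).
  suff H i' j' : i' < m -> j' < m -> i' != j' -> ~~ anc (w i') (w j').
    by move=> im jm ij; rewrite /incomp !H // eq_sym.
  move=> im jm ij; have [_ _ _ _ h] := wP _ im; have [_ _ h' _ _] := wP _ jm.
  have /h : j'.+1 < m.+1 by []. 
  rewrite eqSS eq_sym => /(_ ij); rewrite xsS //; apply: contra => h2; exact: anc_trans h2 h'.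
have hid g i e : g \in X -> ~~ known g -> i < m -> e \in D g -> e \in D (w i) -> False.
  move=> gX ng im eg ew; have [f [fF' fl fg]] := unk g gX ng.
  have [y ye gy] := D_end eg; have [h1 h2 _ _ _] := wP _ im.
  apply: (ext f y i.+1 (pin i) (w i)) => //.
  - exact: anc_trans fg gy.
  - by case/andP: h2.
  - by apply/exists_inP; exists e.
  - by rewrite xsS.
(* The common edge has an end below [w j], through [h]. Its end below [g] is outside: otherwise [g]
   would lie above [w j] and be the frontier cut of slot j, which is known. So the edge crosses
   [w j]. *)
have hid2 g h j e : g \in X -> ~~ known g -> j < m -> ~~ anc (w j) g -> anc (w j) h ->
    e \in D g -> e \in D h -> False.
  move=> gX ng jm wg wh eg eh; apply: (hid g j e) => //.
  have [y ye hy] := D_end eh; have [z ze gz] := D_end eg.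
  apply: (D_ends ye ze); first exact: anc_trans wh hy.
  apply/negP => wz; case/orP: (anc_tot wz gz) => hh; first by rewrite hh in wg.
  have [_ _ _ wf _] := wP _ jm.
  have Eg := frontier_max (fF _ jm) gX (anc_trans hh wf).
  by move/negP: ng; apply; apply/knownP; exists j; rewrite // Eg.
pose XB i := [set g in X | anc (fi i) g && (g != fi i)].
pose XG i := [set g in X | anc (w i) g && ~~ known g].
pose S i := fi i |: (XB i :|: XG i).
have wS i g : i < m -> g \in S i -> anc (w i) g.
  move=> im; have [_ _ _ wf _] := wP _ im; rewrite !inE => /or3P[/eqP->//|/and3P[_ h _]|/and3P[_ h _] //].
  exact: anc_trans wf h.
have SX i g : i < m -> g \in S i -> g \in X.
  by move=> im; rewrite !inE => /or3P[/eqP->|/and3P[]|/and3P[]] //; exact: fX.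
have kS i g : i < m -> anc (fi i) g -> g \in X -> g \in S i.
  by move=> im h gX; rewrite !inE h gX /=; case: eqP.
(* The cuts in no group: linkage would give them an edge in common with [c] or with a grouped cut,
   and both are excluded. *)
pose La := [set g in X | ~~ known g & [forall i : 'I_m, ~~ anc (w i) g]].
have La0 : La = set0.
  apply/eqP; apply: contraT => /(lX La) [|g [h [e [gL hL eg eh]]]].
    by apply/subsetP => g; rewrite inE => /andP[].
  move: gL; rewrite inE => /and3P[gX ng /forallP gw].
  have [hc|] := eqVneq h c; first by rewrite hc in eh; case: (hidc g e).
  move: hL; rewrite !inE => /orP[->//|/andP[hL hX] _].
  suff [j jm wh] : exists2 j, j < m & anc (w j) h.
    by case: (hid2 g h j e) => //; exact: (gw (Ordinal jm)).
  have [/knownP[j jm fh]|nh] := boolP (known h).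
    by exists j => //; apply: (wS j h jm); exact: kS.
  move: hL; rewrite hX nh /= negb_forall => /existsP[j]; rewrite negbK => wh.
  by exists j.
have cover g : g \in X -> exists2 i, i < m & g \in S i.
  move=> gX; have [/knownP[i im fg]|ng] := boolP (known g); first by exists i => //; exact: kS.
  have : g \notin La by rewrite La0 inE.
  rewrite inE gX ng /= negb_forall => /existsP[j]; rewrite negbK => wg.
  by exists j => //; rewrite !inE gX ng wg !orbT.
have fG i g : i < m -> g \in XG i -> incomp g (fi i).
  move=> im; rewrite inE => /and3P[gX _ ng]; apply/andP; split; apply/negP => h.
    have Eg := frontier_max (fF _ im) gX h.
    by move/negP: ng; apply; apply/knownP; exists i; rewrite // Eg.
  by move/negP: ng; apply; apply/knownP; exists i.
have disjS i j : i < m -> j < m -> i != j -> [disjoint S i & S j].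
  move=> im jm ij; rewrite -setI_eq0; apply/eqP/setP => g; rewrite inE [RHS]inE.
  apply/negP => /andP[/(wS _ _ im) h1 /(wS _ _ jm)].
  by apply/negP; exact: incomp_disj (winc _ _ im jm ij) h1.
have cardS i : i < m -> #|S i| = 1 + #|XB i| + #|XG i|.
  move=> im.
  have e1 : XB i :&: XG i = set0.
    apply/setP => g; rewrite inE [RHS]inE; apply/negP => /andP[gB gG].
    by have := fG _ _ im gG; move: gB; rewrite inE /incomp => /and3P[_ -> _]; rewrite andbF.
  have e2 : fi i \notin XB i :|: XG i.
    rewrite in_setU negb_or; apply/andP; split; apply/negP.
      by rewrite inE eqxx !andbF.
    by move/(fG _ _ im); rewrite /incomp anc_refl.
  by rewrite cardsU1 e2 cardsU e1 cards0; lia.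
pose on (f : nat -> nat) i := if i < m then f i else 0.
pose dg := blk (on (fun=> 1)) (blk (on (fun i => (aF' i).1.1)) (blk (on (fun i => (aF' i).1.2))
  (blk (on pin) (blk (on (fun i => #|XB i|)) (on (fun i => #|XG i|)))))).
pose dt := on (fun i => (aF' i).2).
have usedE i : i < J -> dused dg i = (i < m).
  by move=> iJ; rewrite /dused /dg blk_lt // /on; case: ifP.
have daE i : i < m -> da dg i = (aF' i).1.1.
  by move=> im; rewrite /da /dg blk_ge blk_lt ?(leq_trans im) // /on im.
have dbE i : i < m -> db dg i = (aF' i).1.2.
  by move=> im; rewrite /db /dg !blk_ge blk_lt ?(leq_trans im) // /on im.
have dpE i : i < m -> dp dg i = pin i.
  by move=> im; rewrite /dp /dg !blk_ge blk_lt ?(leq_trans im) // /on im.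
have dbelE i : i < m -> dbel dg i = #|XB i|.
  by move=> im; rewrite /dbel /dg !blk_ge blk_lt ?(leq_trans im) // /on im.
have dbesE i : i < m -> dbes dg i = #|XG i|.
  by move=> im; rewrite /dbes /dg !blk_ge /on im.
have leafE j : j <= m -> leaf c dg dt j = nth c xs j.
  move=> jm; rewrite /leaf; apply: (nth_xsq (m := m)) => // [|i im].
    by rewrite /= size_map.
  have [h1 h2 h3 h4] := aP (Ordinal im).
  rewrite daE // dbE // (aFE (Ordinal im)); split=> //.
  by rewrite xsS // /src daE // dbE // (aFE (Ordinal im)) /dt /on im (aFE (Ordinal im)).
have ctopE i : i < m -> ctop c dg dt i = w i.
  move=> im; rewrite /ctop dpE // !leafE // ?xsS //.
  by have [] := wP _ im.
have bnd f : (forall i, i < m -> f i <= J) -> forall i, on f i < J.+1.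
  by move=> h i; rewrite /on; case: ifP => // /h.
have gok : guess_ok dg dt.
  have subX (Y : {set V}) : Y \subset X -> #|Y| <= J.
    by move=> YX; apply: leq_trans (subset_leq_card YX) _; rewrite cX.
  split=> [i _|i iJ].
    have ha : forall j, j < m -> (aF' j).1.1 <= J /\ (aF' j).1.2 <= J.
      move=> j jm; have [h1 h2 _ _] := aP (Ordinal jm); rewrite (aFE (Ordinal jm)).
      by split; [apply: leq_trans h1 _|apply: leq_trans h2 _] => /=; lia.
    move: i; apply: blk_bound; first by apply: bnd => j jm; apply: leq_trans m0 mJ.
    apply: blk_bound; first by apply: bnd => j /ha[].
    apply: blk_bound; first by apply: bnd => j /ha[].
    apply: blk_bound; first by apply: bnd => j /wP[h _ _ _ _]; apply: leq_trans _ mJ.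
    by apply: blk_bound; apply: bnd => j jm; apply: subX; apply/subsetP => g; rewrite inE => /andP[].
  rewrite /dt /on; case: ifP => [im|_]; last lia.
  by have [_ _ h _] := aP (Ordinal im); rewrite (aFE (Ordinal im)).
have XE : \bigcup_(i < J | dused dg i) S i = X.
  apply/setP => g; apply/bigcupP/idP => [[i]|gX].
    by rewrite usedE // => im; exact: SX.
  have [i im gS] := cover g gX; have iJ : i < J by lia.
  by exists (Ordinal iJ); rewrite ?usedE.
have va : valid s u c dg dt.
  split.
  - move=> i; rewrite usedE // => im; rewrite /slot_ok /= ctopE // leafE // xsS //.
    have [h1 /andP[h2 _] h3 h4 h5] := wP _ im.
    have wc : ~~ anc (w i) c by exact: (h5 0).
    case/and4P: (rX _ (fX _ im)) => _ uf fc cf.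
    rewrite h2 h3 wc /=; apply/andP; split.
      case/orP: (anc_tot uf h4) => // h; by rewrite (anc_trans h uc) in wc.
    case/orP: cf => [->//|cf]; apply/orP; right; apply: contra cf => h; exact: anc_trans h h4.
  - move=> i j; rewrite !usedE // => im jm ij; rewrite !ctopE //.
    by case/andP: (winc _ _ im jm ij).
  - rewrite -cX -XE card_bigcup_disjoint => [|i j]; last first.
      by rewrite !usedE // => im jm ij; exact: disjS.
    by apply: eq_bigr => i; rewrite usedE // => im; rewrite cardS // dbelE // dbesE.
have cS i : i < m -> 1 + #|XB i| + #|XG i| <= s.
  move=> im; rewrite -cardS // -cX; apply: subset_leq_card; apply/subsetP => g; exact: SX.
have Df i : i < m -> #|D (fi i)| <= lam by move=> /fok/andP[].
have HB (i : 'I_J) : exists v, dused dg i -> Cert (dbel dg i) (fi i) (fi i) (XB i) v /\ v <= #|DX (XB i) :\: D (fi i)|.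
  rewrite usedE //; have [im|_] := ltnP i m; last by exists 0.
  have cs := cS _ im.
  have RB : region (fi i) (fi i) (XB i).
    move=> g; rewrite inE eqxx => /and3P[gX fg gf]; rewrite fg.
    case/and4P: (rX _ gX) => -> _ _ _ /=; rewrite andbT; apply: contra gf => h.
    by apply/eqP; apply: anc_anti; rewrite h fg.
  (* An edge of a cut below [fi i] that does not cross [fi i] has both ends in its subtree, so the
     partner is below [fi i] as well. *)
  have LB : linked (fi i) (XB i).
    move=> Y YB Yn.
    have YX : Y \subset X by apply: subset_trans YB _; apply/subsetP => g; rewrite inE => /andP[].
    have [g [h [e [gY hY eg eh]]]] := lX Y YX Yn.
    have /andP[fg gf] : anc (fi i) g && (g != fi i) by move/subsetP: YB => /(_ _ gY); rewrite inE => /and3P[_ -> ->].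
    have [ef|ef] := boolP (e \in D (fi i)); first by exists g, (fi i), e; split=> //; rewrite !inE eqxx.
    have [i1 i2] := D_inside eg fg ef.
    have fh : anc (fi i) h.
      by apply: contraTT eh => nh; exact: sep_outside nh i1 i2.
    exists g, h, e; split=> //; move: hY; rewrite !inE fh => /orP[/eqP hc|/andP[-> ->]] //=; last by case: eqP.
    by case/and4P: (rX _ (fX _ im)) => _ _; rewrite -hc fh.
  have b1 : #|XB i| < s by lia.
  have b2 : #|XB i| <= J by lia.
  have [v h1 h2] := IH _ b1 (fi i) (fi i) (XB i) b2 erefl (anc_refl _) (Df _ im) RB LB.
  by exists v; rewrite dbelE.
have HG (i : 'I_J) : exists v, dused dg i -> Cert (dbes dg i) (w i) (fi i) (XG i) v /\ v <= #|DX (XG i) :\: D (fi i)|.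
  rewrite usedE //; have [im|_] := ltnP i m; last by exists 0.
  have cs := cS _ im; have [_ _ _ wf _] := wP _ im.
  have RG : region (w i) (fi i) (XG i).
    move=> g gG; have /andP[-> ->] := fG _ _ im gG.
    by move: gG; rewrite inE => /and3P[gX -> _]; case/and4P: (rX _ gX) => ->; rewrite orbT.
  (* By [hid2] the partner belongs to the same group. Were it below [fi i], the edge would join
     incomparable subtrees and cross [fi i]. *)
  have LG : linked (fi i) (XG i).
    move=> Y YG Yn.
    have YX : Y \subset X by apply: subset_trans YG _; apply/subsetP => g; rewrite inE => /andP[].
    have [g [h [e [gY hY eg eh]]]] := lX Y YX Yn.
    have gG : g \in XG i by move/subsetP: YG; apply.
    have /and3P[gX wg ng] : [&& g \in X, anc (w i) g & ~~ known g] by move: gG; rewrite inE.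
    have [ef|ef] := boolP (e \in D (fi i)); first by exists g, (fi i), e; split=> //; rewrite !inE eqxx.
    exists g, h, e; split=> //; move: hY; rewrite !inE => /orP[/eqP hc|/andP[hY hX]].
      by rewrite hc in eh; case: (hidc g e).
    apply/orP; right; rewrite hY hX /=.
    have [j jm hS] := cover h hX.
    have ji : j = i.
      apply/eqP; apply: contraT => ji; case: (hid2 g h j e) => //; last exact: wS.
      by apply: incomp_disj wg; apply: winc; rewrite // eq_sym.
    rewrite ji !inE hX /= in hS; case/or3P: hS => [/eqP hf|/andP[fh hf]|//].
      by rewrite hf (negbTE ef) in eh.
    have [y [z [ye ze gy hz]]] := D_incomp (incomp_below (fG _ _ im gG) (anc_refl g) fh) eg eh.
    have fz := anc_trans fh hz.
    move/negP: ef; case; apply: (D_ends ze ye fz); apply: incomp_disj gy; exact: fG.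
  have b1 : #|XG i| < s by lia.
  have b2 : #|XG i| <= J by lia.
  have [v h1 h2] := IH _ b1 (w i) (fi i) (XG i) b2 erefl wf (Df _ im) RG LG.
  by exists v; rewrite dbesE.
have [vB vBP] := fin_all_exists HB; have [vG vGP] := fin_all_exists HG.
exists (#|DX (front dg (fun i => fi i)) :\: D c| + \sum_(i < J | dused dg i) (vB i + vG i)).
  rewrite -XE; apply: (@CertS s u c dg dt (fun i : 'I_J => fi i) (fun i : 'I_J => XB i)
    (fun i : 'I_J => XG i) vB vG s0 gok va) => i ui; have im : i < m by rewrite -usedE.
  - rewrite /on_chain ctopE // leafE // xsS // fx // fok //=.
    have [_ _ _ -> _] := wP _ im; rewrite dbesE //=; apply/orP.
    have [wf|] := eqVneq (w i) (fi i); last by left.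
    right; rewrite cards_eq0; apply/eqP/setP => g; rewrite [RHS]inE; apply/negP => gG.
    have := fG _ _ im gG; rewrite /incomp -wf => /andP[_ /negP]; apply.
    by move: gG; rewrite inE => /and3P[].
  - by have [] := vBP i ui.
  - by rewrite ctopE //; have [] := vGP i ui.
(* The edges charged inside group i. These sets are disjoint from each other and from the front
   edges, so the charges add up to the size of a union. *)
pose M i := (DX (XB i) :\: D (fi i)) :|: (DX (XG i) :\: D (fi i)).
have inB i e : i < m -> e \in DX (XB i) :\: D (fi i) -> anc (fi i) (es e) /\ anc (fi i) (et e).
  move=> im; rewrite in_setD => /andP[nf /DXP[g]]; rewrite inE => /and3P[_ fg _] eg.
  exact: D_inside eg fg nf.
have inG i e : i < m -> e \in DX (XG i) -> exists2 g, [&& g \in X, ~~ known g & anc (w i) g] & (e \in D g) && incomp g (fi i).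
  move=> im /DXP[g gG eg]; exists g; last by rewrite eg fG.
  by move: gG; rewrite inE => /and3P[-> -> ->].
have outG i e : i < m -> e \in DX (XG i) -> e \notin D c /\ forall j, j < m -> j != i ->
    e \notin D (fi j) /\ ~ (anc (fi j) (es e) /\ anc (fi j) (et e)).
  move=> im /inG-/(_ im)[g /and3P[gX ng wg] /andP[eg gf]]; split.
    by apply/negP => ec; exact: hidc gX ng eg ec.
  move=> j jm ji; have nw : ~~ anc (w j) g by apply: incomp_disj wg; apply: winc; rewrite // eq_sym.
  have [_ _ _ wf _] := wP _ jm; split.
    by apply/negP => ej; exact: hid2 gX ng jm nw wf eg ej.
  move=> [f1 f2]; have [z ze gz] := D_end eg.
  have fz : anc (fi j) z by case/orP: ze => /eqP <-.
  have gj : incomp g (fi j).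
    have gw : incomp g (w j).
      by apply: (incomp_below _ wg (anc_refl _)); apply: winc; rewrite // eq_sym.
    exact: incomp_below gw (anc_refl _) wf.
  by move/negP: (incomp_disj gj gz); apply.
have outM i j e : i < m -> j < m -> j != i -> e \in M i -> e \notin M j.
  move=> im jm ji; rewrite in_setU => /orP[eB|].
    rewrite in_setU negb_or; have [b1 b2] := inB _ _ im eB; apply/andP; split; apply/negP.
      move/(inB _ _ jm) => [b3 _]; move/negP: (incomp_disj (finc _ _ jm im ji) b3); exact.
    rewrite in_setD => /andP[_ /outG-/(_ jm)[_ /(_ i im)]]; rewrite eq_sym => /(_ ji)[_]; exact.
  rewrite in_setD => /andP[_ eG]; have [_ /(_ j jm ji)[o1 o2]] := outG _ _ im eG.
  rewrite in_setU negb_or; apply/andP; split; apply/negP; first by move/(inB _ _ jm).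
  rewrite in_setD => /andP[_ /inG-/(_ jm)[h /and3P[hX nh wh] /andP[eh _]]].
  have [g /and3P[gX ng wg] /andP[eg _]] := inG _ _ im eG.
  by apply: (hid2 g h j e) => //; apply: incomp_disj wg; apply: winc; rewrite // eq_sym.
have disjM : [disjoint DX (front dg (fun i => fi i)) :\: D c & \bigcup_(i < J | dused dg i) M i].
  rewrite -setI_eq0; apply/eqP/setP => e; rewrite in_setI in_setD [RHS]inE; apply/negP.
  case/andP=> /andP[ec /DXP[f /imsetP[j]]]; rewrite inE usedE // => jm -> ej /bigcupP[i]; rewrite usedE // => im.
  have [ji|ji] := eqVneq (j : nat) i.
    by rewrite in_setU !in_setD -ji ej.
  rewrite in_setU => /orP[eB|].
    have [b1 b2] := inB _ _ im eB.
    have /andP[_ nn] := finc _ _ jm im ji.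
    by rewrite (negbTE (sep_outside nn b1 b2)) in ej.
  by rewrite in_setD => /andP[_ /outG-/(_ im)[_ /(_ j jm ji)[/negP]]].
have sub : (DX (front dg (fun i => fi i)) :\: D c) :|: \bigcup_(i < J | dused dg i) M i \subset DX X :\: D c.
  apply/subsetP => e; rewrite in_setU => /orP[|].
    rewrite !in_setD => /andP[-> /DXP[f /imsetP[j]]]; rewrite inE usedE // => jm -> ej /=.
    by apply/DXP; exists (fi j) => //; exact: fX.
  move=> /bigcupP[i]; rewrite usedE // => im; rewrite in_setU => /orP[eB|].
    have [b1 b2] := inB _ _ im eB; rewrite in_setD; apply/andP; split.
      by apply: sep_outside b1 b2; case/and4P: (rX _ (fX _ im)).
    move: eB; rewrite in_setD => /andP[_ /DXP[g gB eg]]; apply/DXP; exists g => //.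
    by move: gB; rewrite inE => /andP[].
  rewrite !in_setD => /andP[_ eG]; have [-> _] := outG _ _ im eG.
  by have [g /and3P[gX _ _] /andP[eg _]] := inG _ _ im eG; apply/DXP; exists g.
apply: leq_trans (subset_leq_card sub); rewrite cardsU.
have -> : #|(DX (front dg (fun i => fi i)) :\: D c) :&: \bigcup_(i < J | dused dg i) M i| = 0.
  by apply/eqP; rewrite cards_eq0 setI_eq0.
rewrite subn0 leq_add2l card_bigcup_disjoint => [|i j]; last first.
  rewrite !usedE // => im jm ij; rewrite -setI_eq0; apply/eqP/setP => e; rewrite in_setI [RHS]inE.
  rewrite eq_sym in ij; apply/negP => /andP[e1 e2].
  by rewrite (negbTE (outM _ _ _ im jm ij e1)) in e2.
apply: leq_sum => i ui; have im : i < m by rewrite -usedE.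
have [_ h1] := vBP i ui; have [_ h2] := vGP i ui.
rewrite /M cardsU (_ : _ :&: _ = set0) ?cards0 ?subn0; first exact: leq_add.
apply/setP => e; rewrite in_setI [RHS]inE; apply/negP => /andP[/(inB _ _ im)[b1 b2]].
rewrite in_setD => /andP[_ /inG-/(_ im)[g _ /andP[eg gf]]].
have [z ze gz] := D_end eg; have fz : anc (fi i) z by case/orP: ze => /eqP <-.
by move/negP: (incomp_disj gf gz); apply.
Qed.

(** * Certificates for a whole component *)

Hypothesis anc_root : forall x, anc root x.

Definition CertQ j (Q : {set V}) v := [/\ j = 0, Q = set0 & v = 0] \/
  exists c s1 s2 X1 X2 v1 v2, [/\ okv c, Cert s1 c c X1 v1, Cert s2 root c X2 v2 &
    [/\ j = (s1 + s2).+1, Q = c |: (X1 :|: X2) & v = #|D c| + (v1 + v2)]].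

Lemma DXU (X Y : {set V}) : DX (X :|: Y) = DX X :|: DX Y.
Proof. exact: bigcup_setU. Qed.

Lemma DX1 f : DX [set f] = D f.
Proof. exact: big_set1. Qed.

Lemma certQ_sound j Q v : CertQ j Q v ->
  [/\ #|Q| = j, #|DX Q| <= v & forall g, g \in Q -> okv g].
Proof.
case=> [[-> -> ->]|[c [s1 [s2 [X1 [X2 [v1 [v2 [cok C1 C2 [-> -> ->]]]]]]]]]].
  by split=> [||g]; rewrite ?cards0 ?inE // /DX big_set0 cards0.
have [k1 r1 d1] := cert_sound C1 (anc_refl c).
have [k2 r2 d2] := cert_sound C2 (anc_root c).
have b1 g : g \in X1 -> anc c g && ~~ anc g c by move/r1 => /and4P[_ -> ->].
have b2 g : g \in X2 -> incomp g c.
  move/r2 => /and4P[_ _ h]; rewrite /incomp h; case/orP=> // /eqP rc.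
  by case/andP: cok; rewrite rc eqxx.
split.
- rewrite cardsU1 cardsU k1 k2 (_ : X1 :&: X2 = set0) ?cards0; last first.
    apply/setP => g; rewrite inE [RHS]inE; apply/negP => /andP[/b1/andP[h _] /b2].
    by rewrite /incomp h andbF.
  rewrite (_ : c \notin _) ?subn0 //= in_setU negb_or.
  by apply/andP; split; apply/negP; [move/b1|move/b2]; rewrite /incomp anc_refl.
- rewrite !DXU DX1.
  have -> : D c :|: (DX X1 :|: DX X2) = D c :|: ((DX X1 :\: D c) :|: (DX X2 :\: D c)).
    by apply/setP => e; rewrite !in_setU !in_setD; case: (e \in D c).
  apply: leq_trans (leq_card_setU _ _) _; rewrite leq_add2l.
  by apply: leq_trans (leq_card_setU _ _) _; exact: leq_add.
- move=> g; rewrite !inE => /or3P[/eqP->//|/r1|/r2]; by case/and4P.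
Qed.

Definition connected (Q : {set V}) := forall Y : {set V}, Y \subset Q -> Y != set0 -> Y != Q ->
  exists g h e, [/\ g \in Y, h \in Q :\: Y, e \in D g & e \in D h].

(** Any topmost cut can serve as [c]. An edge shared by a cut below [c] and a cut incomparable with
    [c] crosses [c]; hence both parts are linked to [c], and their costs outside [D c] add up. *)
Lemma certQ_complete (Q : {set V}) : #|Q| <= J.+1 -> Q != set0 -> {in Q, forall g, okv g} -> connected Q ->
  exists2 v, CertQ #|Q| Q v & v <= #|DX Q|.
Proof.
move=> QJ Q0 Qok Qc.
have [g gQ] := set0Pn _ Q0; have [c cF _] := frontier_above gQ.
have cQ := frontier_in cF; have cok := Qok _ cQ; have /andP[_ cD] := cok.
pose B := [set g in Q | anc c g && (g != c)]; pose U := [set g in Q | ~~ anc c g].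
have QE : Q = c |: (B :|: U).
  apply/setP => h; rewrite !inE; have [->|_] := eqVneq h c; first by rewrite cQ.
  by case: (anc c h); rewrite ?andbT ?andbF ?orbF.
have Uc h : h \in U -> incomp h c.
  rewrite inE => /andP[hQ nh]; rewrite /incomp nh andbT; apply: contra nh => hc.
  by rewrite (frontier_max cF hQ hc) anc_refl.
have cB : c \notin B by rewrite inE eqxx !andbF.
have cU : c \notin U by rewrite inE anc_refl andbF.
have BU : [disjoint B & U].
  rewrite -setI_eq0; apply/eqP/setP => h; rewrite !inE; case: (anc c h); rewrite ?andbF //.
have cardE : #|Q| = (#|B| + #|U|).+1.
  rewrite {1}QE cardsU1 in_setU negb_or cB cU /= cardsU; move: BU; rewrite -setI_eq0 => /eqP ->.
  by rewrite cards0; lia.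
have BQ : B \subset Q by apply/subsetP => h; rewrite inE => /andP[].
have UQ : U \subset Q by apply/subsetP => h; rewrite inE => /andP[].
have nQ (Y : {set V}) : c \notin Y -> Y != Q by move=> nc; apply/eqP => YQ; rewrite YQ cQ in nc.
have RB : region c c B.
  move=> h; rewrite inE eqxx => /and3P[hQ ch hc]; rewrite ch Qok //= andbT.
  by apply: contra hc => hc; apply/eqP/anc_anti; rewrite ch hc.
have RU : region root c U.
  move=> h hU; have /andP[h1 h2] := Uc _ hU; rewrite anc_root h1 h2 orbT /= andbT.
  by apply: Qok; exact: (subsetP UQ).
have LB : linked c B.
  move=> Y YB Yn; have YQ := subset_trans YB BQ.
  have cY : c \notin Y by apply: contra cB; exact: (subsetP YB).
  have [g' [h [e [gY hY eg eh]]]] := Qc Y YQ Yn (nQ _ cY).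
  have := subsetP YB _ gY; rewrite inE => /and3P[gQ' cg gc].
  have [ef|ef] := boolP (e \in D c); first by exists g', c, e; split=> //; rewrite !inE eqxx.
  have [i1 i2] := D_inside eg cg ef.
  have ch : anc c h by apply: contraTT eh => nh; exact: sep_outside nh i1 i2.
  exists g', h, e; split=> //; move: hY; rewrite !inE ch => /andP[-> ->] /=.
  by case: eqP.
have LU : linked c U.
  move=> Y YU Yn; have YQ := subset_trans YU UQ.
  have cY : c \notin Y by apply: contra cU; exact: (subsetP YU).
  have [g' [h [e [gY hY eg eh]]]] := Qc Y YQ Yn (nQ _ cY).
  have gU := subsetP YU _ gY.
  have [ef|ef] := boolP (e \in D c); first by exists g', c, e; split=> //; rewrite !inE eqxx.
  exists g', h, e; split=> //; move: hY; rewrite in_setD in_setU1 in_setD inE => /andP[hY hQ].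
  rewrite hY hQ /= orbC; have [ch|//] := boolP (anc c h).
  have [y [z [ye ze gy hz]]] := D_incomp (incomp_below (Uc _ gU) (anc_refl g') ch) eg eh.
  have fz := anc_trans ch hz.
  by move/negP: ef; case; apply: (D_ends ze ye fz); apply: incomp_disj gy; exact: Uc.
have sB : #|B| <= J by lia.
have sU : #|U| <= J by lia.
have [v1 C1 h1] := cert_complete sB erefl (anc_refl c) cD RB LB.
have [v2 C2 h2] := cert_complete sU erefl (anc_root c) cD RU LU.
exists (#|D c| + (v1 + v2)).
  by right; exists c, #|B|, #|U|, B, U, v1, v2; split.
apply: (@leq_trans (#|D c| + (#|DX B :\: D c| + #|DX U :\: D c|))); first by rewrite leq_add2l leq_add.
rewrite QE !DXU DX1.
have -> : D c :|: (DX B :|: DX U) = D c :|: ((DX B :\: D c) :|: (DX U :\: D c)).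
  by apply/setP => e; rewrite !in_setU !in_setD; case: (e \in D c).
have E1 : (DX B :\: D c) :&: (DX U :\: D c) = set0.
  apply/setP => e; rewrite in_setI !in_setD [RHS]inE; apply/negP => /andP[/andP[ec /DXP[b bB eb]] /andP[_ /DXP[u uU eu]]].
  move: bB; rewrite inE => /and3P[_ cb _]; have [i1 i2] := D_inside eb cb ec.
  have /andP[_ cu] := Uc _ uU.
  by rewrite (negbTE (sep_outside cu i1 i2)) in eu.
have E2 : D c :&: ((DX B :\: D c) :|: (DX U :\: D c)) = set0.
  by apply/setP => e; rewrite in_setI in_setU !in_setD [RHS]inE; case: (e \in D c).
by rewrite cardsU E2 cards0 subn0 cardsU E1 cards0 subn0.
Qed.

(** * Components and optimal values *)

Lemma decompose (F : {set V}) : exists L : seq {set V},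
  [/\ forall Q, Q \in L -> Q != set0 /\ connected Q,
      forall y, count (fun Q : {set V} => y \in Q) L = (y \in F)
    & \sum_(Q <- L) #|DX Q| <= #|DX F|].
Proof.
have [m] := ubnP #|F|; elim: m F => // m IH F Fm.
have [F0|F0] := eqVneq F set0.
  by exists [::]; rewrite !big_nil F0; split=> // y; rewrite inE.
have [Fc|Fc] := classic (connected F).
  exists [:: F]; rewrite !big_seq1; split=> // [Q|y]; first by rewrite inE => /eqP ->.
  by rewrite /= addn0.
(* A set that refutes connectedness shares no edge with the rest, so the two costs add up
   exactly. *)
have [Y [YF Y0 YnF Yd]] : exists Y : {set V}, [/\ Y \subset F, Y != set0, Y != F &
    [disjoint DX Y & DX (F :\: Y)]].
  apply: NNPP => h; apply: Fc => Y YF Y0 YnF; apply: NNPP => h'; apply: h; exists Y; split=> //.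
  rewrite -setI_eq0; apply/eqP/setP => e; rewrite in_setI [RHS]inE; apply/negP => /andP[/DXP[g gY eg] /DXP[k kY ek]].
  by apply: h'; exists g, k, e.
have YsF : Y \proper F by rewrite properEneq YnF.
have ZsF : F :\: Y \proper F.
  rewrite properE subsetDl; apply/subsetPn; have [y yY] := set0Pn _ Y0; exists y; last by rewrite inE yY.
  exact: (subsetP YF).
have [L1 [a1 b1 d1]] := IH Y (leq_trans (proper_card YsF) Fm).
have [L2 [a2 b2 d2]] := IH (F :\: Y) (leq_trans (proper_card ZsF) Fm).
have FE : Y :|: (F :\: Y) = F by rewrite -{2}(setID F Y) (setIidPr YF).
exists (L1 ++ L2); split.
- by move=> Q; rewrite mem_cat => /orP[/a1|/a2].
- move=> y; rewrite count_cat b1 b2 inE; have := subsetP YF y.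
  by case: (y \in Y) => [->|_].
- rewrite big_cat /=; apply: leq_trans (leq_add d1 d2) _.
  rewrite -[X in _ <= #|DX X|]FE DXU cardsU; move: Yd; rewrite -setI_eq0 => /eqP ->.
  by rewrite cards0 subn0.
Qed.

(** Values are truncated at [lam.+1], the number of augmentations after which the minimum cut
    computation gives up; a witness is promised up to [lam] only. *)
Definition is_best j (A : {set V}) x :=
  [/\ x <= lam.+1,
      x <= lam -> exists Q v, [/\ CertQ j Q v, Q \subset A & v <= x]
    & forall Q v, CertQ j Q v -> Q \subset A -> x <= v].

Lemma is_best_ex j A : exists x, is_best j A x.
Proof.
suff H m : m <= lam.+1 -> (forall Q v, CertQ j Q v -> Q \subset A -> lam.+1 - m <= v) ->
    exists x, is_best j A x.
  by apply: (H lam.+1) => // Q v _ _; rewrite subnn.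
elim: m => [_ h|m IH ml h].
  by exists lam.+1; split=> //; rewrite ltnn.
have [[Q [v [h1 h2 h3]]]|no] := classic (exists Q v, [/\ CertQ j Q v, Q \subset A & v <= lam.+1 - m.+1]).
  exists (lam.+1 - m.+1); split=> [|_|]; [lia| |exact: h].
  by exists Q, v.
apply: IH => [|Q v c s]; first lia.
rewrite leqNgt; apply/negP => lv; apply: no; exists Q, v; split=> //; lia.
Qed.

Lemma is_best_uniq j A x y : is_best j A x -> is_best j A y -> x = y.
Proof.
suff H x' y' : is_best j A x' -> is_best j A y' -> x' <= y'.
  by move=> hx hy; apply/eqP; rewrite eqn_leq !H.
move=> [l1 _ a1] [l2 e2 _]; have [yl|] := leqP y' lam; last lia.
by have [Q [v [c s vl]]] := e2 yl; exact: leq_trans (a1 _ _ c s) vl.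
Qed.

Variable Vf : nat -> {set V} -> nat.
Hypothesis VfP : forall j A, is_best j A (Vf j A).

Lemma Vf_anti j (A B : {set V}) : A \subset B -> Vf j B <= Vf j A.
Proof.
move=> AB; have [l1 e1 a1] := VfP j A; have [l2 e2 a2] := VfP j B.
have [h|] := leqP (Vf j A) lam; last lia.
by have [Q [v [c s vl]]] := e1 h; exact: leq_trans (a2 _ _ c (subset_trans s AB)) vl.
Qed.

Definition estep j x (A : {set V}) e := if (e \in A) && (Vf j (A :\ e) <= x) then A :\ e else A.
Definition elimin j A := foldl (estep j (Vf j A)) A (enum V).

(** One pass is enough: if deleting [e] raises the value above [x] when its turn comes, it also does
    so after further deletions, the value being antitone in the set. *)
Lemma foldl_estep j x l (A : {set V}) : Vf j A <= x -> let R := foldl (estep j x) A l in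
  [/\ R \subset A, Vf j R <= x & forall e, e \in l -> e \in R -> x < Vf j (R :\ e)].
Proof.
elim: l A => [|e l IH] A Ax /=; first by split.
have [h1 h2] : Vf j (estep j x A e) <= x /\ estep j x A e \subset A.
  by rewrite /estep; case: ifP => [/andP[]|] //; rewrite subD1set.
have [r1 r2 r3] := IH _ h1; split=> //; first exact: subset_trans r1 h2.
move=> f; rewrite inE => /orP[/eqP ->|fl]; last exact: r3.
move=> eR; have eA := subsetP r1 _ eR.
move: (eA) r1; rewrite /estep; case: ifP => [_|]; first by rewrite setD11.
move=> + eA' r1; rewrite eA' /= => /negbT; rewrite -ltnNge => h.
by apply: leq_trans h _; apply: Vf_anti; exact: setSD.
Qed.

(** An optimum inside the remainder uses all of it, since a vertex it avoids would have been
    deleted. So the remainder is the optimum itself, and the table can store values without sets. *)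
Lemma elimin_ok j (A : {set V}) : Vf j A <= lam -> exists2 v, CertQ j (elimin j A) v & v <= Vf j A /\ elimin j A \subset A.
Proof.
move=> xl; have [r1 r2 r3] := foldl_estep (enum V) (leqnn (Vf j A)).
rewrite -/(elimin j A) in r1 r2 r3.
have [_ e1 _] := VfP j (elimin j A).
have [Q [v [c s vl]]] := e1 (leq_trans r2 xl).
suff E2 : Q = elimin j A.
  by rewrite E2 in c; exists v => //; split=> //; exact: leq_trans vl r2.
apply/eqP; rewrite eqEsubset s; apply/subsetP => e eR; apply: contraT => eQ.
have := r3 e (mem_enum _ _) eR; rewrite ltnNge; case/negP.
have [_ _ a1] := VfP j (elimin j A :\ e).
apply: leq_trans (a1 Q v c _) (leq_trans vl r2).
by rewrite subsetD1 s eQ.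
Qed.

(** * Packing the components *)

Variable qsel : {set V} -> nat -> V.
Hypothesis qsel_ok : forall (Q : {set V}) y, y \in Q -> exists2 q, q < #|Q| & qsel Q q = y.

(* Packing the components one after the other: an action a = 0 accepts the cheapest
   candidate for the current component, an action a > 0 declares that a vertex of that
   candidate belongs to component a instead. *)
Record pst := Pst { psel : {set V}; plab : V -> nat; pcur : nat; ptot : nat }.

Definition pavail st := [set y | [&& okv y, y \notin psel st &
  (plab st y == 0) || (plab st y == pcur st)]].

Definition pstep sz a q st :=
  if pcur st <= J then
    let A := pavail st in
    let Q := elimin sz A in
    if a == 0 then Pst (psel st :|: Q) (plab st) (pcur st).+1 (ptot st + Vf sz A)
    else Pst (psel st) (fun y => if y == qsel Q q then a else plab st y) (pcur st) (ptot st)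
  else st.

Implicit Types dd : nat -> nat.
(** Layout of an outer guess: 2 J actions, 2 J indices of elements, and the sizes of the components
    1 to J, in all 5 J digits. *)
Definition psz dd c := dd (J + J + (J + J) + c.-1).

Fixpoint prun dd t := if t is t'.+1 then
    let st := prun dd t' in pstep (psz dd (pcur st)) (dd t') (dd (J + J + t')) st
  else Pst set0 (fun=> 0) 1 0.

Lemma prun_cur dd t : 0 < pcur (prun dd t).
Proof. by elim: t => //= t IH; rewrite /pstep; case: ifP => // _; case: ifP. Qed.

Lemma prun_sound dd t : ptot (prun dd t) <= lam ->
  [/\ #|psel (prun dd t)| = \sum_(1 <= c < pcur (prun dd t)) psz dd c,
      #|DX (psel (prun dd t))| <= ptot (prun dd t)
    & forall g, g \in psel (prun dd t) -> okv g].
Proof.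
elim: t => [_|t IH]; first by rewrite /= cards0 /DX big_set0 cards0 big_nil; split=> // g; rewrite inE.
move: IH => /=; move: (prun dd t) (prun_cur dd t) => st c0 IH; rewrite /pstep.
case: ifP => // cJ; case: ifP => [a0 /= tl|_ /=]; last exact: IH.
have [k1 k2 k3] : [/\ #|psel st| = \sum_(1 <= c < pcur st) psz dd c, #|DX (psel st)| <= ptot st
    & forall g, g \in psel st -> okv g].
  by apply: IH; exact: leq_trans (leq_addr _ _) tl.
set A := pavail st in tl *; set j := psz dd (pcur st) in tl *.
have [v cQ [vl sA]] := elimin_ok (leq_trans (leq_addl _ _) tl).
have [q1 q2 q3] := certQ_sound cQ.
split.
- rewrite big_nat_recr //= -k1 cardsU q1 (_ : _ :&: _ = set0) ?cards0 ?subn0 //.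
  apply/setP => g; rewrite in_setI [RHS]inE; apply/negP => /andP[gs /(subsetP sA)].
  by rewrite inE gs andbF.
- rewrite DXU; apply: leq_trans (leq_card_setU _ _) _; apply: leq_add => //.
  exact: leq_trans vl.
- by move=> g; rewrite in_setU => /orP[/k3|/q3].
Qed.

Definition updn (f : nat -> nat) a v := fun b => if b == a then v else f b.

(** Lets a successful guess be built step by step, since each step reads only two digits of its own
    besides the sizes. *)
Lemma prun_ext dd dd' t : t <= J + J ->
  (forall i, i < t -> dd' i = dd i /\ dd' (J + J + i) = dd (J + J + i)) ->
  (forall c, 0 < c <= J -> psz dd' c = psz dd c) -> prun dd' t = prun dd t.
Proof.
elim: t => // t IH tJ h1 h2 /=; rewrite IH //; [|lia|by move=> i it; apply: h1; lia].
have [-> ->] := h1 t (leqnn _); have := prun_cur dd t; rewrite /pstep.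
by case: ifP => // cJ c0; rewrite h2 // c0.
Qed.

(* The invariant relates the run to a fixed target C_1, ..., C_J of which the components
   from the current one on are still to be found. *)
Definition pinv opt (C : nat -> {set V}) (cst : nat -> nat) (sz : nat -> nat) r st :=
  [/\ 0 < pcur st <= J.+1,
      forall i y, pcur st <= i <= J -> y \in C i -> [/\ okv y, y \notin psel st & (plab st y == 0) || (plab st y == i)],
      forall y, pcur st <= plab st y -> plab st y <= J /\ y \in C (plab st y),
      ptot st + \sum_(pcur st <= i < J.+1) cst i <= opt
    & \sum_(pcur st <= i < J.+1) #|[set y in C i | plab st y == 0]| + (J.+1 - pcur st) <= r].

(** The target component is available, so the candidate is at most as expensive. If it meets no
    later component it is accepted, although it may differ from the target; otherwise a common
    vertex gets the label of that later component. The potential [r], unlabelled vertices plus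
    components still to be found, drops in both cases. *)
Lemma pstep_target opt C cst sz r st : opt <= lam ->
  (forall i, 0 < i <= J -> exists2 v, CertQ (sz i) (C i) v & v <= cst i) ->
  (forall i j y, 0 < i <= J -> 0 < j <= J -> y \in C i -> y \in C j -> i = j) ->
  (forall i, sz i <= J) ->
  pinv opt C cst sz r.+1 st ->
  exists a q, [/\ a <= J, q <= J & pinv opt C cst sz r (pstep (sz (pcur st)) a q st)].
Proof.
move=> ol cC dC szJ [/andP[c0 cJ] iC il it ip]; rewrite /pstep; case: (leqP (pcur st) J) => [cJ'|Jc]; last first.
  exists 0, 0; split=> //; split=> //; first by rewrite c0.
  by rewrite big_geq //; lia.
set ci := pcur st in c0 cJ iC il it ip cJ' *; set A := pavail st.
have c0J : 0 < ci <= J by rewrite c0.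
have CA : C ci \subset A.
  by apply/subsetP => y /(iC ci); rewrite leqnn cJ' => /(_ isT)[h1 h2 h3]; rewrite inE h1 h2.
have [v cv vc] := cC ci c0J.
have [_ _ aV] := VfP (sz ci) A.
have Vc : Vf (sz ci) A <= cst ci by apply: leq_trans (aV _ _ cv CA) vc.
have Vl : Vf (sz ci) A <= lam.
  by move: it; rewrite big_ltn //; lia.
have [v' cQ [_ QA]] := elimin_ok Vl; have [kQ _ _] := certQ_sound cQ.
set Q := elimin (sz ci) A in cQ QA kQ *.
have [[i [y [/andP[ci_i iJ] yQ yC]]]|none] :=
    classic (exists i y, [/\ ci < i <= J, y \in Q & y \in C i]); last first.
  exists 0, 0; split=> //=; split=> /=.
  - by rewrite ltnS.
  - move=> i y /andP[ci_i iJ] yC; have [|h1 h2 h3] := iC i y _ yC; first by rewrite (ltnW ci_i).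
    split=> //; rewrite in_setU negb_or h2; apply/negP => yQ; apply: none; exists i, y.
    by rewrite ci_i.
  - by move=> y h; apply: il; exact: ltnW.
  - by move: it; rewrite big_ltn //; lia.
  - by move: ip; rewrite big_ltn //; lia.
have i0J : 0 < i <= J by rewrite iJ andbT; lia.
have [q ql Eq] := qsel_ok yQ.
exists i, q; split=> //; first by rewrite kQ in ql; have := szJ ci; lia.
have -> : (i == 0) = false by apply/eqP; lia.
rewrite Eq.
have [|_ _ h3] := iC i y _ yC; first by rewrite (ltnW ci_i).
(* Candidates avoid vertices reserved for later components, so [y] is still unlabelled and labelling
   it makes progress. *)
have yl : plab st y = 0.
  have := subsetP QA _ yQ; rewrite inE => /and3P[_ _ /orP[/eqP //|/eqP h]].
  by case/orP: h3 => /eqP //; rewrite h /ci => h4; move: ci_i; rewrite /ci h4 ltnn.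
split=> //=.
- by rewrite c0.
- move=> i' y' hi' y'C; have [h1 h2 h4] := iC i' y' hi' y'C; split=> //.
  case: (y' =P y) => [Ey|_] //; have i0 : 0 < i' <= J by move/andP: hi' => [a b]; rewrite b andbT; lia.
  by rewrite (dC i i' y) ?eqxx ?orbT // -Ey.
- by move=> y'; case: eqP => [-> _|_]; [split|exact: il].
- have ir : ci <= i < J.+1 by rewrite (ltnW ci_i).
  have lt : \sum_(ci <= i0 < J.+1) #|[set y0 in C i0 | (if y0 == y then i else plab st y0) == 0]| <
      \sum_(ci <= i0 < J.+1) #|[set y0 in C i0 | plab st y0 == 0]|.
    rewrite (bigD1_seq i) ?mem_index_iota ?iota_uniq //= [X in _ < X](bigD1_seq i) ?mem_index_iota ?iota_uniq //=.
    rewrite -addSn; apply: leq_add.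
      apply: proper_card; rewrite properE; apply/andP; split.
        apply/subsetP => z; rewrite !inE => /andP[-> /=]; case: (z =P y) => // _ /eqP; lia.
      apply/subsetPn; exists y; rewrite !inE yC /= ?yl // eqxx /=; apply/eqP; lia.
    apply: leq_sum => k _; apply: subset_leq_card; apply/subsetP => z; rewrite !inE => /andP[-> /=].
    case: (z =P y) => // _ /eqP; lia.
  lia.
Qed.

(** The potential starts at J vertices plus J component slots, hence the 2 J steps; if there are
    fewer than J components the list is padded by empty sets. *)
Lemma packing_exists (F : {set V}) : #|F| = J -> {in F, forall f, okv f} -> #|DX F| <= lam ->
  exists dd, [/\ forall i, dd i <= J, pcur (prun dd (J + J)) = J.+1,
    \sum_(1 <= c < J.+1) psz dd c = J & ptot (prun dd (J + J)) <= #|DX F|].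
Proof.
move=> FJ Fok Fl; have [L [Lc Ln Ld]] := decompose F.
pose C i := nth set0 L i.-1; pose sz i := #|C i|.
have inL i y : 0 < i -> y \in C i -> i.-1 < size L /\ C i \in L.
  rewrite /C => i0; case: (ltnP i.-1 (size L)) => [h _|h]; last by rewrite nth_default ?inE.
  by split=> //; exact: mem_nth.
have LF Q : Q \in L -> Q \subset F.
  move=> QL; apply/subsetP => y yQ; have := Ln y; case: (y \in F) => // /eqP.
  by rewrite -leqn0 leqNgt -has_count; case/hasP; exists Q.
have CF i : 0 < i -> C i \subset F.
  by move=> i0; apply/subsetP => y yC; have [_ /LF/subsetP] := inL i y i0 yC; apply.
have Cdis i j y : 0 < i -> 0 < j -> y \in C i -> y \in C j -> i = j.
  move=> i0 j0 yi yj; have [si _] := inL _ _ i0 yi; have [sj _] := inL _ _ j0 yj.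
  apply/eqP; apply: contraT => ij.
  have : count (fun Q : {set V} => y \in Q) L <= 1 by rewrite Ln leq_b1.
  have ij' : Ordinal sj != Ordinal si by apply/eqP => -[]; lia.
  rewrite -sum1_count (big_nth set0) big_mkord big_mkcond (bigD1 (Ordinal si)) //= (bigD1 (Ordinal sj)) //=.
  by rewrite -/(C i) -/(C j) yi yj.
have szF i : 0 < i -> sz i <= J by move=> i0; rewrite -FJ; exact: subset_leq_card (CF i i0).
have sumL (f : {set V} -> nat) : f set0 = 0 -> size L <= J -> \sum_(1 <= c < J.+1) f (C c) = \sum_(Q <- L) f Q.
  move=> f0 sL; rewrite big_add1 /= (big_cat_nat (n := size L)) //= -(big_nth set0 xpredT f).
  rewrite [X in _ + X]big_nat_cond [X in _ + X]big1 ?addn0 // => i /andP[/andP[h _] _].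
  by rewrite /C /= nth_default.
have cardL : \sum_(Q <- L) #|Q| = J.
  rewrite -FJ -sum1_card [RHS]big_mkcond /=.
  rewrite [RHS](eq_bigr (fun y => \sum_(Q <- L) (if y \in Q then 1 else 0))); last first.
    by move=> y _; have := Ln y; rewrite -sum1_count big_mkcond => ->; case: (y \in F).
  by rewrite exchange_big /=; apply: eq_bigr => Q _; rewrite -sum1_card big_mkcond.
have sL : size L <= J.
  rewrite -cardL -sum1_size big_seq [X in _ <= X]big_seq; apply: leq_sum => Q /Lc[Q0 _].
  by rewrite card_gt0.
have cC i : 0 < i <= J -> exists2 v, CertQ (sz i) (C i) v & v <= #|DX (C i)|.
  move=> /andP[i0 iJ]; have [C0|C0] := eqVneq (C i) set0.
    by exists 0 => //; left; rewrite /sz C0 cards0.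
  have [y yC] := set0Pn _ C0; have [_ /Lc[_ Cc]] := inL _ _ i0 yC.
  apply: certQ_complete => // [|g gC]; first exact: leq_trans (szF i i0) _.
  by apply: Fok; exact: (subsetP (CF i i0)).
have key t : t <= J + J -> exists dd, [/\ forall i, dd i <= J, forall c, 0 < c <= J -> psz dd c = sz c &
    pinv #|DX F| C (fun i => #|DX (C i)|) sz (J + J - t) (prun dd t)].
  elim: t => [_|t IH tJ].
    pose dd i := if J + J + (J + J) <= i then sz (i - (J + J + (J + J))).+1 else 0.
    exists dd; split.
    - by move=> i; rewrite /dd; case: ifP => // _; exact: szF.
    - by move=> c /andP[c0 _]; rewrite /psz /dd leq_addr addKn prednK.
    - split=> //=.
      + by move=> i y /andP[i0 _] yC; rewrite inE; split=> //; apply: Fok; exact: (subsetP (CF i i0)).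
      + by rewrite add0n (sumL (fun Q => #|DX Q|)) // /DX big_set0 cards0.
      + rewrite (eq_bigr (fun i => #|C i|)); last by move=> i _; apply: eq_card => y; rewrite inE andbT.
        by rewrite (sumL (fun Q => #|Q|)) ?cards0 // cardL subn0 subn1.
  have [dd [ddJ ddz ddi]] := IH (ltnW tJ).
  have rE : J + J - t = (J + J - t.+1).+1 by lia.
  rewrite rE in ddi.
  (* Components are numbered from 1; the value at 0 is a filler under which the size bound holds for
     all indices. *)
  pose sz' i := if 0 < i then sz i else 0.
  have [a [q [aJ qJ inv]]] : exists a q, [/\ a <= J, q <= J & pinv #|DX F| C (fun i => #|DX (C i)|) sz' (J + J - t.+1)
      (pstep (sz' (pcur (prun dd t))) a q (prun dd t))].
    apply: pstep_target => //.
    - by move=> i hi; rewrite /sz'; case/andP: (hi) => -> _; exact: cC.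
    - by move=> i j y /andP[i0 _] /andP[j0 _]; exact: Cdis.
    - by move=> i; rewrite /sz'; case: ifP => // /szF.
  pose dd' := updn (updn dd t a) (J + J + t) q.
  have E1 : prun dd' t = prun dd t.
    apply: prun_ext => [|i it|c /andP[c0 cJ]]; first lia.
      rewrite /dd' /updn; split.
        by case: eqP => [|_]; [lia|case: eqP => [|_] //; lia].
      by case: eqP => [|_]; [lia|case: eqP => [|_] //; lia].
    by rewrite /psz /dd' /updn; case: eqP => [|_]; [lia|case: eqP => [|_] //; lia].
  exists dd'; split.
  - by move=> i; rewrite /dd' /updn; case: eqP => // _; case: eqP.
  - move=> c hc; rewrite -ddz // /psz /dd' /updn; case: eqP => [|_]; first lia.
    by case: eqP => [|_] //; lia.
  - rewrite /= E1; have -> : dd' t = a.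
      by rewrite /dd' /updn; case: eqP => [|_]; [lia|rewrite eqxx].
    have -> : dd' (J + J + t) = q by rewrite /dd' /updn eqxx.
    have c0 := prun_cur dd t.
    have Ep : pcur (prun dd t) <= J -> psz dd' (pcur (prun dd t)) = sz' (pcur (prun dd t)).
      move=> cJ; rewrite /sz' c0 -ddz ?c0 // /psz /dd' /updn.
      by case: eqP => [|_]; [lia|case: eqP => [|_] //; lia].
    have -> : pstep (psz dd' (pcur (prun dd t))) a q (prun dd t) = pstep (sz' (pcur (prun dd t))) a q (prun dd t).
      by rewrite /pstep; case: ifP => // cJ; rewrite Ep.
    suff : pinv #|DX F| C (fun i => #|DX (C i)|) sz' (J + J - t.+1) (pstep (sz' (pcur (prun dd t))) a q (prun dd t)) by [].
    exact: inv.
have [dd [ddJ ddz [/andP[_ h1] _ _ h2 h3]]] := key _ (leqnn _).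
rewrite subnn in h3.
have Ec : pcur (prun dd (J + J)) = J.+1 by lia.
exists dd; split=> //; last by apply: leq_trans h2; exact: leq_addr.
rewrite -[RHS]cardL -(sumL (fun Q => #|Q|)) ?cards0 //.
by apply: eq_big_nat => c hc; rewrite ddz.
Qed.

End Certificates.

(** * Positions on chains as minimum cuts *)

Section Residual.
Variable V : finType.
Implicit Types (R : V -> V -> nat) (S : {set V}).

Definition cutv R S := \sum_(q : V * V | (q.1 \in S) && (q.2 \notin S)) R q.1 q.2.

(** One unit of flow from [p] to [z], recorded in the residual capacities alone; no flow is ever
    represented. *)
Definition push p z R x y :=
  if (x == p) && (y == z) then R x y - 1
  else if (x == z) && (y == p) then R x y + 1 else R x y.

Lemma cutv_push p z R S : p != z -> 0 < R p z ->
  cutv (push p z R) S + (p \in S) = cutv R S + (z \in S).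
Proof.
move=> pz R0; have zp : (z == p) = false by rewrite eq_sym; apply/negbTE.
pose Q (q : V * V) := (q.1 \in S) && (q.2 \notin S).
have E1 q : q != (p, z) -> q != (z, p) -> push p z R q.1 q.2 = R q.1 q.2.
  case: q => x y; rewrite /push /= !xpair_eqE => /negbTE -> /negbTE ->.
  by [].
have e1 : push p z R p z = R p z - 1 by rewrite /push !eqxx.
have e2 : push p z R z p = R z p + 1 by rewrite /push zp !eqxx.
rewrite /cutv -/(Q _); case ps: (p \in S); case zs: (z \in S).
- congr (_ + _); apply: eq_bigr => -[x y] /= /andP[xs ys]; apply: (E1 (x, y)).
    by apply: contraNneq ys => -[_ ->].
  by apply: contraNneq ys => -[_ ->].
- rewrite (bigD1 (p, z)) /=; last by rewrite ps zs.
  rewrite [X in _ = X + _](bigD1 (p, z)) /=; last by rewrite ps zs.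
  rewrite e1 (eq_bigr (fun q => R q.1 q.2)); first lia.
  move=> q /andP[/andP[h1 h2] h3]; apply: E1 => //.
  by apply: contraTneq h1 => ->; rewrite zs.
- rewrite (bigD1 (z, p)) /=; last by rewrite ps zs.
  rewrite [X in _ = X + _](bigD1 (z, p)) /=; last by rewrite ps zs.
  rewrite e2 (eq_bigr (fun q => R q.1 q.2)); first lia.
  move=> q /andP[/andP[h1 h2] h3]; apply: E1 => //.
  by apply: contraTneq h1 => ->; rewrite ps.
- congr (_ + _); apply: eq_bigr => -[x y] /= /andP[xs ys]; apply: (E1 (x, y)).
    by apply: contraTneq xs => -[-> _]; rewrite ps.
  by apply: contraTneq xs => -[-> _]; rewrite zs.
Qed.

Definition wstep (pr : V -> V) (zR : V * (V -> V -> nat)) :=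
  (pr zR.1, if pr zR.1 == zR.1 then zR.2 else push (pr zR.1) zR.1 zR.2).

(** The changes of [cutv_push] telescope on the way from [z] back to a source. Ranks fall strictly,
    so an edge still has its capacity when the walk gets there; surplus iterations rest at the
    source. *)
Lemma walk_ok (pr : V -> V) (rk : V -> nat) (src vs : pred V) : subpred src vs ->
  (forall y, src y -> pr y = y) ->
  (forall y, vs y -> ~~ src y -> vs (pr y) && (rk (pr y) < rk y)) ->
  forall k z R, vs z -> rk z <= k ->
  (forall y, vs y -> ~~ src y -> rk y <= rk z -> 0 < R (pr y) y) ->
  let zR := iter k (wstep pr) (z, R) in
  src zR.1 /\ forall S, cutv zR.2 S + (zR.1 \in S) = cutv R S + (z \in S).
Proof.
move=> sv sp vp k z R; elim: k z R => [|k IH] z R vz rz Rp.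
  split=> //=; apply: contraT => nz; have /andP[_] := vp z vz nz; lia.
rewrite iterSr /wstep /=; have [sz|nz] := boolP (src z).
  rewrite (sp z sz) eqxx; elim: k {IH rz} => [|k IHk] //=.
  move: IHk; case: (iter k _ _) => z' R' /= [s1 s2].
  by rewrite /wstep /= (sp z' s1) eqxx.
have /andP[vz' rz'] := vp z vz nz.
have zz : pr z != z by apply: contraTneq rz' => ->; rewrite ltnn.
rewrite (negbTE zz); have rk' : rk (pr z) <= k by lia.
have R' y : vs y -> ~~ src y -> rk y <= rk (pr z) -> 0 < push (pr z) z R (pr y) y.
  move=> vy ny ry; have yz : y != z by apply: contraTneq ry => ->; lia.
  by rewrite /push (negbTE yz) andbF; case: ifP => _; have := Rp y vy ny; lia.
have [h1 h2] := IH (pr z) _ vz' rk' R'.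
by split=> // S; rewrite h2 cutv_push //; apply: Rp.
Qed.

End Residual.

(** * The capacity network of a guess *)

Section CutGraph.
Variables (V E : finType) (es et : E -> V) (anc : rel V) (root : V).
Hypothesis anc_refl : reflexive anc.
Hypothesis anc_trans : transitive anc.
Hypothesis anc_anti : antisymmetric anc.
Hypothesis anc_tot : forall v w x, anc v x -> anc w x -> anc v w || anc w v.
Hypothesis anc_root : forall x, anc root x.
Variable par : V -> V.
Hypothesis anc_par : forall v x, x != root -> anc v x = (v == x) || anc v (par x).
Hypothesis par_lt : forall x, x != root -> ~~ anc x (par x).
Variable idx : V -> nat.
Hypothesis idx_inj : injective idx.

Definition mult a b := #|[set e | ((es e == a) && (et e == b)) || ((es e == b) && (et e == a))]|.

(** An edge matches the two orderings of its ends, of which the antisymmetric [Q] accepts at most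
    one; it accepts no loop. *)
Lemma count_pairs (Q : rel V) : (forall a b, Q a b -> ~~ Q b a) ->
  \sum_a \sum_b (if Q a b then mult a b else 0) =
  #|[set e | Q (es e) (et e) || Q (et e) (es e)]|.
Proof.
move=> as_; have ir a : Q a a = false by apply/negP => h; move: (as_ _ _ h); rewrite h.
pose jn (q : V * V) e := ((es e == q.1) && (et e == q.2)) || ((es e == q.2) && (et e == q.1)).
rewrite pair_big /= -sum1_card [RHS]big_mkcond /=.
under eq_bigr => q _.
  rewrite (_ : (if _ then _ else _) = \sum_e (if Q q.1 q.2 && jn q e then 1 else 0)); last first.
    rewrite /mult -sum1_card big_mkcond /=; case: (Q q.1 q.2); last by rewrite big1.
    by apply: eq_bigr => e _; rewrite inE.
  over.
rewrite exchange_big /=; apply: eq_bigr => e _; rewrite inE.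
have jnE (q : V * V) : jn q e = (q == (es e, et e)) || (q == (et e, es e)).
  by case: q => x y; rewrite /jn /= !xpair_eqE (eq_sym x) (eq_sym y) (eq_sym x) (eq_sym y) andbC [X in _ || X]andbC orbC [X in _ || X]andbC orbC [X in X || _]andbC.
have [En|En] := eqVneq (es e) (et e).
  rewrite En ir big1 // => q _; rewrite jnE En orbb; case: eqP => [->|]; rewrite ?ir ?andbF //.
rewrite (bigD1 (es e, et e)) //= (bigD1 (et e, es e)) /=; last by rewrite xpair_eqE eq_sym (negbTE En).
rewrite big1 => [|q /andP[/negbTE q1 /negbTE q2]]; last by rewrite jnE q1 q2 andbF.
rewrite !jnE !eqxx !orbT !andbT addn0; case h: (Q (es e) (et e)) => //=.
  by rewrite (negbTE (as_ _ _ h)).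
Qed.

Variables (J : nat) (used : pred nat) (w x : nat -> V) (c : V) (inf : nat) (psi : nat -> V -> nat).
Hypothesis wx : forall i, i < J -> used i -> anc (w i) (x i).
Hypothesis w_root : forall i, i < J -> used i -> w i != root.
Hypothesis w_anti : forall i j, i < J -> j < J -> used i -> used j -> i != j -> ~~ anc (w i) (w j).
Hypothesis inf0 : 0 < inf.

(* One plus the number of the chain whose region contains a, or 0. *)
Definition chn a := \sum_(i < J) (if used i && anc (w i) a then i.+1 else 0).

Lemma w_disj i j a : i < J -> j < J -> used i -> used j -> anc (w i) a -> anc (w j) a -> i = j.
Proof.
move=> iJ jJ ui uj wi wj; apply/eqP; apply: contraT => ij.
have a1 := w_anti iJ jJ ui uj ij; rewrite eq_sym in ij; have a2 := w_anti jJ iJ uj ui ij.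
by case/orP: (anc_tot wi wj) => h; [rewrite h in a1|rewrite h in a2].
Qed.

Lemma chnE i a : i < J -> used i -> anc (w i) a -> chn a = i.+1.
Proof.
move=> iJ ui wa; rewrite /chn (bigD1 (Ordinal iJ)) //= ui wa /= big1 ?addn0 // => j ji.
case: ifP => // /andP[uj wj]; have ij := w_disj iJ (ltn_ord j) ui uj wa wj.
by case/eqP: ji; apply: val_inj; rewrite /= ij.
Qed.

Lemma chnP a : (chn a != 0) -> exists i, [/\ i < J, used i, anc (w i) a & chn a = i.+1].
Proof.
have [/existsP[i /andP[ui wi]] _|no] := boolP [exists i : 'I_J, used i && anc (w i) a].
  by exists i; split=> //; exact: chnE.
rewrite /chn big1 ?eqxx // => i _; case: ifP => // h.
by case/negP: no; apply/existsP; exists i.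
Qed.

Definition same a b := anc c a == anc c b.

(* A source side S of finite capacity is the union of the subtrees below one position on
   each chain: the capacity psi sits on the edge from a position to its parent, infinite
   capacity on the edge back.  An edge of the graph between two chains is cut as soon as one
   of its ends lies in S: the end of smaller index pays for it through an edge to the root,
   the other one only when the first is outside S. *)
Definition capf a b :=
  if chn a == 0 then 0 else
  (if b == par a then if anc a (x (chn a).-1) then psi (chn a).-1 a else inf else 0)
  + (if (a == par b) && (chn b != 0) then inf else 0)
  + (if same a b && [|| chn b == 0, chn b == chn a | idx b < idx a] then mult a b else 0)
  + (if b == root then \sum_d (if same a d && [&& chn d != 0, chn d != chn a & idx a < idx d]
                               then mult a d else 0) else 0).

Lemma chn_root : chn root = 0.
Proof.
rewrite /chn big1 // => i _; case: ifP => // /andP[ui wr]; case/eqP: (w_root (ltn_ord i) ui).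
by apply: anc_anti; rewrite wr anc_root.
Qed.

Section Positions.
Variable p : nat -> V.
Hypothesis wp : forall i, i < J -> used i -> anc (w i) (p i).
Hypothesis px : forall i, i < J -> used i -> anc (p i) (x i).

Definition psub := [set a | [exists i : 'I_J, used i && anc (p i) a]].
Definition pfront := [set p i | i : 'I_J & used i].
Definition DXe (X : {set V}) := [set e | [exists f in X, anc f (es e) != anc f (et e)]].

Lemma psubP a : reflect (exists i, [/\ i < J, used i & anc (p i) a]) (a \in psub).
Proof.
rewrite inE; apply: (iffP existsP) => [[i /andP[ui pa]]|[i [iJ ui pa]]]; first by exists i; split.
by exists (Ordinal iJ); rewrite /= ui.
Qed.

Lemma psub_chn i a : i < J -> used i -> anc (p i) a -> chn a = i.+1.
Proof. by move=> iJ ui pa; apply: chnE => //; exact: anc_trans (wp iJ ui) pa. Qed.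

Lemma psub_chn0 a : a \in psub -> chn a != 0.
Proof. by case/psubP=> i [iJ ui /(psub_chn iJ ui) ->]. Qed.

Lemma p_root i : i < J -> used i -> p i != root.
Proof.
move=> iJ ui; apply/eqP => pr; have := chnE iJ ui (wp iJ ui).
by rewrite pr chn_root.
Qed.

(** [Q] selects the end that pays for an edge: the end in [psub] if there is only one, and of two
    ends in different subtrees the one of smaller index. No infinite capacity leaves [psub], and in
    each subtree the position is the only vertex with its parent outside. *)
Lemma cut_positions : cutv capf psub =
  \sum_(i < J | used i) psi i (p i) +
  #|DXe pfront :\: [set e | anc c (es e) != anc c (et e)]|.
Proof.
pose T1 a b := if b == par a then psi (chn a).-1 a else 0.
pose Q a b := [&& same a b, a \in psub & ((b \notin psub) && [|| chn b == 0, chn b == chn a | idx b < idx a])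
   || [&& chn b != 0, chn b != chn a & idx a < idx b]].
have Qas a b : Q a b -> ~~ Q b a.
  rewrite /Q => /and3P[_ aS h]; apply/negP => /and3P[_ bS].
  rewrite aS bS /= in h *; case/and3P: h => _ _ l1 /and3P[_ _ l2]; lia.
have rS : root \notin psub by apply/negP => /psub_chn0; rewrite chn_root.
have E1 : #|DXe pfront :\: [set e | anc c (es e) != anc c (et e)]| = \sum_a \sum_b (if Q a b then mult a b else 0).
  rewrite (count_pairs Qas); apply: eq_card => e; rewrite !inE negbK.
  set a := es e; set b := et e.
  have Qab d1 d2 : same d1 d2 -> d1 \in psub -> d2 \notin psub -> Q d1 d2.
    move=> sm h1 h2; rewrite /Q sm h1 h2 /=; case: eqP => //= h3; case: eqP => //= h4.
    by case: ltngtP => //= /idx_inj h5; rewrite h5 h1 in h2.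
  have sab : same b a = same a b by rewrite /same eq_sym.
  rewrite -/(same a b); case sm: (same a b); last by rewrite /Q sab sm.
  rewrite /=; apply/exists_inP/idP => [[f /imsetP[j]]|].
    rewrite inE => uj -> sp.
    case aS: (a \in psub); case bS: (b \in psub); last 1 first.
    - move: sp; have /negbTE -> : ~~ anc (p j) a.
        by apply/negP => h; move/negP: aS; apply; apply/psubP; exists j.
      by have /negbTE -> : ~~ anc (p j) b; [apply/negP => h; move/negP: bS; apply; apply/psubP; exists j|].
    - case/psubP: (aS) => i1 [i1J u1 pa]; case/psubP: (bS) => i2 [i2J u2 pb].
      have i12 : i1 != i2.
        apply: contraNneq sp => Ei; rewrite -Ei in pb; have [Ej|nj] := eqVneq (j : nat) i1.
          by rewrite Ej pa pb.
        have na y : anc (p i1) y -> anc (p j) y = false.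
          move=> h; apply/negP => h'; case/eqP: nj.
          by have := psub_chn (ltn_ord j) uj h'; rewrite (psub_chn i1J u1 h) => -[].
        by rewrite !na.
      have ca := psub_chn i1J u1 pa; have cb := psub_chn i2J u2 pb.
      have /negbTE i21 : i2 != i1 by rewrite eq_sym.
      rewrite /Q sab sm aS bS ca cb /= !eqSS (negbTE i12) i21 /=.
      case: ltngtP => // /idx_inj Eab; move: cb; rewrite -Eab ca => -[Ei].
      by rewrite Ei eqxx in i12.
    - by rewrite Qab // bS.
    - by rewrite (Qab b a) ?orbT // ?sab // aS.
  have sepP i d1 d2 : i < J -> used i -> anc (p i) d1 -> ~~ anc (p i) d2 -> exists2 f, f \in pfront & anc f d1 != anc f d2.
    move=> iJ ui h1 /negbTE h2; exists (p i); last by rewrite h1 h2.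
    by apply/imsetP; exists (Ordinal iJ); rewrite ?inE.
  have QP d1 d2 : Q d1 d2 -> exists2 f, f \in pfront & anc f d1 != anc f d2.
    case/and3P => _ /psubP[i [iJ ui pd]] h; apply: (sepP i) => //; apply/negP => pd2.
    have c1 := psub_chn iJ ui pd; have c2 := psub_chn iJ ui pd2.
    have d2S : d2 \in psub by apply/psubP; exists i.
    by move: h; rewrite d2S c1 c2 eqxx.
  case/orP => [/QP//|/QP[f fF h]]; exists f => //; by rewrite eq_sym.
have E2 : \sum_(i < J | used i) psi i (p i) = \sum_(a in psub) \sum_(b | b \notin psub) T1 a b.
  have par_out i : i < J -> used i -> par (p i) \notin psub.
    move=> iJ ui; apply/negP => /psubP[j [jJ uj h]].
    have pr := p_root iJ ui; have hj : anc (p j) (p i) by rewrite anc_par // h orbT.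
    have Ej : j = i by have := psub_chn jJ uj hj; rewrite (psub_chn iJ ui (anc_refl _)) => -[].
    by move: h; rewrite Ej (negbTE (par_lt pr)).
  have inner a : a \in psub -> \sum_(b | b \notin psub) T1 a b = if par a \notin psub then psi (chn a).-1 a else 0.
    move=> aS; rewrite (bigID (fun b => b == par a)) /= [X in _ + X]big1 ?addn0; last first.
      by move=> b /andP[_ /negbTE h]; rewrite /T1 h.
    case: ifP => h; last first.
      by rewrite big_pred0 // => b; apply/negP => /andP[hb /eqP Eb]; rewrite Eb h in hb.
    rewrite (big_pred1 (par a)) /T1 ?eqxx // => b; rewrite /=; case: eqP => [->|_]; by rewrite ?andbF ?h.
  rewrite (eq_bigr _ inner) -big_mkcondr /=.
  rewrite [RHS](eq_bigl (fun a => a \in pfront)).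
    rewrite /pfront big_imset /=; last first.
      move=> i j; rewrite !inE => ui uj Ep; apply: val_inj => /=.
      have := psub_chn (ltn_ord i) ui (anc_refl _).
      by rewrite Ep (psub_chn (ltn_ord j) uj (anc_refl _)) => -[].
    rewrite [RHS](eq_bigl (fun i : 'I_J => used i)); last by move=> i; rewrite inE.
    by apply: eq_bigr => i ui; rewrite (psub_chn (ltn_ord i) ui (anc_refl _)).
  move=> a; apply/andP/idP => [[/psubP[i [iJ ui pa]] ho]|/imsetP[i]].
    have ar : a != root by apply/eqP => ar; move: (psub_chn iJ ui pa); rewrite ar chn_root.
    move: pa; rewrite anc_par // => /orP[/eqP <-|h].
      by apply/imsetP; exists (Ordinal iJ); rewrite ?inE.
    by case/negP: ho; apply/psubP; exists i.
  rewrite inE => ui ->; split; last exact: par_out.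
  by apply/psubP; exists i.
rewrite E1 E2 /cutv -(pair_big_dep (fun a => a \in psub) (fun _ b => b \notin psub) (fun a b => capf a b)) /=.
have -> : \sum_a \sum_b (if Q a b then mult a b else 0) =
   \sum_(a in psub) \sum_b (if Q a b then mult a b else 0).
  rewrite [RHS]big_mkcond; apply: eq_bigr => a _; case: ifP => // na.
  by rewrite big1 // => b _; rewrite /Q na andbF.
rewrite -big_split /=; apply: eq_bigr => a aS.
have ca := psub_chn0 aS; have [i [iJ ui pa]] := psubP _ aS.
have ci := psub_chn iJ ui pa.
pose F2 b := if same a b && [|| chn b == 0, chn b == chn a | idx b < idx a] then mult a b else 0.
pose F3 b := if same a b && [&& chn b != 0, chn b != chn a & idx a < idx b] then mult a b else 0.
have -> : \sum_(b | b \notin psub) capf a b =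
   \sum_(b | b \notin psub) (T1 a b + F2 b + (if b == root then \sum_d F3 d else 0)).
  apply: eq_bigr => b bS; rewrite /capf (negbTE ca) -/(F2 b).
  have -> : (if (a == par b) && (chn b != 0) then inf else 0) = 0.
    case: ifP => // /andP[/eqP Ea /chnP[j [jJ uj wb cb]]].
    have br : b != root by apply/eqP => br; move: cb; rewrite br chn_root.
    by case/negP: bS; apply/psubP; exists i; rewrite anc_par // -Ea pa orbT.
  rewrite addn0; congr (_ + _ + _); rewrite /T1; case: ifP => // /eqP Eb.
  suff Ea : a = p i by rewrite ci /= Ea px.
  have ar : a != root by apply/eqP => ar; rewrite ar chn_root in ci.
  move: pa; rewrite anc_par // -Eb => /orP[/eqP //|h].
  by case/negP: bS; apply/psubP; exists i.
rewrite !big_split /= -addnA; congr (_ + _).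
have -> : \sum_(b | b \notin psub) (if b == root then \sum_d F3 d else 0) = \sum_d F3 d.
  by rewrite (bigD1 root) //= eqxx [X in _ + X]big1 ?addn0 // => b /andP[_ /negbTE ->].
rewrite big_mkcond -big_split /=; apply: eq_bigr => b _; rewrite /Q aS /F2 /F3 /=.
case sm: (same a b) => /=; last by rewrite if_same.
case: (b \in psub) => //=.
case h1: (chn b == 0) => /=; first by rewrite addn0.
case h2: (chn b == chn a) => /=; first by rewrite addn0.
by case: (ltngtP (idx b) (idx a)) => //= _; rewrite ?addn0.
Qed.

End Positions.

Definition goodcut (S : {set V}) :=
  (forall i a, i < J -> used i -> anc (x i) a -> a \in S) /\ (forall a, a \in S -> chn a != 0).

Lemma psub_good (p : nat -> V) : (forall i, i < J -> used i -> anc (w i) (p i)) ->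
  (forall i, i < J -> used i -> anc (p i) (x i)) -> goodcut (psub p).
Proof.
move=> wp px; split=> [i a iJ ui xa|a]; last exact: psub_chn0.
by apply/psubP; exists i; split=> //; exact: anc_trans (px i iJ ui) xa.
Qed.

Lemma cutv_term (R : V -> V -> nat) (S : {set V}) a b : a \in S -> b \notin S -> R a b <= cutv R S.
Proof.
by move=> aS bS; rewrite /cutv (bigD1 (a, b)) /= ?aS ?bS // leq_addr.
Qed.

Definition depth a := #|[set z | anc z a]|.

Lemma depth_par a : a != root -> depth (par a) < depth a.
Proof.
move=> ar; apply: proper_card; rewrite properE; apply/andP; split.
  by apply/subsetP => z; rewrite !inE => h; rewrite anc_par // h orbT.
by apply/subsetPn; exists a; rewrite inE ?anc_refl // par_lt.
Qed.

(** Infinite edges from parents to children close [S] downwards, and those from vertices off the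
    chain to their parents make it reach the chain. Hence [S] is, in each region, the subtree of its
    topmost vertex on the chain. *)
Lemma cut_structure (S : {set V}) : goodcut S -> cutv capf S < inf ->
  exists p : nat -> V, [/\ forall i, i < J -> used i -> anc (w i) (p i),
    forall i, i < J -> used i -> anc (p i) (x i) & S = psub p].
Proof.
move=> [gx gc] cl.
have T a b : a \in S -> inf <= capf a b -> b \in S.
  move=> aS ab; apply: contraT => bS; have := cutv_term capf aS bS; lia.
have nroot a : a \in S -> a != root by move=> /gc; apply: contraNneq => ->; rewrite chn_root.
have down i a b : i < J -> used i -> a \in S -> anc (w i) a -> anc a b -> b \in S.
  move=> iJ ui aS wa; have [m] := ubnP (depth b); elim: m b => // m IH b bm ab.
  have [<-//|nab] := eqVneq a b.
  have br : b != root.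
    by apply: contraNneq nab => br; apply/eqP; apply: anc_anti; rewrite ab br anc_root.
  have apb : anc a (par b) by move: ab; rewrite anc_par // (negbTE nab).
  have pS : par b \in S by apply: IH apb; have := depth_par br; lia.
  apply: (T _ _ pS); rewrite /capf (negbTE (gc _ pS)) eqxx.
  have -> : chn b != 0 by rewrite (chnE iJ ui (anc_trans wa ab)).
  by rewrite /=; lia.
have up i a : i < J -> used i -> a \in S -> anc (w i) a -> exists2 b, b \in S & [&& anc b a, anc (w i) b & anc b (x i)].
  move=> iJ ui; have [m] := ubnP (depth a); elim: m a => // m IH a am aS wa.
  have [ax|nax] := boolP (anc a (x i)); first by exists a; rewrite // anc_refl wa.
  have ar := nroot a aS.
  have wpa : anc (w i) (par a).
    move: wa; rewrite anc_par // => /orP[/eqP Ew|//].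
    by rewrite -Ew wx in nax.
  have pS : par a \in S.
    apply: (T _ _ aS); rewrite /capf (chnE iJ ui wa) /= eqxx (negbTE nax); lia.
  have am' : depth (par a) < m by have := depth_par ar; lia.
  have [b bS /and3P[h1 h2 h3]] := IH (par a) am' pS wpa.
  by exists b => //; rewrite h2 h3 anc_par // h1 orbT.
have top i : exists q, i < J -> used i -> [/\ q \in S, anc (w i) q, anc q (x i) &
    forall b, b \in S -> anc (w i) b -> anc b (x i) -> anc q b].
  have [iJ|] := ltnP i J; last by exists root.
  have [ui|] := boolP (used i); last by exists root.
  pose P q := [&& q \in S, anc (w i) q & anc q (x i)].
  have Px : P (x i) by rewrite /P (gx i) ?wx // anc_refl.
  case: (arg_minnP depth Px) => q /and3P[q1 q2 q3] qm; exists q => _ _; split=> // b b1 b2 b3.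
  case/orP: (anc_tot b3 q3) => // bq.
  have le : depth q <= depth b by apply: qm; rewrite /P b1 b2.
  have sub : [set z | anc z b] \subset [set z | anc z q].
    by apply/subsetP => z; rewrite !inE => zb; exact: anc_trans zb bq.
  have /eqP E2 : [set z | anc z b] == [set z | anc z q] by rewrite eqEcard sub.
  by have : q \in [set z | anc z q]; [rewrite inE|rewrite -E2 inE].
have [p' pP] := fin_all_exists (fun i : 'I_J => top i).
pose p i := if insub i is Some o then p' o else root.
have {}pP i : i < J -> used i -> [/\ p i \in S, anc (w i) (p i), anc (p i) (x i) &
    forall b, b \in S -> anc (w i) b -> anc b (x i) -> anc (p i) b].
  move=> iJ ui; have := pP (Ordinal iJ) iJ ui.
  by rewrite /p insubT.
exists p; split=> [i iJ ui|i iJ ui|]; [by have [] := pP i iJ ui|by have [] := pP i iJ ui|].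
apply/setP => a; apply/idP/psubP => [aS|[i [iJ ui pa]]].
  have [i [iJ ui wa _]] := chnP (gc _ aS).
  have [b bS /and3P[ba wb bx]] := up i a iJ ui aS wa.
  have [_ _ _ h] := pP i iJ ui.
  by exists i; split=> //; exact: anc_trans (h b bS wb bx) ba.
have [h1 h2 _ _] := pP i iJ ui; exact: down iJ ui h1 h2 pa.
Qed.

End CutGraph.

(** * Cuts of a rooted tree *)

Section ParentTree.
Variables (n : nat).
Local Notation V := 'I_n.+1.
Variables (par : V -> V) (rk : V -> nat).
Hypothesis par0 : par ord0 = ord0.
Hypothesis rk_par : forall y, y != ord0 -> rk (par y) < rk y.

Definition ancp (v x : V) := fconnect par x v.

Lemma ancp_refl : reflexive ancp.
Proof. by move=> x; exact: connect0. Qed.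

Lemma ancp_trans : transitive ancp.
Proof. by move=> y x z xy yz; exact: connect_trans yz xy. Qed.

Lemma iter_par0 i : iter i par ord0 = ord0.
Proof. by elim: i => //= i ->. Qed.

Lemma ancpP v x : reflect (exists i, v = iter i par x) (ancp v x).
Proof.
apply: (iffP idP) => [h|[i ->]]; last exact: fconnect_iter.
by exists (findex par x v); rewrite iter_findex.
Qed.

Lemma rk_anc v x : ancp v x -> v != x -> rk v < rk x.
Proof.
case/ancpP => i ->; elim: i x => [|i IH] x; first by rewrite eqxx.
rewrite iterSr; have [->|x0] := eqVneq x ord0; first by rewrite par0 iter_par0 eqxx.
move=> _; have := rk_par x0; have [->//|h] := eqVneq (iter i par (par x)) (par x).
by have := IH _ h; lia.
Qed.

Lemma ancp_anti : antisymmetric ancp.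
Proof.
move=> v x /andP[vx xv]; apply/eqP; apply: contraT => ne.
have h1 := rk_anc vx ne; rewrite eq_sym in ne; have := rk_anc xv ne; lia.
Qed.

Lemma ancp_tot v w x : ancp v x -> ancp w x -> ancp v w || ancp w v.
Proof.
case/ancpP => i ->; case/ancpP => j ->.
case: (leqP i j) => ij; apply/orP; [right|left]; apply/ancpP.
  by exists (j - i); rewrite -iterD subnK.
by exists (i - j); rewrite -iterD subnK // ltnW.
Qed.

Lemma ancp_root x : ancp ord0 x.
Proof.
have [m] := ubnP (rk x); elim: m x => // m IH x xm.
have [->|x0] := eqVneq x ord0; first exact: ancp_refl.
have /IH h : rk (par x) < m by have := rk_par x0; lia.
exact: connect_trans (fconnect1 par x) h.
Qed.

Lemma ancp_par v x : x != ord0 -> ancp v x = (v == x) || ancp v (par x).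
Proof.
move=> x0; apply/idP/orP => [/ancpP[[|i] ->]|[/eqP ->|h]].
- by left.
- by right; rewrite iterSr; exact: fconnect_iter.
- exact: ancp_refl.
- exact: connect_trans (fconnect1 par x) h.
Qed.

Lemma ancp_lt x : x != ord0 -> ~~ ancp x (par x).
Proof.
move=> x0; apply/negP => h; have lt := rk_par x0.
have [E|ne] := eqVneq x (par x); first by rewrite -E ltnn in lt.
by have := rk_anc h ne; lia.
Qed.

Variable F : {set V}.
Hypothesis F0 : ord0 \notin F.
Definition sig x := [set v in F | ancp v x].
Definition tops := ord0 |: F.

Lemma in_tops v : (v \in tops) = (v == ord0) || (v \in F).
Proof. by rewrite !inE. Qed.

Lemma tops_sig_inj v v' : v \in tops -> v' \in tops -> sig v = sig v' -> v = v'.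
Proof.
suff H u u' : u \in F -> u' \in tops -> sig u = sig u' -> ancp u u'.
  rewrite !in_tops => /orP[/eqP->|vF] /orP[/eqP->|vF'] // E.
  - have h := H v' ord0 vF' (_ : ord0 \in tops) (esym E); rewrite in_tops eqxx in h.
    by apply: ancp_anti; rewrite h ?ancp_root.
  - have h := H v ord0 vF (_ : ord0 \in tops) E; rewrite in_tops eqxx in h.
    by apply: ancp_anti; rewrite h ?ancp_root.
  - by apply: ancp_anti; rewrite !H ?in_tops ?vF ?vF' ?orbT.
move=> uF _ E; have : u \in sig u by rewrite inE uF ancp_refl.
by rewrite E inE => /andP[].
Qed.

(** The witness is the nearest vertex of [tops] above [x]. The clause on [P] moves along tree edges
    outside [F], and later identifies a given cut with the one induced by [F]. *)
Lemma top_ex x : exists2 v, v \in tops & sig v = sig x /\ ancp v x /\ 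
  forall P : {set {set V}}, (forall y, y != ord0 -> y \notin F -> pblock P y = pblock P (par y)) ->
    pblock P x = pblock P v.
Proof.
have [m] := ubnP (rk x); elim: m x => // m IH x xm.
have [xt|xt] := boolP (x \in tops); first by exists x => //; split=> //; split=> //; exact: ancp_refl.
have [x0 xF] : x != ord0 /\ x \notin F by move: xt; rewrite in_tops negb_or => /andP[].
have /IH[v vt [sv [av pv]]] : rk (par x) < m by have := rk_par x0; lia.
exists v => //; split; [|split].
- rewrite sv; apply/setP => w; rewrite !inE [in RHS]ancp_par //.
  by have [->|] := eqVneq w x; first by rewrite (negbTE xF).
- by rewrite ancp_par // av orbT.
- by move=> P h; rewrite h // pv.
Qed.

Lemma card_sig_partition : #|preim_partition sig [set: V]| = #|F|.+1.
Proof.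
have pp := preim_partitionP sig [set: V].
rewrite -(_ : #|tops| = #|F|.+1); last by rewrite /tops cardsU1 F0.
symmetry; apply: (@card_transversal _ tops _ [set: V]).
rewrite /is_transversal pp subsetT /=; apply/forall_inP => B BP.
have [x xB] : exists x, x \in B.
  apply/set0Pn; apply: contraTneq BP => ->; by case/and3P: pp.
have [v vt [sv [av _]]] := top_ex x.
have cls y : (y \in B) = (sig x == sig y).
  have ti : trivIset (preim_partition sig [set: V]) by case/and3P: pp.
  rewrite -(def_pblock ti BP xB) pblock_equivalence_partition ?inE //.
  by move=> a b d _ _ _ /=; split=> // /eqP ->.
rewrite (_ : tops :&: B = [set v]) ?cards1 //; apply/setP => y; rewrite in_setI in_set1 cls.
apply/andP/eqP => [[yt /eqP sy]|->]; last by split=> //; rewrite sv.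
by apply: tops_sig_inj; rewrite // sv.
Qed.

End ParentTree.

(** * Tight cuts as sets of tree edges *)

Section Cuts.
Variables (n : nat) (G : multigraph n.+1).
Local Notation V := 'I_n.+1.
Local Notation es e := (@ends _ G e).1.
Local Notation et e := (@ends _ G e).2.

Lemma crossing_pblock (A : {set edge G}) P e : partition P [set: V] ->
  (e \in crossing A P) = (e \in A) && (pblock P (es e) != pblock P (et e)).
Proof.
move=> pP; have /and3P[/eqP cP tP _] := pP; rewrite inE; congr (_ && _).
have inP x : pblock P x \in P by apply: pblock_mem; rewrite cP inE.
have inb x : x \in pblock P x by rewrite mem_pblock cP inE.
apply/exists_inP/idP => [[B BP /exists_inP[B' BP' /and3P[BB h1 h2]]]|ne].
  by rewrite (def_pblock tP BP h1) (def_pblock tP BP' h2).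
exists (pblock P (es e)) => //; apply/exists_inP; exists (pblock P (et e)) => //.
by rewrite ne !inb.
Qed.

Variables (par : V -> V) (rk : V -> nat) (T : {set edge G}).
Hypothesis par0 : par ord0 = ord0.
Hypothesis rk_par : forall y, y != ord0 -> rk (par y) < rk y.
Hypothesis par_T : forall y, y != ord0 -> adjacent T (par y) y.

Local Notation anc := (ancp par).
Local Notation DXG := (DX (fun e : edge G => es e) (fun e : edge G => et e) anc).

Lemma sig_kcut (F : {set V}) k : ord0 \notin F -> #|F| = k -> let P := preim_partition (sig par F) [set: V] in
  is_kcut k.+1 P /\ cut_size G P = #|DXG F|.
Proof.
move=> F0 Fk P; have pp := preim_partitionP (sig par F) [set: V]; split.
  by rewrite /is_kcut pp (card_sig_partition par0 rk_par F0) Fk eqxx.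
apply: eq_card => e; rewrite (crossing_pblock _ _ pp) inE /=.
have cls x y : (y \in pblock P x) = (sig par F x == sig par F y).
  rewrite pblock_equivalence_partition ?inE //.
  by move=> a b d _ _ _ /=; split=> // /eqP ->.
have eqb x y : (pblock P x == pblock P y) = (sig par F x == sig par F y).
  apply/eqP/eqP => [E|E]; first by apply/eqP; rewrite -cls E cls.
  by apply/setP => z; rewrite !cls E.
rewrite eqb; apply/idP/bigcupP => [ne|[f fF]].
  have [f] : exists f, (f \in sig par F (es e)) != (f \in sig par F (et e)).
    by apply/existsP; apply: contraNT ne; rewrite negb_exists => /forallP h; apply/eqP/setP => f; move: (h f); rewrite negbK => /eqP.
  rewrite !inE; case fF: (f \in F) => //= h; exists f => //.
  by rewrite inE.
rewrite inE /sep; apply: contraNN => /eqP/setP/(_ f); rewrite !inE fF /= => ->.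
by [].
Qed.

(** Let [F] be the tree edges crossing [P], at most k of them. The vertices of [tops F] represent
    all k + 1 blocks, so [F] has exactly k elements and the representatives lie in distinct blocks.
    Thus [P] is the cut induced by [F]. *)
Lemma tight_cut k P : is_kcut k.+1 P -> #|crossing T P| <= k ->
  exists F : {set V}, [/\ ord0 \notin F, #|F| = k & #|DXG F| = cut_size G P].
Proof.
move=> /andP[pP /eqP Pk] Tk; have /and3P[/eqP cP tP nP] := pP.
pose F := [set y | (y != ord0) && (pblock P y != pblock P (par y))].
have F0 : ord0 \notin F by rewrite inE eqxx.
have [ey eyP] : exists ey : V -> option (edge G), forall y, y \in F ->
    exists2 e, ey y = Some e & (e \in crossing T P) && joins e (par y) y.
  exists (fun y => [pick e | (e \in crossing T P) && joins e (par y) y]) => y.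
  rewrite inE => /andP[y0 yp]; case: pickP => [e h|no]; first by exists e.
  have /exists_inP[e eT je] := par_T y0.
  have := no e; rewrite je (crossing_pblock _ _ pP) eT /=.
  case/orP: je => /eqP -> /=; last by rewrite yp.
  by rewrite eq_sym yp.
have Fk : #|F| <= k.
  apply: leq_trans Tk.
  (* If [y] and [y'] had the same tree edge without being equal, each would be the parent of the
     other, against the ranks. *)
  have inj : {in F &, injective ey}.
    move=> y y' yF yF' Ee; have [e Ey /andP[_ j1]] := eyP y yF; have [e' Ey' /andP[_ j2]] := eyP y' yF'.
    have Eee : e = e' by move: Ee; rewrite Ey Ey' => -[].
    rewrite -{}Eee in j2.
    have [y0 y0'] : y != ord0 /\ y' != ord0 by move: yF yF'; rewrite !inE => /andP[-> _] /andP[-> _].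
    have r1 := rk_par y0; have r2 := rk_par y0'.
    move: j2; rewrite /joins; case/orP: j1 => /eqP ->; rewrite !xpair_eqE => /orP[]/andP[/eqP h1 /eqP h2] //;
      have := congr1 rk h1; have := congr1 rk h2; lia.
  rewrite -(card_in_imset inj) -(card_imset (mem (crossing T P)) (@Some_inj _)).
  apply: subset_leq_card; apply/subsetP => o /imsetP[y yF ->].
  have [e -> /andP[ec _]] := eyP y yF; exact: imset_f.
have parP y : y != ord0 -> y \notin F -> pblock P y = pblock P (par y).
  by move=> y0; rewrite inE y0 /= negbK => /eqP.
have cov : P \subset pblock P @: tops F.
  apply/subsetP => B BP; have [x xB] : exists x, x \in B.
    by apply/set0Pn; apply: contraTneq BP => ->.
  have [v vt [_ [_ h]]] := top_ex rk_par F0 x.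
  by apply/imsetP; exists v => //; rewrite -(h P parP) (def_pblock tP BP xB).
have cT : #|tops F| = #|F|.+1 by rewrite cardsU1 F0.
have c1 := subset_leq_card cov; have c2 := leq_imset_card (pblock P) (tops F).
have EF : #|F| = k.
  by apply/eqP; rewrite eqn_leq Fk; have := leq_trans c1 c2; rewrite cT Pk ltnS.
have inj : {in tops F &, injective (pblock P)}.
  by apply/imset_injP; rewrite eqn_leq c2 cT EF -Pk c1.
have [_ cs] := sig_kcut F0 EF.
exists F; split=> //; rewrite -cs; apply: eq_card => e.
have pp := preim_partitionP (sig par F) [set: V].
rewrite !(crossing_pblock _ _ pP) !(crossing_pblock _ _ pp) !inE /=; congr (~~ _).
set Q := preim_partition _ _.
have cls x y : (y \in pblock Q x) = (sig par F x == sig par F y).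
  rewrite pblock_equivalence_partition ?inE //.
  by move=> a b d _ _ _ /=; split=> // /eqP ->.
have eqb x y : (pblock Q x == pblock Q y) = (sig par F x == sig par F y).
  apply/eqP/eqP => [E|E]; first by apply/eqP; rewrite -cls E cls.
  by apply/setP => z; rewrite !cls E.
rewrite eqb; have [v1 v1t [s1 [_ h1]]] := top_ex rk_par F0 (es e).
have [v2 v2t [s2 [_ h2]]] := top_ex rk_par F0 (et e).
rewrite (h1 P parP) (h2 P parP) -s1 -s2; apply/eqP/eqP => [|h].
  by move/(tops_sig_inj par0 rk_par v1t v2t) ->.
by rewrite (inj _ _ v1t v2t h).
Qed.

End Cuts.

(** * The algorithm *)

Definition xnot e := XSub (XLit 1) e.
Definition xand a b := XIte a b (XLit 0).
Definition xor a b := XIte a (XLit 1) b.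
Definition xeq a b := XSub (XLit 1) (XAdd (XSub a b) (XSub b a)).
Definition xlt a b := XSub b a.
Definition xbool e := XIte e (XLit 1) (XLit 0).
Definition xex x l e := XSum x l (xbool e).

Definition rN := 0. Definition rK := 1. Definition rL := 2. Definition rJ := 3.
Definition rInf := 4. Definition rSq := 5. Definition rTL := 6. Definition rL1 := 7.
Definition rL2 := 8. Definition rC1 := 9. Definition rC2 := 10. Definition rC3 := 11.
Definition rJJ := 12.

Definition aIN := 1. Definition aROW := 0. Definition aPAR := 2. Definition aVIS := 3.
Definition aANC := 4. Definition aDEG := 5. Definition aD1 := 6. Definition aD2 := 7.
Definition aD3 := 8. Definition aX := 9. Definition aW := 10. Definition aCH := 11.
Definition aR := 12. Definition aN := 13. Definition aAV := 14. Definition aLAB := 15.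
Definition aSEL := 16. Definition aBSEL := 17. Definition aOUT := 18. Definition aFP := 19.
Definition aFV := 20.

Definition xidx i j := XAdd (XArr aROW i) j.
Definition xanc a b := XArr aANC (xidx a b).
Definition xA a b := XArr aIN (xidx a b).
Definition xT a b := XArr aIN (XAdd (XVar rSq) (xidx a b)).
Definition xok v := xand v (xnot (XSub (XArr aDEG v) (XVar rL))).
Definition xcand v x x' := xand (xok v) (xand (xanc v x) (xnot (xanc v x'))).
(** There is no search instruction: a unique index is obtained as the sum of all indices that
    satisfy its defining condition. *)
Definition xtop x x' := XSum 80 rN (XIte (xand (xcand (XVar 80) x x')
   (xnot (xex 81 rN (xand (xcand (XVar 81) x x')
            (xand (xanc (XVar 81) (XVar 80)) (xnot (xeq (XVar 81) (XVar 80))))))))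
  (XVar 80) (XLit 0)).
Definition xvis w y := xex 82 rN (xand (xA y (XVar 82)) (xnot (xeq (xanc w y) (xanc w (XVar 82))))).
Definition xnth (f : ex -> ex) q := XSum 83 rN (XIte (xand (f (XVar 83))
    (xeq (xex 84 rN (xand (xlt (XVar 84) (XVar 83)) (f (XVar 84)))) q))
  (XVar 83) (XLit 0)).

Fixpoint CSeqs (l : seq cmd) : cmd :=
  match l with
  | [::] => CNop
  | [:: c] => c
  | c :: l' => CSeq c (CSeqs l')
  end.
Definition CWhen e c := CIf e c CNop.

(** As many sweeps over all pairs as there are vertices. Every vertex starts as its own predecessor,
    and the sources remain so. *)
Definition cSearch pa va edge src := CSeq
  (CFor 14 rN (CSeq (CSto va (XVar 14) (xbool src)) (CSto pa (XVar 14) (XVar 14))))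
  (CFor 15 rN (CFor 13 rN (CFor 14 rN
    (CWhen (xand (XArr va (XVar 13)) (xand (xnot (XArr va (XVar 14))) edge))
      (CSeq (CSto va (XVar 14) (XLit 1)) (CSto pa (XVar 14) (XVar 13))))))).

Definition cTree := cSearch aPAR aVIS (xT (XVar 13) (XVar 14)) (xnot (XVar 14)).

Definition cAnc := CFor 16 rN (CSeqs [::
  CFor 17 rN (CSto aANC (xidx (XVar 17) (XVar 16)) (XLit 0));
  CSet 18 (XVar 16);
  CFor 17 rN (CSeq (CSto aANC (xidx (XVar 18) (XVar 16)) (XLit 1))
                   (CSet 18 (XArr aPAR (XVar 18))))]).

Definition cDeg := CFor 16 rN (CSto aDEG (XVar 16)
  (XSum 80 rN (XSum 81 rN (XIte (xand (xanc (XVar 16) (XVar 80)) (xnot (xanc (XVar 16) (XVar 81))))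
     (xA (XVar 80) (XVar 81)) (XLit 0))))).

Definition cZero d l := CFor 19 l (CSto d (XVar 19) (XLit 0)).
(** Adds one to the number with digits [d], least significant digit first; register 20 is the
    carry. *)
Definition cInc d l b := CSeq (CSet 20 (XLit 1)) (CFor 19 l (CWhen (XVar 20)
  (CIf (XSub (XVar b) (XAdd (XArr d (XVar 19)) (XLit 1)))
     (CSeq (CSto d (XVar 19) (XAdd (XArr d (XVar 19)) (XLit 1))) (CSet 20 (XLit 0)))
     (CSto d (XVar 19) (XLit 0))))).
(** Multiplication by the base is repeated addition, so the time depends on base and exponent and
    not on the value. *)
Definition cPow r b l := CSeq (CSet r (XLit 1)) (CFor 19 l (CSeqs [::
  CSet 22 (XLit 0); CFor 21 b (CSet 22 (XAdd (XVar 22) (XVar r))); CSet r (XVar 22)])).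

Definition rS := 23. Definition rU := 24. Definition rC := 25. Definition rBest := 26.

Definition vJ := XVar rJ.
Definition xused i := XArr aD2 i.
Definition xda i := XArr aD2 (XAdd vJ i).
Definition xdb i := XArr aD2 (XAdd vJ (XAdd vJ i)).
Definition xdp i := XArr aD2 (XAdd vJ (XAdd vJ (XAdd vJ i))).
Definition xdbel i := XArr aD2 (XAdd vJ (XAdd vJ (XAdd vJ (XAdd vJ i)))).
Definition xdbes i := XArr aD2 (XAdd vJ (XAdd vJ (XAdd vJ (XAdd vJ (XAdd vJ i))))).
Definition xX i := XArr aX i.
Definition xW i := XArr aW i.
Definition xsucc i := XAdd i (XLit 1).
Definition xpred i := XSub i (XLit 1).
(** [aROW] tabulates the multiples of the number of vertices, so that a three-dimensional index
    needs no multiplication. *)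
Definition xN s u c := XArr aN (XAdd (XArr aROW (XAdd (XArr aROW s) u)) c).
Definition rJ1 := 28.

Definition cLeaves := CSeqs [::
  CFor 27 rJ1 (CSto aX (XVar 27) (XVar rC));
  CFor 27 rJ (CSeqs [::
    CSet 30 (xX (xda (XVar 27))); CSet 31 (xX (xdb (XVar 27)));
    CSet 32 (XIte (xda (XVar 27)) (xtop (XVar 30) (XVar 31)) (XVar rC));
    CSto aX (xsucc (XVar 27)) (xnth (xvis (XVar 32)) (XArr aD3 (XVar 27)))]);
  CFor 27 rJ (CSeqs [::
    CSet 30 (xX (xsucc (XVar 27))); CSet 31 (xX (xdp (XVar 27)));
    CSto aW (XVar 27) (xtop (XVar 30) (XVar 31))])].

Definition xslot_ok i := xand (xW i) (xand (xanc (xW i) (xX (xsucc i)))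
  (xand (xanc (XVar rU) (xW i)) (xand (xnot (xanc (xW i) (XVar rC)))
  (xor (xeq (XVar rU) (XVar rC)) (xnot (xanc (XVar rC) (xW i))))))).
Definition xvalid := xand
  (xnot (xex 80 rJ (xand (xused (XVar 80)) (xnot (xslot_ok (XVar 80)))))) (xand
  (xnot (xex 80 rJ (xex 81 rJ (xand (xused (XVar 80)) (xand (xused (XVar 81))
     (xand (xnot (xeq (XVar 80) (XVar 81))) (xanc (xW (XVar 80)) (xW (XVar 81)))))))))
  (xeq (XSum 80 rJ (XIte (xused (XVar 80))
          (XAdd (XAdd (XLit 1) (xdbel (XVar 80))) (xdbes (XVar 80))) (XLit 0))) (XVar rS))).

Definition xCH a := XArr aCH a.
(** For [a] at the top of its chain, the cell for cuts beside [a] would be that of the problem below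
    [a]; the value is infinite there unless no such cuts are left to place. *)
Definition xpsi i a := XIte (XArr aAV a)
  (XIte (xand (xeq a (xW i)) (xdbes i)) (XVar rInf)
     (XAdd (xN (xdbel i) a a) (xN (xdbes i) (xW i) a))) (XVar rInf).
Definition xsame a b := xeq (xanc (XVar rC) a) (xanc (XVar rC) b).
Definition xcap a b := XIte (xCH a)
  (XAdd (XAdd (XAdd
    (XIte (xeq b (XArr aPAR a))
       (XIte (xanc a (xX (xCH a))) (xpsi (xpred (xCH a)) a) (XVar rInf)) (XLit 0))
    (XIte (xand (xeq a (XArr aPAR b)) (xCH b)) (XVar rInf) (XLit 0)))
    (XIte (xand (xsame a b) (xor (xnot (xCH b)) (xor (xeq (xCH b) (xCH a)) (xlt b a)))) (xA a b) (XLit 0)))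
    (XIte (xnot b) (XSum 80 rN (XIte (xand (xsame a (XVar 80)) (xand (xCH (XVar 80))
        (xand (xnot (xeq (xCH (XVar 80)) (xCH a))) (xlt a (XVar 80))))) (xA a (XVar 80)) (XLit 0)))
      (XLit 0)))
  (XLit 0).

Definition cCap := CSeq
  (CFor 33 rN (CSto aCH (XVar 33) (XSum 80 rJ (XIte (xand (xused (XVar 80)) (xanc (xW (XVar 80)) (XVar 33)))
      (xsucc (XVar 80)) (XLit 0)))))
  (CFor 33 rN (CFor 34 rN (CSto aR (xidx (XVar 33) (XVar 34)) (xcap (XVar 33) (XVar 34))))).

Definition xsink y := xand (XArr aFV y) (xnot (xCH y)).
(** Sources are the vertices below the leaves, which lie in every admissible cut; sinks are the
    vertices outside all chain regions. Register 35 counts the successful augmentations. *)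
Definition cAugment := CSeqs [::
  cSearch aFP aFV (XArr aR (xidx (XVar 13) (XVar 14)))
    (xand (xCH (XVar 14)) (xanc (xX (xCH (XVar 14))) (XVar 14)));
  CSet 37 (xnth xsink (XLit 0));
  CWhen (xsink (XVar 37)) (CSeq (CSet 35 (xsucc (XVar 35)))
    (CFor 39 rN (CSeq (CSet 40 (XArr aFP (XVar 37)))
       (CWhen (xnot (xeq (XVar 40) (XVar 37))) (CSeqs [::
          CSto aR (xidx (XVar 40) (XVar 37)) (xpred (XArr aR (xidx (XVar 40) (XVar 37))));
          CSto aR (xidx (XVar 37) (XVar 40)) (xsucc (XArr aR (xidx (XVar 37) (XVar 40))));
          CSet 37 (XVar 40)])))))].
Definition cFlow := CSeq (CSet 35 (XLit 0)) (CFor 36 rInf cAugment).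
Definition cMin r v := CWhen (xlt (XVar v) (XVar r)) (CSet r (XVar v)).

Definition cTry := CSeq cLeaves (CWhen xvalid (CSeqs [:: cCap; cFlow; cMin rBest 35])).

Definition cGuess := CSeq (cZero aD2 rL2) (CFor 41 rC2 (CSeqs [::
   cZero aD3 rJ; CFor 42 rC3 (CSeq cTry (cInc aD3 rJ rTL)); cInc aD2 rL2 rK])).

(** Sizes up to J - 1 suffice, because a component of at most J cuts spends one on its entry [c]. *)
Definition cTable := CFor rS rJ (CFor rU rN (CFor rC rN (CSeqs [::
  CSet rBest (XIte (XVar rS) (XVar rInf) (XLit 0));
  CWhen (xand (XVar rS) (xanc (XVar rU) (XVar rC))) cGuess;
  CSto aN (XAdd (XArr aROW (XAdd (XArr aROW (XVar rS)) (XVar rU))) (XVar rC)) (XVar rBest)]))).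

Definition rSz := 43. Definition rVal := 44.
Definition cBest := CSeqs [:: cTable;
  CSet rVal (XIte (XVar rSz) (XVar rInf) (XLit 0));
  CFor 45 rN (CFor 46 rJ (CWhen (xand (XArr aAV (XVar 45)) (xlt (XVar 46) (XVar rSz))) (CSeq
    (CSet 47 (XAdd (XArr aDEG (XVar 45)) (XAdd (xN (XVar 46) (XVar 45) (XVar 45))
        (xN (XSub (xpred (XVar rSz)) (XVar 46)) (XLit 0) (XVar 45)))))
    (cMin rVal 47))))].

(** Register 48 keeps the value of the full set; every trial deletion recomputes the table for the
    reduced set. *)
Definition cElim := CSeqs [:: cBest; CSet 48 (XVar rVal);
  CFor 49 rN (CWhen (XArr aAV (XVar 49)) (CSeqs [::
    CSto aAV (XVar 49) (XLit 0); cBest;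
    CWhen (xlt (XVar 48) (XVar rVal)) (CSto aAV (XVar 49) (XLit 1))]))].

Definition rCi := 50. Definition rTot := 51. Definition rBtot := 55.
Definition xdsz c := XArr aD1 (XAdd (XAdd (XAdd vJ vJ) (XAdd vJ vJ)) c).

Definition cStep := CWhen (XSub (xsucc vJ) (XVar rCi)) (CSeqs [::
  CSet rSz (xdsz (xpred (XVar rCi)));
  CFor 33 rN (CSto aAV (XVar 33) (xbool (xand (xok (XVar 33)) (xand (xnot (XArr aSEL (XVar 33)))
     (xor (xnot (XArr aLAB (XVar 33))) (xeq (XArr aLAB (XVar 33)) (XVar rCi)))))));
  cElim;
  CSet 53 (XArr aD1 (XVar 52));
  CIf (XVar 53)
    (CSeq (CSet 54 (xnth (fun y => XArr aAV y) (XArr aD1 (XAdd (XAdd vJ vJ) (XVar 52)))))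
          (CSto aLAB (XVar 54) (XVar 53)))
    (CSeqs [:: CFor 33 rN (CWhen (XArr aAV (XVar 33)) (CSto aSEL (XVar 33) (XLit 1)));
       CSet rTot (XAdd (XVar rTot) (XVar 48)); CSet rCi (xsucc (XVar rCi))])]).

Definition cPack := CSeqs [::
  CFor 33 rN (CSeq (CSto aSEL (XVar 33) (XLit 0)) (CSto aLAB (XVar 33) (XLit 0)));
  CSet rCi (XLit 1); CSet rTot (XLit 0);
  CFor 52 rJJ cStep;
  CWhen (xand (xeq (XVar rCi) (xsucc vJ)) (xand (xeq (XSum 80 rJ (xdsz (XVar 80))) vJ)
           (xlt (XVar rTot) (XVar rBtot))))
    (CSeq (CSet rBtot (XVar rTot)) (CFor 33 rN (CSto aBSEL (XVar 33) (XArr aSEL (XVar 33)))))].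

Definition cOuter := CSeqs [:: CSet rBtot (XVar rInf); CFor 33 rN (CSto aBSEL (XVar 33) (XLit 0));
  cZero aD1 rL1; CFor 56 rC1 (CSeq cPack (cInc aD1 rL1 rK))].

Definition xsigeq x y := xnot (xex 82 rN (xand (XArr aBSEL (XVar 82))
  (xnot (xeq (xanc (XVar 82) x) (xanc (XVar 82) y))))).
Definition cLabel := CFor 33 rN (CSto aOUT (XVar 33) (xnth (fun y => xsigeq y (XVar 33)) (XLit 0))).

Definition cMain := CSeqs [:: cTree; cAnc; cDeg; cOuter; cLabel].

(** [rL1] and [rL2] are the numbers of base k digits of an outer guess and of the array [aD2] of an
    inner one. *)
Definition cConst := CSeqs [::
  CSet rJ (XSub (XVar rK) (XLit 1)); CSet rInf (XAdd (XVar rL) (XLit 1));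
  CSet rJ1 (xsucc vJ); CSet rJJ (XAdd vJ vJ); CSet rTL (XAdd (XVar rL) (XVar rL));
  CSet rL1 (XAdd (XVar rJJ) (XAdd (XVar rJJ) vJ)); CSet rL2 (XAdd (XVar rL1) vJ)].
Definition cPows := CSeqs [:: cPow rC1 rK rL1; cPow rC2 rK rL2; cPow rC3 rTL rJ].
Definition cSquare := CSeqs [:: CSet rSq (XLit 0);
  CFor 13 rN (CSet rSq (XAdd (XVar rSq) (XVar rN))); CSet 14 (XAdd (XVar rSq) (XVar rSq))].
Definition cRow := CSeqs [:: CSet 14 (XLit 0);
  CFor 13 rSq (CSeq (CSto aROW (XVar 13) (XVar 14)) (CSet 14 (XAdd (XVar 14) (XVar rN))))].

Lemma okC_main : okC cMain. Proof. by vm_compute. Qed.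
Lemma okC_const : okC cConst. Proof. by vm_compute. Qed.
Lemma okC_pows : okC cPows. Proof. by vm_compute. Qed.
Lemma okC_square : okC cSquare. Proof. by vm_compute. Qed.
Lemma okC_row : okC cRow. Proof. by vm_compute. Qed.

(** * Correctness of the algorithm *)

Definition fr (rs sa : seq nat) (s s' : st) :=
  (forall r, r \notin rs -> rg s' r = rg s r) /\
  (forall a i, a \notin sa -> ar s' a i = ar s a i).

Lemma fr_refl rs sa s : fr rs sa s s. Proof. by []. Qed.
Lemma fr_run c s : fr (wrC c) (waC c) s (run c s).
Proof. by split=> [r|a i]; [exact: run_rg|exact: run_ar]. Qed.
Lemma fr_trans rs sa s1 s2 s3 : fr rs sa s1 s2 -> fr rs sa s2 s3 -> fr rs sa s1 s3.
Proof. by move=> [a b] [a' b']; split=> [r h|x i h]; rewrite ?a' ?b' ?a ?b. Qed.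
Lemma fr_sub rs sa rs' sa' s s' : fr rs sa s s' -> {subset rs <= rs'} -> {subset sa <= sa'} -> fr rs' sa' s s'.
Proof.
move=> [a b] h1 h2; split=> [r h|x i h]; [apply: a|apply: b].
  by apply: contra h; exact: h1.
by apply: contra h; exact: h2.
Qed.

Lemma fr_of c s rs sa : all (fun r => r \in rs) (wrC c) -> all (fun a => a \in sa) (waC c) ->
  fr rs sa s (run c s).
Proof. by move=> /allP h1 /allP h2; apply: fr_sub (fr_run c s) h1 h2. Qed.

(** Each step is given the frame relative to the start of the loop, so an invariant need only speak
    of what the body changes. *)
Lemma run_for (I : nat -> st -> Prop) x l b s L : rg s l = L ->
  I 0 (setr s x 0) ->
  (forall i s', i < L -> fr (x :: wrC b) (waC b) s s' -> rg s' x = i -> I i s' ->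
     I i.+1 (setr (run b s') x i.+1)) ->
  I L (run (CFor x l b) s).
Proof.
move=> <- I0 Is /=.
suff H m : m <= rg s l -> let s' := iteri m (fun i s' => setr (run b s') x i.+1) (setr s x 0) in
    [/\ I m s', fr (x :: wrC b) (waC b) s s' & rg s' x = m].
  by have [] := H _ (leqnn _).
elim: m => [|m IH] ml.
  split=> //=; last by rewrite /upd eqxx.
  by split=> //= r; rewrite inE /upd => /norP[/negbTE ->].
have [h1 h2 h3] := IH (ltnW ml); split; last by rewrite /= /upd eqxx.
  exact: Is.
have [a1 a2] := fr_run b (iteri m (fun i s' => setr (run b s') x i.+1) (setr s x 0)).
have [b1 b2] := h2; split=> [r h|a i h] /=.
  have h' := h; move: h'; rewrite inE => /norP[/negbTE e1 e2].
  by rewrite /upd e1 a1 // b1.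
by rewrite a2 // b2.
Qed.

Lemma run_seq c1 c2 s : run (CSeq c1 c2) s = run c2 (run c1 s).
Proof. by []. Qed.

Lemma run_seqs c c' l s : run (CSeqs [:: c, c' & l]) s = run (CSeqs (c' :: l)) (run c s).
Proof. by []. Qed.

Lemma run_seqs1 c s : run (CSeqs [:: c]) s = run c s.
Proof. by []. Qed.

Lemma run_when e c s : run (CWhen e c) s = if evs s e != 0 then run c s else s.
Proof. by []. Qed.

Section Eval.
Variables (g : nat -> nat) (a : nat -> nat -> nat).

Lemma ev_xnot e : (ev g a (xnot e) != 0) = ~~ (ev g a e != 0).
Proof. by rewrite /=; case: (ev g a e) => //= m; rewrite subn_eq0. Qed.
Lemma ev_xand e f : (ev g a (xand e f) != 0) = (ev g a e != 0) && (ev g a f != 0).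
Proof. by rewrite /=; case: ifP. Qed.
Lemma ev_xor e f : (ev g a (xor e f) != 0) = (ev g a e != 0) || (ev g a f != 0).
Proof. by rewrite /=; case: ifP. Qed.
Lemma ev_xeq e f : (ev g a (xeq e f) != 0) = (ev g a e == ev g a f).
Proof. rewrite /=; apply/idP/eqP; lia. Qed.
Lemma ev_xlt e f : (ev g a (xlt e f) != 0) = (ev g a e < ev g a f).
Proof. by rewrite /= subn_eq0 ltnNge. Qed.
Lemma ev_xbool e : ev g a (xbool e) = (ev g a e != 0).
Proof. by rewrite /=; case: ifP. Qed.
End Eval.

Section EvalSum.
Variables (g : nat -> nat) (a : nat -> nat -> nat).

Lemma ev_xexP x l e : (ev g a (xex x l e) != 0) = [exists i : 'I_(g l), ev (upd g x i) a e != 0].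
Proof.
rewrite -[ev _ _ _]/(\sum_(i < g l) ev (upd g x i) a (xbool e)) sum_nat_eq0 negb_forall.
apply: eq_existsb => i; rewrite /=; case: ifP => //.
Qed.
Lemma ev_xex x l N e (P : pred 'I_N) : g l = N ->
  (forall i : 'I_N, (ev (upd g x i) a e != 0) = P i) -> (ev g a (xex x l e) != 0) = [exists i, P i].
Proof. by move=> E; rewrite ev_xexP; case: _ / E P => P h; apply: eq_existsb. Qed.
Lemma ev_xexn x l N e (P : pred 'I_N) : g l = N ->
  (forall i : 'I_N, (ev (upd g x i) a e != 0) = P i) -> ev g a (xex x l e) = #|P|.
Proof.
move=> E h; rewrite -[LHS]/(\sum_(i < g l) ev (upd g x i) a (xbool e)) E -sum1_card [RHS]big_mkcond.
by apply: eq_bigr => i _; rewrite ev_xbool h unfold_in; case: (P i).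
Qed.
Lemma ev_xsum x l N e (f : 'I_N -> nat) : g l = N ->
  (forall i : 'I_N, ev (upd g x i) a e = f i) -> ev g a (XSum x l e) = \sum_i f i.
Proof. by move=> E h; rewrite -[LHS]/(\sum_(i < g l) ev (upd g x i) a e) E; apply: eq_bigr. Qed.
Lemma ev_ite e f h : ev g a (XIte e f h) = if ev g a e != 0 then ev g a f else ev g a h.
Proof. by []. Qed.

End EvalSum.

(** The default vertex 0 agrees with an empty sum, so [sum_the] holds even if no vertex satisfies
    [P]. *)
Definition the n (P : pred 'I_n.+1) : 'I_n.+1 := odflt ord0 [pick v | P v].

Lemma sum_the n (P : pred 'I_n.+1) : (forall v w, P v -> P w -> v = w) ->
  \sum_(v < n.+1) (if P v then v : nat else 0) = the P.
Proof.
move=> u; rewrite /the; case: pickP => [v Pv|no] /=; last by rewrite big1 // => v _; rewrite no.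
rewrite (bigD1 v) //= Pv big1 ?addn0 // => w; case: ifP => // Pw /eqP wv.
by case: wv; exact: u.
Qed.

Lemma theP n (P : pred 'I_n.+1) v : P v -> P (the P).
Proof. by rewrite /the; case: pickP => // /(_ v) ->. Qed.

Definition isnth n (P : pred 'I_n.+1) q (v : 'I_n.+1) := P v && (#|[pred u : 'I_n.+1 | (u < v) && P u]| == q).
Definition nthset n (P : pred 'I_n.+1) q := the (isnth P q).

Lemma nthset_uniq n (P : pred 'I_n.+1) q v w :
  isnth P q v -> isnth P q w -> v = w.
Proof.
rewrite /isnth.
suff H (x y : 'I_n.+1) : P x -> x < y ->
    #|[pred u : 'I_n.+1 | (u < x) && P u]| < #|[pred u : 'I_n.+1 | (u < y) && P u]|.
  move=> /andP[Pv /eqP cv] /andP[Pw /eqP cw]; apply: val_inj => /=.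
  case: (ltngtP v w) => // lt; [have := H _ _ Pv lt|have := H _ _ Pw lt]; rewrite cv cw ltnn //.
move=> Px xy; apply: proper_card; apply/properP; split.
  by apply/subsetP => u; rewrite !inE => /andP[ux ->]; rewrite (ltn_trans ux xy).
by exists x; rewrite !inE ?ltnn ?xy.
Qed.

Lemma nthset_ex n (P : pred 'I_n.+1) v : P v -> exists2 q, q < #|P| & nthset P q = v.
Proof.
move=> Pv; exists #|[pred u : 'I_n.+1 | (u < v) && P u]|.
  apply: proper_card; apply/properP; split; first by apply/subsetP => u; rewrite !inE => /andP[].
  by exists v; rewrite ?inE ?ltnn.
have h : isnth P #|[pred u : 'I_n.+1 | (u < v) && P u]| v by rewrite /isnth Pv eqxx.
exact: nthset_uniq (theP h) h.
Qed.

Lemma nthset0 n (P : pred 'I_n.+1) v : P v -> P (nthset P 0).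
Proof.
move=> Pv; case: (arg_minnP (fun u : 'I_n.+1 => u : nat) Pv) => u Pu um.
have h : isnth P 0 u.
  rewrite /isnth Pu /=; apply/eqP/eq_card0 => z; rewrite !inE; apply/negP => /andP[zu Pz].
  by have := um _ Pz; rewrite leqNgt zu.
by have /andP[] := theP h.
Qed.

Lemma ev_xnth n g a (f : ex -> ex) q (P : pred 'I_n.+1) : g rN = n.+1 ->
  (forall i : 'I_n.+1, (ev (upd g 83 i) a (f (XVar 83)) != 0) = P i) ->
  (forall i j : 'I_n.+1, (ev (upd (upd g 83 i) 84 j) a (f (XVar 84)) != 0) = P j) ->
  (forall i, ev (upd g 83 i) a q = ev g a q) ->
  ev g a (xnth f q) = nthset P (ev g a q).
Proof.
move=> gN h1 h2 h3.
rewrite (ev_xsum (N := n.+1) (f := fun v : 'I_n.+1 => if isnth P (ev g a q) v then v : nat else 0)) //.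
  by rewrite sum_the // => v w; exact: nthset_uniq.
move=> i; rewrite ev_ite ev_xand h1 ev_xeq h3.
rewrite (ev_xexn (N := n.+1) (P := [pred u : 'I_n.+1 | (u < i) && P u])) //.
by move=> j; rewrite ev_xand h2 ev_xlt.
Qed.

Lemma fill1 s x l a e N (f : nat -> nat) : rg s l = N -> x != l ->
  (forall s' i, i < N -> fr [:: x] [:: a] s s' -> rg s' x = i -> evs s' e = f i) ->
  forall i, i < N -> ar (run (CFor x l (CSto a (XVar x) e)) s) a i = f i.
Proof.
move=> lN xl h.
apply: (@run_for (fun m s' => forall i, i < m -> ar s' a i = f i) _ _ _ _ _ lN) => // i s' iN [h1 h2] sx IH j.
rewrite /= /evs /= sx ltnS leq_eqVlt => /orP[/eqP->|ji].
  by rewrite !eqxx /=; apply: h => //; split.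
by rewrite eqxx /=; case: eqP => [Ej|_]; [lia|exact: IH].
Qed.

(** * Digits and odometers *)

Definition digit b m i := (m %/ b ^ i) %% b.

(** The carry reaches position i exactly when all lower digits are maximal, that is when [b ^ i]
    divides [m.+1]. *)
Lemma digit_succ b m i : 0 < b -> digit b m.+1 i =
  if b ^ i %| m.+1 then (if (digit b m i).+1 < b then (digit b m i).+1 else 0) else digit b m i.
Proof.
move=> b0; rewrite /digit divnS ?expn_gt0 ?b0 //; case: ifP => //= _.
rewrite add1n modnS; case: ifP => h; have hb := ltn_pmod (m %/ b ^ i) b0.
  case: ifP => // h2; move: h; rewrite (divn_eq (m %/ b ^ i) b) -addnS dvdn_addr ?dvdn_mull //.
  by move/dvdn_leq => /(_ isT); lia.
case: ifP => // /negbT; rewrite -leqNgt => h2.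
have E : ((m %/ b ^ i) %% b).+1 = b by lia.
by move: h; rewrite {1}(divn_eq (m %/ b ^ i) b) -addnS E dvdn_addr ?dvdn_mull // dvdnn.
Qed.

Lemma dvdn_exp_succ b m i : 0 < b -> (b ^ i.+1 %| m.+1) = (b ^ i %| m.+1) && (b <= (digit b m i).+1).
Proof.
move=> b0; case: (boolP (b ^ i %| m.+1)) => [h|h]; last first.
  by apply/negbTE; apply: contra h; apply: dvdn_trans; rewrite dvdn_exp2l.
have E : m.+1 = (m %/ b ^ i).+1 * b ^ i by rewrite -{1}(divnK h) divnS ?expn_gt0 ?b0 // h.
rewrite {1}E expnS dvdn_pmul2r ?expn_gt0 ?b0 //= /digit.
rewrite {1}(divn_eq (m %/ b ^ i) b) -addnS dvdn_addr ?dvdn_mull //.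
have hb := ltn_pmod (m %/ b ^ i) b0; apply/idP/idP => [/dvdn_leq ->//|h2].
by have -> : ((m %/ b ^ i) %% b).+1 = b by lia.
Qed.

Lemma digit_all b L (d : nat -> nat) : (forall i, i < L -> d i < b) ->
  exists2 m, m < b ^ L & forall i, i < L -> digit b m i = d i.
Proof.
elim: L d => [|L IH] d h; first by exists 0.
have b0 : 0 < b by have := h 0 isT; lia.
have [i iL|m mb hm] := IH (fun i => d i.+1); first exact: h.
exists (m * b + d 0).
  have := h 0 isT; have : m.+1 * b <= b ^ L.+1 by rewrite expnSr leq_mul2r mb orbT.
  by rewrite mulSn; lia.
move=> [|i] iL; first by rewrite /digit expn0 divn1 modnMDl modn_small ?h.
have d0 := h 0 isT; by rewrite -hm // /digit expnS divnMA divnMDl // (divn_small d0) addn0.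
Qed.

Lemma zero_ok s d l L : rg s l = L -> l != 19 -> forall i, i < L -> ar (run (cZero d l) s) d i = 0.
Proof. by move=> lL l19; apply: fill1 => //; rewrite eq_sym. Qed.

Lemma inc_ok s d l b L B m : rg s l = L -> rg s b = B -> l != 19 -> l != 20 -> b != 19 -> b != 20 ->
  (L == 0) || (0 < B) ->
  (forall i, i < L -> ar s d i = digit B m i) ->
  forall i, i < L -> ar (run (cInc d l b) s) d i = digit B m.+1 i.
Proof.
move=> lL bB l1 l2 b1 b2 LB h.
have [L0|L0] := posnP L; first by rewrite L0.
have B0 : 0 < B by case/orP: LB => //; lia.
set s1 := run (CSet 20 (XLit 1)) s.
have l1E : rg s1 l = L by rewrite /s1 /= /upd (negbTE l2).
pose bd := CWhen (XVar 20) (CIf (XSub (XVar b) (XAdd (XArr d (XVar 19)) (XLit 1)))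
  (CSeq (CSto d (XVar 19) (XAdd (XArr d (XVar 19)) (XLit 1))) (CSet 20 (XLit 0)))
  (CSto d (XVar 19) (XLit 0))).
pose I j s' := (rg s' 20 = (B ^ j %| m.+1)) /\
   forall i, i < L -> ar s' d i = digit B (if i < j then m.+1 else m) i.
suff [_ H] : I L (run (CFor 19 l bd) s1).
  by move=> i iL; have := H i iL; rewrite iL.
apply: (@run_for I _ _ _ _ _ l1E).
- by split; rewrite /= ?expn0 ?dvd1n.
- move=> j s' jL [f1 f2] sx [q1 q2].
  have bE : rg s' b = B by rewrite f1 ?inE ?negb_or ?b1 ?b2 // /s1 /= /upd (negbTE b2).
  have E1 : ar s' d j = digit B m j by rewrite q2 // ltnn.
  rewrite /I /bd /CWhen /= /evs /= q1; have ds := digit_succ m j B0; have de := dvdn_exp_succ m j B0.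
  case dv: (B ^ j %| m.+1) in ds de *; rewrite /= ?eqxx /=.
    rewrite bE sx E1; case lt: ((digit B m j).+1 < B) in ds *.
      have -> : (B - (digit B m j + 1) != 0) = true by lia.
      rewrite /=; split; first by rewrite /upd de /=; lia.
      move=> i iL; rewrite ?eqxx /=; case: (i =P j) => [->|ne].
        by rewrite ltnS leqnn ds addn1.
      by rewrite q2 // [in RHS]ltnS [in RHS]leq_eqVlt; case: (i =P j) => // /ne.
    have -> : (B - (digit B m j + 1) != 0) = false by lia.
    rewrite /=; split; first by rewrite /upd /= q1 dv de /=; lia.
    move=> i iL; rewrite ?eqxx /=; case: (i =P j) => [->|ne].
      by rewrite ltnS leqnn ds.
    by rewrite q2 // [in RHS]ltnS [in RHS]leq_eqVlt; case: (i =P j) => // /ne.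
  split; first by rewrite /upd /= q1 dv de.
  move=> i iL; rewrite q2 // [in RHS]ltnS [in RHS]leq_eqVlt; case: (i =P j) => [->|] //=.
  by rewrite ltnn ds.
Qed.

Lemma pow_ok s r b l B L : rg s b = B -> rg s l = L ->
  r \notin [:: 19; 21; 22] -> b \notin [:: 19; 21; 22; r] -> l \notin [:: 19; 21; 22; r] ->
  rg (run (cPow r b l) s) r = B ^ L.
Proof.
move=> bB lL; rewrite !inE !negb_or => /and3P[r1 r2 r3] /and4P[b1 b2 b3 b4] /and4P[l1 l2 l3 l4].
set s1 := run (CSet r (XLit 1)) s.
have l1E : rg s1 l = L by rewrite /s1 /= /upd (negbTE l4).
set bd := CSeqs [:: CSet 22 (XLit 0); CFor 21 b (CSet 22 (XAdd (XVar 22) (XVar r))); CSet r (XVar 22)].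
apply: (@run_for (fun j s' => rg s' r = B ^ j) 19 l bd s1 L l1E).
  by rewrite /s1 /= /upd (negbTE r1) eqxx.
move=> j s' jL [f1 _] sx q; rewrite -[run bd s']/(run (CSet r (XVar 22)) (run (CFor 21 b (CSet 22 (XAdd (XVar 22) (XVar r)))) (run (CSet 22 (XLit 0)) s'))).
set s2 := run (CSet 22 (XLit 0)) s'.
have r2E : rg s2 r = B ^ j by rewrite /s2 /= /upd (negbTE r3).
have b2E : rg s2 b = B.
  rewrite /s2 /= /upd (negbTE b3) f1 ?inE ?negb_or ?b1 ?b2 ?b3 ?b4 //.
  by rewrite /s1 /= /upd (negbTE b4).
have r22 : rg s2 22 = 0 by [].
clearbody s2.
pose I i s' := rg s' r = B ^ j /\ rg s' 22 = i * B ^ j.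
suff [_ H] : I B (run (CFor 21 b (CSet 22 (XAdd (XVar 22) (XVar r)))) s2).
  by rewrite /= /upd (negbTE r1) eqxx expnS -H.
apply: (@run_for I _ _ _ _ _ b2E).
- by rewrite /I /= /upd (negbTE r2) r2E r22.
- by move=> i s3 iB _ _ [q1 q2]; rewrite /I /= /evs /upd (negbTE r2) (negbTE r3) /= q1 q2 mulSn addnC.
Qed.

(** * Graph search *)

Section Search.
Variables (n : nat) (E : rel 'I_n.+1) (src : pred 'I_n.+1) (pa va : nat) (edge srce : ex) (s : st).
Local Notation V := 'I_n.+1.
Hypothesis sN : rg s rN = n.+1.
Hypothesis pva : pa != va.
Hypothesis Hedge : forall s' (x y : V), fr [:: 13; 14; 15] [:: pa; va] s s' ->
  rg s' 13 = x -> rg s' 14 = y -> (evs s' edge != 0) = E x y.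
Hypothesis Hsrc : forall s' (y : V), fr [:: 13; 14; 15] [:: pa; va] s s' ->
  rg s' 14 = y -> (evs s' srce != 0) = src y.

(** A newly visited vertex gets as rank the number of vertices visited before; ranks therefore fall
    along predecessors and bound the way back to a source. *)
Definition sgood (s' : st) (vs : {set V}) (pr : V -> V) (rk : V -> nat) :=
  [/\ forall y : V, ar s' va y = (y \in vs), forall y : V, ar s' pa y = pr y,
      forall y, src y -> (y \in vs) && (pr y == y),
      forall y, y \in vs -> ~~ src y -> [&& pr y \in vs, E (pr y) y & rk (pr y) < rk y]
    & forall y, y \in vs -> rk y < #|vs|].

Definition sclosed (vs : {set V}) := forall x y, x \in vs -> E x y -> y \in vs.

(** A round that visits nothing new shows that the set is closed; otherwise the set grows. Hence it
    is closed after as many rounds as there are vertices. *)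
Definition sinv m (s' : st) := exists vs pr rk, sgood s' vs pr rk /\ (sclosed vs \/ m <= #|vs|).

Definition sinv2 (vs0 : {set V}) i j (s' : st) := exists vs pr rk, [/\ sgood s' vs pr rk, vs0 \subset vs,
  sclosed vs0 -> vs = vs0
  & forall x y : V, (x < i) || (x == i :> nat) && (y < j) -> x \in vs0 -> E x y -> y \in vs].

Lemma search_step vs0 (x y : V) s' : fr [:: 13; 14; 15] [:: pa; va] s s' ->
  rg s' 13 = x -> rg s' 14 = y -> sinv2 vs0 x y s' ->
  sinv2 vs0 x y.+1 (run (CWhen (xand (XArr va (XVar 13)) (xand (xnot (XArr va (XVar 14))) edge))
      (CSeq (CSto va (XVar 14) (XLit 1)) (CSto pa (XVar 14) (XVar 13)))) s').
Proof.
move=> f sx sy [vs [pr [rk [[g1 g2 g3 g4 g5] sub cl pr0]]]].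
rewrite -[run _ s']/(if evs s' _ != 0 then _ else s') /evs !ev_xand ev_xnot -/(evs s' edge) (Hedge f sx sy).
rewrite -[ev _ _ (XArr va (XVar 13))]/(ar s' va (rg s' 13)) -[ev _ _ (XArr va (XVar 14))]/(ar s' va (rg s' 14)).
rewrite sx sy !g1 !eqb0 !negbK.
case: ifP => [/and3P[xv yv Exy]|h].
  have vpa : (va == pa) = false by rewrite eq_sym (negbTE pva).
  have syb := fun z => (g3 z).
  pose pr' z := if z == y then x else pr z; pose rk' z := if z == y then #|vs| else rk z.
  have nsy : ~~ src y by apply: contra yv => /g3/andP[].
  have cU : #|y |: vs| = #|vs|.+1 by rewrite cardsU1 yv.
  have rlt z : z \in vs -> z != y by apply: contraTneq => ->.
  exists (y |: vs), pr', rk'; split.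
  - split=> [z|z|z sz|z|z].
    + rewrite /= /evs /= sy vpa eqxx /= in_setU1 -val_eqE /= g1.
      by case: eqP.
    + rewrite /= /evs /= sy sx eqxx (negbTE pva) /= g2 /pr' -val_eqE /=.
      by case: eqP.
    + have /andP[zv zp] := g3 z sz; rewrite in_setU1 zv orbT /pr'; case: (z =P y) => [Ez|_] //.
      by rewrite -Ez sz in nsy.
    + rewrite in_setU1 /pr' /rk' => /orP[/eqP ->|zv] nz.
        by rewrite eqxx (negbTE (rlt _ xv)) in_setU1 xv orbT Exy g5.
      have /and3P[h1 h2 h3] := g4 z zv nz.
      by rewrite (negbTE (rlt _ zv)) (negbTE (rlt _ h1)) in_setU1 h1 orbT h2 h3.
    + rewrite in_setU1 cU /rk'; case: (z =P y) => // _ /= zv; exact: leqW (g5 z zv).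
  - by apply: subset_trans sub _; exact: subsetU1.
  - move=> c0; have E0 := cl c0; rewrite E0 in xv yv; by rewrite (c0 x y) in yv.
  - move=> x' y' h xv' Ex'; rewrite in_setU1; case: eqP => //= ne.
    apply: (pr0 x' y') => //; case/orP: h => [->//|/andP[-> hy]] /=; rewrite ltnS leq_eqVlt in hy.
    by case/orP: hy => [/eqP/val_inj/ne //|->]; rewrite orbT.
exists vs, pr, rk; split=> // x' y' hxy xv' Ex'.
apply/negPn/negP => hn.
case/orP: hxy => [lx|/andP[/eqP/val_inj Ex hy]]; first by case/negP: hn; apply: (pr0 x' y'); rewrite ?lx.
rewrite ltnS leq_eqVlt in hy; case/orP: hy => [/eqP/val_inj Ey|ly]; last first.
  by case/negP: hn; apply: (pr0 x' y') => //; rewrite Ex eqxx ly orbT.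
move/negP: h; case; rewrite -Ex -Ey.
by rewrite (subsetP sub _ xv') hn Ex'.
Qed.

Lemma search_ok : exists vs pr rk, sgood (run (cSearch pa va edge srce) s) vs pr rk /\ sclosed vs.
Proof.
rewrite /cSearch run_seq; set s1 := run (CFor 14 rN _) s.
have f1 : fr [:: 13; 14; 15] [:: pa; va] s s1.
  by apply: fr_sub (fr_run _ _) _ _ => z; rewrite /= !inE; lia.
have H1 : (forall i (y : V), y < i -> ar s1 va y = src y /\ ar s1 pa y = y) \/ True by right.
pose I1 i s' := forall y : V, y < i -> ar s' va y = src y /\ ar s' pa y = y.
have {}H1 : I1 n.+1 s1.
  apply: (@run_for I1 _ _ _ _ _ sN) => // i s' iN f' si IH y.
  rewrite ltnS leq_eqVlt /= /evs /= si => /orP[/eqP Ey|lt].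
    rewrite Ey eqxx [va == pa]eq_sym (negbTE pva) /= !eqxx /=; split=> //.
    have h : (evs s' srce != 0) = src y.
      apply: Hsrc => //; last by rewrite si Ey.
      apply: fr_sub f' _ _ => z; rewrite /= !inE; lia.
    by move: h; rewrite /evs => ->; case: (src y).
  have [e1 e2] := IH y lt.
  rewrite !eqxx [va == pa]eq_sym (negbTE pva) /= e1 e2.
  have -> : (y == i :> nat) = false by lia.
  by [].
have b1 : sinv 0 s1.
  exists [set y | src y], id, (fun=> 0); split; last by right.
  split=> [y|y|y|y|y]; rewrite ?inE.
  - by have [-> _] := H1 y (ltn_ord y).
  - by have [_ ->] := H1 y (ltn_ord y).
  - by move=> ->; rewrite eqxx.
  - by move=> ->.
  - by move=> sy; rewrite card_gt0; apply/set0Pn; exists y; rewrite inE.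
have s1N : rg s1 rN = n.+1 by rewrite f1.1.
suff [vs [pr [rk [g [c|c]]]]] : sinv n.+1 (run (CFor 15 rN (CFor 13 rN (CFor 14 rN
    (CWhen (xand (XArr va (XVar 13)) (xand (xnot (XArr va (XVar 14))) edge))
      (CSeq (CSto va (XVar 14) (XLit 1)) (CSto pa (XVar 14) (XVar 13))))))) s1).
- by exists vs, pr, rk.
- exists vs, pr, rk; split=> // x y _ _.
  have /eqP -> : vs == [set: V] by rewrite eqEcard subsetT cardsT card_ord.
  by rewrite inE.
set bd := CFor 14 rN _.
have fb : {subset wrC bd <= [:: 13; 14; 15]} /\ {subset waC bd <= [:: pa; va]}.
  by split=> z; rewrite /= !inE; lia.
apply: (@run_for sinv _ _ _ _ _ s1N); first exact: b1.
move=> r s2 rN' f2 sr [vs [pr [rk [g c]]]].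
have f2' : fr [:: 13; 14; 15] [:: pa; va] s s2.
  apply: fr_trans f1 _; apply: fr_sub f2 _ _ => z; first by rewrite /= !inE; lia.
  by rewrite /= !inE; lia.
have s2N : rg s2 rN = n.+1 by rewrite f2'.1.
suff : sinv2 vs n.+1 0 (run (CFor 13 rN bd) s2).
  move=> [vs' [pr' [rk' [g' sub cl ad]]]]; exists vs', pr', rk'; split; first by case: g'.
  have [cv|ncv] := boolP [forall x, forall y, (x \in vs) && E x y ==> (y \in vs)].
    left; have cv' : sclosed vs.
      by move=> x y xv Exy; move/forallP: cv => /(_ x)/forallP/(_ y)/implyP; apply; rewrite xv.
    by rewrite (cl cv').
  right; case: c => [cv|h].
    case/negP: ncv; apply/forallP => x; apply/forallP => y; apply/implyP => /andP[xv Exy].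
    exact: cv xv Exy.
  apply: leq_ltn_trans h _; apply: proper_card; apply/properP; split=> //.
  move: ncv; rewrite negb_forall => /existsP[x]; rewrite negb_forall => /existsP[y].
  rewrite negb_imply => /andP[/andP[xv Exy] yn]; exists y => //.
  by apply: (ad x y) => //; rewrite ltn_ord.
apply: (@run_for (fun i => sinv2 vs i 0) _ _ _ _ _ s2N).
  by exists vs, pr, rk; split=> // x y; rewrite ltn0 andbF.
move=> i s3 iN f3 si h3.
have f3' : fr [:: 13; 14; 15] [:: pa; va] s s3.
  apply: fr_trans f2' _; apply: fr_sub f3 _ _ => z; first by rewrite /= !inE; lia.
  by rewrite /= !inE; lia.
have s3N : rg s3 rN = n.+1 by rewrite f3'.1.
suff : sinv2 vs i n.+1 (run bd s3).
  move=> [vs' [pr' [rk' [g' sub cl ad]]]]; exists vs', pr', rk'; split=> //.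
  move=> x y; rewrite ltn0 andbF orbF ltnS leq_eqVlt => h xv Exy; apply: (ad x y) => //.
  by rewrite ltn_ord andbT orbC.
apply: (@run_for (sinv2 vs i) _ _ _ _ _ s3N).
  by case: h3 => vs' [pr' [rk' [g' sub cl ad]]]; exists vs', pr', rk'; split; first by case: g'.
move=> j s4 jN f4 sj h4.
have f4' : fr [:: 13; 14; 15] [:: pa; va] s s4.
  apply: fr_trans f3' _; apply: fr_sub f4 _ _ => z; first by rewrite /= !inE; lia.
  by rewrite /= !inE; lia.
have s4i : rg s4 13 = i by rewrite f4.1.
have [vs' [pr' [rk' [g' sub cl ad]]]] := @search_step vs (Ordinal iN) (Ordinal jN) s4 f4' s4i sj h4.
by exists vs', pr', rk'; split; first by case: g'.
Qed.

End Search.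

(** * Constants, input arrays and the rooted tree *)

Section Context.
Variables (n : nat) (G : multigraph n.+1) (T : {set edge G}) (J lam : nat).
Local Notation V := 'I_n.+1.
Local Notation N := (n.+1).
Definition e1 (e : edge G) : V := (ends e).1.
Definition e2 (e : edge G) : V := (ends e).2.

Record ctx (g : nat -> nat) (a : nat -> nat -> nat) : Prop := Ctx {
  cN : g rN = N; cK : g rK = J.+1; cL : g rL = lam; cJ : g rJ = J; cInf : g rInf = lam.+1;
  cSq : g rSq = N * N; cTL : g rTL = 2 * lam; cL1 : g rL1 = 5 * J; cL2 : g rL2 = 6 * J;
  cC1 : g rC1 = J.+1 ^ (5 * J); cC2 : g rC2 = J.+1 ^ (6 * J); cC3 : g rC3 = (2 * lam) ^ J;
  cJJ : g rJJ = J + J; cJ1 : g rJ1 = J.+1;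
  cROW : forall i, i < N * N -> a aROW i = i * N;
  cA : forall x y : V, a aIN (x * N + y) = mult e1 e2 x y;
  cT : forall x y : V, (a aIN (N * N + (x * N + y)) != 0) = adjacent T x y }.

Definition cregs := [:: 0; 1; 2; 3; 4; 5; 6; 7; 8; 9; 10; 11; 12; 28].
Definition carrs := [:: aROW; aIN].

Lemma ctx_ext g a g' a' : {in cregs, g' =1 g} -> (forall b i, b \in carrs -> a' b i = a b i) ->
  ctx g a -> ctx g' a'.
Proof.
by move=> hg ha []; split; rewrite ?hg //; move=> *; rewrite ha //; auto.
Qed.

Lemma ctx_fr rs sa s s' : fr rs sa s s' -> ~~ has (mem rs) cregs -> ~~ has (mem sa) carrs ->
  ctx (rg s) (ar s) -> ctx (rg s') (ar s').
Proof.
move=> [f1 f2] /hasPn h1 /hasPn h2; apply: ctx_ext => [r /h1|b i /h2] h; [exact: f1|exact: f2].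
Qed.

Lemma ctx_upd g a x i : 70 <= x -> ctx g a -> ctx (upd g x i) a.
Proof.
move=> x70; apply: ctx_ext => // r hr; rewrite /upd; case: eqP => // Er.
by move: hr; rewrite !inE Er; lia.
Qed.

Lemma idx2_lt (x y : V) : x * N + y < N * N.
Proof. by have := ltn_ord x; have := ltn_ord y; nia. Qed.

Lemma idx2_inj (x y x' y' : V) : (x * N + y == x' * N + y') = (x == x') && (y == y').
Proof.
apply/eqP/andP => [h|[/eqP-> /eqP->]//].
have h1 := congr1 (fun m => m %/ N) h; have h2 := congr1 (fun m => m %% N) h.
rewrite /= !divnMDl // !divn_small ?addn0 in h1 => //; rewrite !modnMDl !modn_small // in h2.
by split; apply/eqP/val_inj.
Qed.

Section Exprs.
Variables (g : nat -> nat) (a : nat -> nat -> nat).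
Hypothesis c : ctx g a.

Lemma row_lt (x : V) : x < N * N.
Proof. by have := ltn_ord x; nia. Qed.

Lemma ev_xidx e f (x y : V) : ev g a e = x -> ev g a f = y -> ev g a (xidx e f) = x * N + y.
Proof. by move=> /= -> ->; rewrite (cROW c) // row_lt. Qed.

Lemma ev_xA e f (x y : V) : ev g a e = x -> ev g a f = y -> ev g a (xA e f) = mult e1 e2 x y.
Proof. by move=> h1 h2; rewrite -(cA c) -(ev_xidx h1 h2). Qed.

Lemma ev_xT e f (x y : V) : ev g a e = x -> ev g a f = y -> (ev g a (xT e f) != 0) = adjacent T x y.
Proof. by move=> h1 h2; rewrite -(cT c) -(ev_xidx h1 h2) /= (cSq c). Qed.
End Exprs.

Record treeok (par : V -> V) (a : nat -> nat -> nat) : Prop := Treeok {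
  tP : forall x : V, a aPAR x = par x;
  tA : forall v x : V, a aANC (v * N + x) = ancp par v x;
  tD : forall v : V, a aDEG v = #|D e1 e2 (ancp par) v| }.

Lemma closed_connect_set (e : rel V) (S : {set V}) x y :
  (forall u v, u \in S -> e u v -> v \in S) -> x \in S -> connect e x y -> y \in S.
Proof.
move=> cl xS /connectP[p pp ->]; elim: p x xS pp => //= u p IH x xS /andP[xu].
by apply: IH; exact: cl xS xu.
Qed.

(** The search from vertex 0 along [T] reaches every vertex by connectedness; its predecessors and
    ranks are the parent function and the ranks of the rooted tree. *)
Lemma tree_ok s : ctx (rg s) (ar s) -> (forall u v, connect (adjacent T) u v) ->
  exists par rk, [/\ par ord0 = ord0, forall y : V, y != ord0 -> rk (par y) < rk y,
    forall y, y != ord0 -> adjacent T (par y) y & forall x : V, ar (run cTree s) aPAR x = par x].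
Proof.
move=> c Tc; rewrite /cTree; have src0 (y : V) : (y : nat) == 0 = (y == ord0) by [].
have [||vs [pr [rk [[g1 g2 g3 g4 g5] cl]]]] := @search_ok n (adjacent T) (pred1 ord0) aPAR aVIS
    (xT (XVar 13) (XVar 14)) (xnot (XVar 14)) s (cN c) isT.
- move=> s' x y f h1 h2; apply: ev_xT => //.
  by apply: ctx_fr f _ _ c.
- by move=> s' y f h; rewrite /evs ev_xnot negbK /= h.
have all y : y \in vs.
  have /g3/andP[h _] : pred1 ord0 (ord0 : V) by [].
  exact: closed_connect_set cl h (Tc ord0 y).
exists pr, rk; split=> //.
- by apply/eqP; have /g3/andP[_] : pred1 ord0 (ord0 : V) by [].
- by move=> y y0; have /and3P[_ _] := g4 y (all y) y0.
- by move=> y y0; have /and3P[_ ] := g4 y (all y) y0.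
Qed.

Variables (par : V -> V) (rk : V -> nat).
Hypothesis par0 : par ord0 = ord0.
Hypothesis rk_par : forall y, y != ord0 -> rk (par y) < rk y.
Local Notation anc := (ancp par).

(** An ancestor is reached within fewer steps than there are vertices; this bounds the walk that
    fills a column of the ancestor table. *)
Lemma ancp_iter v x : anc v x = [exists i : 'I_N, v == iter i par x].
Proof.
apply/idP/existsP => [h|[i /eqP ->]]; last exact: fconnect_iter.
have lt : findex par x v < N.
  apply: leq_trans (findex_max h) _; rewrite -[X in _ <= X](card_ord N); exact: max_card.
by exists (Ordinal lt); rewrite /= iter_findex.
Qed.

Lemma anc_ok s : ctx (rg s) (ar s) -> (forall x : V, ar s aPAR x = par x) ->
  forall v x : V, ar (run cAnc s) aANC (v * N + x) = anc v x.
Proof.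
move=> c hp.
pose I i s' := forall v x : V, x < i -> ar s' aANC (v * N + x) = anc v x.
suff : I N (run cAnc s) by move=> h v x; exact: h.
apply: (@run_for I _ _ _ _ _ (cN c)) => // i s1 iN f1 s1i I1.
have c1 : ctx (rg s1) (ar s1) by apply: ctx_fr f1 _ _ c.
pose x := Ordinal iN.
rewrite !run_seqs run_seqs1.
set s2 := run (CFor 17 rN (CSto _ _ (XLit 0))) s1.
have f2 : fr [:: 17] [:: aANC] s1 s2 by rewrite /s2; apply: fr_of.
pose K j s' := forall v y : V, y <= i -> ar s' aANC (v * N + y) = if y < i then anc v y : nat else if v < j then 0 else ar s1 aANC (v * N + y).
have I2 : K N s2.
  apply: (@run_for K _ _ _ _ _ (cN c1)).
    by move=> v y; rewrite leq_eqVlt => /orP[/eqP ->|h]; rewrite ?ltnn ?h // I1.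
  move=> j s' jN f' sj Kj v y yi.
  have c' : ctx (rg s') (ar s') by apply: ctx_fr f' _ _ c1.
  have s'x : rg s' 16 = x by rewrite f'.1.
  rewrite -[LHS]/(if (aANC == aANC) && (v * N + y == evs s' (xidx (XVar 17) (XVar 16))) then 0 else ar s' aANC (v * N + y)).
  rewrite /evs (@ev_xidx _ _ c' (XVar 17) (XVar 16) (Ordinal jN) x) // eqxx andTb idx2_inj Kj // -!val_eqE /=.
  case: (y =P i :> nat) => [->|ne]; last first.
    have -> : y < i by lia.
    by rewrite andbF.
  rewrite ltnn andbT ltnS [v <= j]leq_eqVlt; case: eqP => [->|_] //=.
set s3 := run (CSet 18 (XVar 16)) s2.
have c3 : ctx (rg s3) (ar s3).
  by apply: ctx_fr (fr_run _ _) _ _ (ctx_fr f2 _ _ c1).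
pose L j s' := (rg s' 18 = iter j par x :> nat) /\ forall v y : V, y <= i ->
  ar s' aANC (v * N + y) = if y < i then anc v y : nat else [exists q : 'I_N, (q < j) && (v == iter q par x)].
have : L N (run (CFor 17 rN (CSeq (CSto aANC (xidx (XVar 18) (XVar 16)) (XLit 1)) (CSet 18 (XArr aPAR (XVar 18))))) s3).
  apply: (@run_for L _ _ _ _ _ (cN c3)).
    split; first by rewrite -[LHS]/(rg s2 16) f2.1.
    move=> v y yi; rewrite -[LHS]/(ar s2 aANC (v * N + y)) I2 // ltn_ord.
    by case: ifP => // _; apply/esym/eqP; rewrite eqb0; apply/existsPn => q; rewrite ltn0.
  move=> j s' jN f' sj [L1 L2].
  have c' : ctx (rg s') (ar s') by apply: ctx_fr f' _ _ c3.
  have s'x : rg s' 16 = x by rewrite f'.1 // -[LHS]/(rg s2 16) f2.1.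
  rewrite run_seq; set s4 := run (CSto _ _ _) s'.
  split.
    rewrite -[LHS]/(ar s4 aPAR (rg s' 18)) -[ar s4 aPAR _]/(ar s' aPAR (rg s' 18)) L1.
    by rewrite f'.2 // -[ar s3 _ _]/(ar s2 aPAR (iter j par x)) f2.2 // f1.2 // hp.
  move=> v y yi.
  rewrite -[LHS]/(if (aANC == aANC) && (v * N + y == evs s' (xidx (XVar 18) (XVar 16))) then 1 else ar s' aANC (v * N + y)).
  rewrite /evs (@ev_xidx _ _ c' (XVar 18) (XVar 16) (iter j par x) x) // eqxx andTb idx2_inj L2 //.
  have [yx|ne] := eqVneq y x; last first.
    rewrite andbF; have -> // : y < i.
    by move: ne; rewrite -val_eqE /= => ne; lia.
  have -> : (y < i) = false by rewrite yx; exact: ltnn.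
  rewrite andbT; case: eqP => [->|nv].
    by apply/esym/eqP; rewrite eqb1; apply/existsP; exists (Ordinal jN); rewrite /= ltnSn eqxx.
  congr nat_of_bool; apply: eq_existsb => q; rewrite [in RHS]ltnS [in RHS]leq_eqVlt.
  case: (q =P j :> nat) => [Eq|_] //=; rewrite Eq ltnn /=.
  by apply/esym/negbTE/eqP => h; apply: nv.
move=> [_ L2] v y; rewrite ltnS => yi; rewrite -[LHS]/(ar (run (CFor 17 rN _) s3) aANC (v * N + y)) L2 //.
case: ltnP => // iy; have -> : y = x by apply/val_inj => /=; lia.
by rewrite ancp_iter; congr nat_of_bool; apply: eq_existsb => q; rewrite ltn_ord.
Qed.

End Context.

(** * Evaluation of a guess *)

Section Guesses.
Variables (n : nat) (G : multigraph n.+1) (T : {set edge G}) (J lam : nat).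
Local Notation V := 'I_n.+1.
Local Notation N := (n.+1).
Local Notation ctx := (ctx T J lam).
Local Notation treeok := (@treeok n G).
Variables (par : V -> V) (rk : V -> nat).
Hypothesis par0 : par ord0 = ord0.
Hypothesis rk_par : forall y, y != ord0 -> rk (par y) < rk y.
Local Notation anc := (ancp par).
Local Notation s1 := (@e1 n G).
Local Notation s2 := (@e2 n G).
Local Notation DD := (D s1 s2 anc).
Local Notation okV := (okv s1 s2 anc ord0 lam).

Let arefl := ancp_refl par.
Let atrans := @ancp_trans n par.
Let aanti := ancp_anti par0 rk_par.
Let atot := @ancp_tot n par.

Definition candv x x' v := [&& okV v, anc v x & ~~ anc v x'].
Definition topv x x' := the (fun v => candv x x' v && ~~ [exists v', candv x x' v' && (anc v' v && (v' != v))]).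

(** Candidates are ancestors of [x], hence pairwise comparable, so only one can have no candidate
    above it. *)
Lemma topv_uniq x x' v w :
  candv x x' v && ~~ [exists v', candv x x' v' && (anc v' v && (v' != v))] ->
  candv x x' w && ~~ [exists v', candv x x' v' && (anc v' w && (v' != w))] -> v = w.
Proof.
move=> /andP[cv /existsPn nv] /andP[cw /existsPn nw].
have /and3P[_ vx _] := cv; have /and3P[_ wx _] := cw.
apply/eqP; apply: contraT => ne.
case/orP: (atot vx wx) => h.
  by have := nw v; rewrite cv h ne.
by have := nv w; rewrite cw h eq_sym ne.
Qed.

Lemma topv_ok x x' f : okV f -> anc f x -> ~~ anc f x' ->
  [/\ okV (topv x x'), anc (topv x x') x, ~~ anc (topv x x') x' & anc (topv x x') f].
Proof.
move=> fo fx fx'; have cf : candv x x' f by rewrite /candv fo fx fx'.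
case: (arg_minnP (fun v => #|[set z | anc z v]|) cf) => v cv vm.
have lowest w : candv x x' w -> anc w v -> w = v.
  move=> cw wv; have le := vm w cw.
  have sub : [set z | anc z w] \subset [set z | anc z v].
    by apply/subsetP => z; rewrite !inE => zw; exact: atrans zw wv.
  have /eqP E2 : [set z | anc z w] == [set z | anc z v] by rewrite eqEcard sub.
  apply: aanti; rewrite wv /=.
  by have : v \in [set z | anc z v]; [rewrite inE|rewrite -E2 inE].
have isv : candv x x' v && ~~ [exists v', candv x x' v' && (anc v' v && (v' != v))].
  rewrite cv; apply/existsPn => w; apply/negP => /and3P[cw wv]; by rewrite (lowest w cw wv) eqxx.
have E : topv x x' = v.
  apply: (@topv_uniq x x') => //.
  exact: (@theP n (fun v => candv x x' v && ~~ [exists v', candv x x' v' && (anc v' v && (v' != v))]) v).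
rewrite E; have /and3P[h1 h2 h3] := cv; split=> //.
case/orP: (atot h2 fx) => // h.
by rewrite (lowest f cf h).
Qed.

Local Notation visV := (vis s1 s2 anc).
Definition vself w t : V := nthset (visV w) t.

Lemma vself_ok w y : #|DD w| <= lam -> visV w y -> exists2 t, t < 2 * lam & vself w t = y.
Proof.
move=> wl /nthset_ex[t tl <-]; exists t => //.
apply: leq_trans tl _.
apply: (@leq_trans #|(s1 @: DD w) :|: (s2 @: DD w)|).
  apply: subset_leq_card; apply/subsetP => z /exists_inP[e ew ez]; rewrite in_setU.
  by case/orP: ez => /eqP <-; rewrite imset_f ?orbT.
apply: leq_trans (leq_card_setU _ _) _; rewrite mul2n -addnn.
by apply: leq_add; apply: leq_trans (leq_imset_card _ _) wl.
Qed.

(** Multiplicities are the only form in which the machine sees edges. *)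
Lemma visE w y : visV w y = [exists z, (mult s1 s2 y z != 0) && (anc w y != anc w z)].
Proof.
apply/exists_inP/existsP => [[e]|[z /andP[m ne]]].
  rewrite inE /sep => ew /orP[/eqP <-|/eqP <-].
    exists (s2 e); rewrite ew andbT -lt0n card_gt0; apply/set0Pn; exists e.
    by rewrite inE !eqxx.
  exists (s1 e); rewrite [X in _ && ~~ X]eq_sym ew andbT -lt0n card_gt0; apply/set0Pn; exists e.
  by rewrite inE !eqxx orbT.
move: m; rewrite -lt0n card_gt0 => /set0Pn[e]; rewrite inE /isend => h.
exists e; case/orP: h => /andP[/eqP h1 /eqP h2]; rewrite ?inE /sep h1 h2 ?eqxx ?orbT //.
by rewrite eq_sym.
Qed.

Lemma upd_lt g x i r : r != x -> upd g x i r = g r.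
Proof. by rewrite /upd => /negbTE ->. Qed.

Lemma ev_xancA g a e f (v x : V) : ctx g a -> (forall v x : V, a aANC (v * N + x) = anc v x) ->
  ev g a e = v -> ev g a f = x -> (ev g a (xanc e f) != 0) = anc v x.
Proof. by move=> c hA h1 h2; rewrite -[ev g a (xanc e f)]/(a aANC (ev g a (xidx e f))) (ev_xidx c h1 h2) hA eqb0 negbK. Qed.

Section Exprs.
Variables (g : nat -> nat) (a : nat -> nat -> nat).
Hypothesis c : ctx g a.
Hypothesis t : treeok par a.

Lemma ev_xanc e f (v x : V) : ev g a e = v -> ev g a f = x -> ev g a (xanc e f) = anc v x.
Proof. by move=> h1 h2; rewrite -(tA t) -(ev_xidx c h1 h2). Qed.
Lemma ev_xancb e f (v x : V) : ev g a e = v -> ev g a f = x -> (ev g a (xanc e f) != 0) = anc v x.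
Proof. by move=> h1 h2; rewrite (ev_xanc h1 h2) eqb0 negbK. Qed.
Lemma ev_xok e (v : V) : ev g a e = v -> (ev g a (xok e) != 0) = okV v.
Proof.
move=> h; rewrite ev_xand ev_xnot negbK h /okv -(tD t) /= h (cL c) subn_eq0.
by rewrite -(inj_eq val_inj).
Qed.
Lemma ev_xcand e f h (v x x' : V) : ev g a e = v -> ev g a f = x -> ev g a h = x' ->
  (ev g a (xcand e f h) != 0) = candv x x' v.
Proof.
by move=> h1 h2 h3; rewrite ev_xand (ev_xok h1) ev_xand (ev_xancb h1 h2) ev_xnot (ev_xancb h1 h3).
Qed.
End Exprs.

Section Exprs2.
Variables (g : nat -> nat) (a : nat -> nat -> nat).
Hypothesis c : ctx g a.
Hypothesis t : treeok par a.

Lemma ev_xtop p q (x x' : V) : p < 70 -> q < 70 -> g p = x -> g q = x' ->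
  ev g a (xtop (XVar p) (XVar q)) = topv x x'.
Proof.
move=> p7 q7 gp gq; rewrite (ev_xsum (N := N) (f := fun v : V => if candv x x' v && ~~ [exists v', candv x x' v' && (anc v' v && (v' != v))] then v : nat else 0)).
- by rewrite sum_the // => v w; exact: topv_uniq.
- exact: cN c.
move=> v; have c1 : ctx (upd g 80 v) a by apply: ctx_upd.
have ne r z i : r < 70 -> 70 <= z -> upd g z i r = g r by move=> *; apply: upd_lt; lia.
rewrite ev_ite ev_xand (@ev_xcand _ _ c1 t _ _ _ v x x') //; try by rewrite /= ne.
rewrite ev_xnot (ev_xex (N := N) (P := fun v' => candv x x' v' && (anc v' v && (v' != v)))) //; first exact: cN c1.
move=> v'; have c2 : ctx (upd (upd g 80 v) 81 v') a by apply: ctx_upd.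
have ne2 r : r < 70 -> upd (upd g 80 v) 81 v' r = g r by move=> *; rewrite !upd_lt //; lia.
rewrite ev_xand (@ev_xcand _ _ c2 t _ _ _ v' x x') //; try by rewrite /= ne2.
by rewrite ev_xand (@ev_xancb _ _ c2 t _ _ v' v) // ev_xnot ev_xeq.
Qed.

Lemma ev_vself p q (w : V) : p < 70 -> g p = w -> (forall i, ev (upd g 83 i) a q = ev g a q) ->
  ev g a (xnth (xvis (XVar p)) q) = vself w (ev g a q).
Proof.
move=> p7 gp hq; apply: ev_xnth => // [|i|i j]; first exact: cN c.
  have c1 : ctx (upd g 83 i) a by apply: ctx_upd.
  rewrite -[LHS]/(ev (upd g 83 i) a (xvis (XVar p) (XVar 83)) != 0) visE.
  apply: ev_xex => [|z]; first exact: cN c1.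
  have c2 : ctx (upd (upd g 83 i) 82 z) a by apply: ctx_upd.
  have pz : upd (upd g 83 i) 82 z p = w by rewrite !upd_lt ?gp //; lia.
  rewrite ev_xand (@ev_xA _ _ _ _ _ _ _ c2 _ _ i z) // ev_xnot ev_xeq.
  rewrite (@ev_xanc _ _ c2 t _ _ w i) // (@ev_xanc _ _ c2 t _ _ w z) //.
  by rewrite eqn_leq; case: (anc w i); case: (anc w z).
have c1 : ctx (upd (upd g 83 i) 84 j) a by apply: ctx_upd => //; apply: ctx_upd.
rewrite -[LHS]/(ev (upd (upd g 83 i) 84 j) a (xvis (XVar p) (XVar 84)) != 0) visE.
apply: ev_xex => [|z]; first exact: cN c1.
have c2 : ctx (upd (upd (upd g 83 i) 84 j) 82 z) a by apply: ctx_upd.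
have pz : upd (upd (upd g 83 i) 84 j) 82 z p = w by rewrite !upd_lt ?gp //; lia.
rewrite ev_xand (@ev_xA _ _ _ _ _ _ _ c2 _ _ j z) // ev_xnot ev_xeq.
rewrite (@ev_xanc _ _ c2 t _ _ w j) // (@ev_xanc _ _ c2 t _ _ w z) //.
by rewrite eqn_leq; case: (anc w j); case: (anc w z).
Qed.
End Exprs2.

Lemma treeok_fr rs sa s s' : fr rs sa s s' -> ~~ has (mem sa) [:: aPAR; aANC; aDEG] ->
  treeok par (ar s) -> treeok par (ar s').
Proof.
move=> [_ f2] /hasPn h2 [h3 h4 h5]; split=> *; rewrite f2 //; apply: h2; by rewrite !inE ?eqxx ?orbT.
Qed.

Lemma deg_ok s : ctx (rg s) (ar s) -> (forall x : V, ar s aPAR x = par x) ->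
  (forall v x : V, ar s aANC (v * N + x) = anc v x) -> treeok par (ar (run cDeg s)).
Proof.
move=> c hP hA.
split=> [x|v x|v]; [by rewrite run_ar|by rewrite run_ar|].
pose f i := if insub i is Some v then #|DD v| else 0.
suff H : forall i, i < N -> ar (run cDeg s) aDEG i = f i by rewrite H // /f valK.
apply: (@fill1 s 16 rN aDEG _ N f (cN c) isT) => s' i iN f' si.
rewrite /f insubT; set w : V := Sub i iN.
have c' : ctx (rg s') (ar s') by apply: ctx_fr f' _ _ c.
have hA' (v' x' : V) : ar s' aANC (v' * N + x') = anc v' x' by rewrite f'.2.
pose Q a b := anc w a && ~~ anc w b.
have Qas a b : Q a b -> ~~ Q b a by rewrite /Q => /andP[-> _]; rewrite andbF.
have -> : #|DD w| = \sum_a \sum_b (if Q a b then mult s1 s2 a b else 0).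
  rewrite (count_pairs s1 s2 Qas); apply: eq_card => e; rewrite !inE /sep /Q.
  by case: (anc w (s1 e)); case: (anc w (s2 e)).
apply: ev_xsum => [|a1]; first exact: cN c'.
have c1 : ctx (upd (rg s') 80 a1) (ar s') by apply: ctx_upd.
apply: ev_xsum => [|b1]; first exact: cN c1.
have c2 : ctx (upd (upd (rg s') 80 a1) 81 b1) (ar s') by apply: ctx_upd.
rewrite ev_ite ev_xand ev_xnot (@ev_xancA _ _ _ _ w a1 c2 hA') // (@ev_xancA _ _ _ _ w b1 c2 hA') //.
by rewrite /Q; case: ifP => // _; exact: (ev_xA c2).
Qed.

Definition stat (s : st) := ctx (rg s) (ar s) /\ treeok par (ar s).
Lemma stat_fr rs sa s s' : fr rs sa s s' -> ~~ has (mem rs) cregs ->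
  ~~ has (mem sa) [:: aROW; aIN; aPAR; aANC; aDEG] -> stat s -> stat s'.
Proof.
move=> f h1 h2 [c t]; have /hasPn h3 := h2; split.
  apply: ctx_fr f h1 _ c; apply/hasPn => b hb; apply: h3; move: hb; rewrite !inE.
  by case/orP => ->; rewrite ?orbT.
apply: treeok_fr f _ t; apply/hasPn => b hb; apply: h3; move: hb; rewrite !inE.
by case/or3P => ->; rewrite ?orbT.
Qed.

Local Notation leafV := (leaf topv vself J).
Local Notation ctopV := (ctop topv vself J).
Local Notation xsqV := (xsq topv vself J).

Lemma leaves_ok s (c : V) : stat s -> rg s rC = c -> (forall i, i < 6 * J -> ar s aD2 i <= J) ->
  let s' := run cLeaves s in
  (forall i, i <= J -> ar s' aX i = leafV c (ar s aD2) (ar s aD3) i) /\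
  (forall i, i < J -> ar s' aW i = ctopV c (ar s aD2) (ar s aD3) i).
Proof.
move=> st0 sc hd; have [cs ts] := st0; rewrite /cLeaves !run_seqs run_seqs1.
set L1 := CFor 27 rJ1 _; set L3 := CFor 27 rJ _; set L2 := CFor 27 rJ _.
set dg := ar s aD2; set dt := ar s aD3.
set s1 := run L1 s; set s2 := run L2 s1.
have f1 : fr [:: 27] [:: aX] s s1 by rewrite /s1; apply: fr_of.
have f2 : fr [:: 27; 30; 31; 32] [:: aX] s1 s2 by rewrite /s2; apply: fr_of.
have st1 : stat s1 by apply: stat_fr f1 _ _ _.
have st2 : stat s2 by apply: stat_fr f2 _ _ _.
have X1 i : i <= J -> ar s1 aX i = c.
  move=> iJ; apply: (@fill1 s 27 rJ1 aX _ J.+1 (fun=> c) (cJ1 cs)) => // s' j jJ f' sj.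
  by rewrite -[LHS]/(rg s' rC) f'.1.
pose I i s' := forall j, j <= J -> ar s' aX j = nth c (xsqV c dg dt i) j.
have X2 : I J s2.
  apply: (@run_for I _ _ _ _ _ (cJ st1.1)).
    move=> j jJ; rewrite -[LHS]/(ar s1 aX j) X1 //; case: j jJ => [|j] //= _.
    by rewrite nth_nil.
  move=> i s' iJ f' si Ii j jJ.
  have st' : stat s' by apply: stat_fr f' _ _ _.
  have D2' q : ar s' aD2 q = dg q by rewrite f'.2 // f1.2.
  have D3' q : ar s' aD3 q = dt q by rewrite f'.2 // f1.2.
  have cJ' := cJ st'.1.
  rewrite -[LHS]/(ar (run (CSeqs _) s') aX j) !run_seqs run_seqs1.
  set t1 := run (CSet 30 _) s'; set t2 := run (CSet 31 _) t1; set t3 := run (CSet 32 _) t2.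
  have ft1 : fr [:: 30] [::] s' t1 by rewrite /t1; apply: fr_of.
  have ft2 : fr [:: 30; 31] [::] s' t2.
    by apply: fr_trans (fr_sub ft1 _ _) _ => // [q|]; [rewrite !inE => ->|rewrite /t2; apply: fr_of].
  have ft3 : fr [:: 30; 31; 32] [::] s' t3.
    apply: fr_trans (fr_sub ft2 _ _) _ => // [q|]; last by rewrite /t3; apply: fr_of.
    by rewrite !inE => /orP[] ->; rewrite ?orbT.
  have stt2 : stat t2 by apply: stat_fr ft2 _ _ _.
  have stt3 : stat t3 by apply: stat_fr ft3 _ _ _.
  have e30 : rg t1 30 = nth c (xsqV c dg dt i) (da J dg i).
    rewrite -[LHS]/(ar s' aX (ar s' aD2 (rg s' rJ + rg s' 27))) D2' cJ' si Ii //.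
    by rewrite /dg hd //; lia.
  have e31 : rg t2 31 = nth c (xsqV c dg dt i) (db J dg i).
    rewrite -[LHS]/(ar t1 aX (ar t1 aD2 (rg t1 rJ + (rg t1 rJ + rg t1 27)))) ft1.1 // ft1.1 // !ft1.2 //.
    by rewrite D2' cJ' si Ii // /dg hd //; lia.
  have e32 : rg t3 32 = src topv J c dg (xsqV c dg dt i) i.
    rewrite -[LHS]/(if ar t2 aD2 (rg t2 rJ + rg t2 27) != 0 then ev (rg t2) (ar t2) (xtop (XVar 30) (XVar 31)) else rg t2 rC).
    rewrite ft2.2 // !ft2.1 // D2' cJ' si /src -/(da J dg i); case: eqP => [_|_] /=.
      by rewrite f'.1 // f1.1.
    by apply: (ev_xtop stt2.1 stt2.2); rewrite // ft1.1.
  have e33 : ev (rg t3) (ar t3) (xnth (xvis (XVar 32)) (XArr aD3 (XVar 27))) = vself (src topv J c dg (xsqV c dg dt i) i) (dt i).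
    rewrite (ev_vself stt3.1 stt3.2 (w := src topv J c dg (xsqV c dg dt i) i)) //.
    by rewrite -[ev _ _ _]/(ar t3 aD3 (rg t3 27)) ft3.2 // ft3.1 // si D3'.
  rewrite -[LHS]/(if (aX == aX) && (j == rg t3 27 + 1) then ev (rg t3) (ar t3) (xnth (xvis (XVar 32)) (XArr aD3 (XVar 27))) else ar t3 aX j).
  rewrite e33 eqxx andTb ft3.1 // si addn1 ft3.2 // Ii // nth_rcons size_xsq.
  case: ltngtP => // h.
  by rewrite nth_default // size_xsq ltnW.
have lf i : i <= J -> ar s2 aX i = leafV c dg dt i by move=> iJ; rewrite X2.
have f3 : fr [:: 27; 30; 31] [:: aW] s2 (run L3 s2) by apply: fr_of.
split=> [i iJ|]; first by rewrite f3.2 // lf.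
pose I3 i s' := forall j, j < i -> ar s' aW j = ctopV c dg dt j.
have : I3 J (run L3 s2); last by [].
apply: (@run_for I3 _ _ _ _ _ (cJ st2.1)) => // i s' iJ f' si Ii j.
rewrite ltnS => ji.
have st' : stat s' by apply: stat_fr f' _ _ _.
have D2' q : ar s' aD2 q = dg q by rewrite f'.2 // f2.2 // f1.2.
have cJ' := cJ st'.1.
rewrite -[LHS]/(ar (run (CSeqs _) s') aW j) !run_seqs run_seqs1.
set t1 := run (CSet 30 _) s'; set t2 := run (CSet 31 _) t1.
have ft1 : fr [:: 30] [::] s' t1 by rewrite /t1; apply: fr_of.
have ft2 : fr [:: 30; 31] [::] s' t2.
  by apply: fr_trans (fr_sub ft1 _ _) _ => // [q|]; [rewrite !inE => ->|rewrite /t2; apply: fr_of].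
have stt2 : stat t2 by apply: stat_fr ft2 _ _ _.
have e30 : rg t1 30 = leafV c dg dt i.+1.
  by rewrite -[LHS]/(ar s' aX (rg s' 27 + 1)) si addn1 f'.2 // lf.
have e31 : rg t2 31 = leafV c dg dt (dp J dg i).
  rewrite -[LHS]/(ar t1 aX (ar t1 aD2 (rg t1 rJ + (rg t1 rJ + (rg t1 rJ + rg t1 27))))) ft1.1 // ft1.1 // !ft1.2 //.
  by rewrite D2' cJ' si f'.2 // lf // /dg hd //; lia.
have e32 : ev (rg t2) (ar t2) (xtop (XVar 30) (XVar 31)) = ctopV c dg dt i.
  by apply: (ev_xtop stt2.1 stt2.2).
rewrite -[LHS]/(if (aW == aW) && (j == rg t2 27) then ev (rg t2) (ar t2) (xtop (XVar 30) (XVar 31)) else ar t2 aW j).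
rewrite e32 eqxx andTb ft2.1 // si; case: eqP => [->//|ne].
by rewrite ft2.2 // Ii //; lia.
Qed.

Section Valid.
Variables (g : nat -> nat) (a : nat -> nat -> nat) (ss : nat) (u c : V).
Hypothesis cg : ctx g a.
Hypothesis ta : treeok par a.
Local Notation dg := (a aD2).
Local Notation dt := (a aD3).
Hypothesis gS : g rS = ss.
Hypothesis gU : g rU = u.
Hypothesis gC : g rC = c.
Hypothesis aXE : forall i, i <= J -> a aX i = leafV c dg dt i.
Hypothesis aWE : forall i, i < J -> a aW i = ctopV c dg dt i.

Lemma ev_xvalid : ev g a xvalid != 0 <-> valid anc ord0 topv vself J ss u c dg dt.
Proof.
pose P1 (i : 'I_J) := dused dg i && ~~ slot_ok anc ord0 topv vself J u c dg dt i.
pose P2 (i j : 'I_J) := [&& dused dg i, dused dg j, i != j & anc (ctopV c dg dt i) (ctopV c dg dt j)].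
rewrite ev_xand ev_xnot ev_xand ev_xnot ev_xeq.
rewrite (ev_xex (N := J) (P := P1)); first last.
- move=> i; have c1 : ctx (upd g 80 i) a by apply: ctx_upd.
  have iJ := ltn_ord i.
  have eW : ev (upd g 80 i) a (xW (XVar 80)) = ctopV c dg dt i by rewrite -aWE.
  have eX : ev (upd g 80 i) a (xX (xsucc (XVar 80))) = leafV c dg dt i.+1.
    by rewrite -[LHS]/(a aX (i + 1)) addn1 aXE.
  rewrite ev_xand ev_xnot /P1; congr (_ && ~~ _).
  rewrite !ev_xand ev_xor ev_xeq !ev_xnot eW (ev_xancb c1 ta eW eX) (@ev_xancb _ _ c1 ta (XVar rU) _ u _ gU eW).
  rewrite (@ev_xancb _ _ c1 ta _ (XVar rC) _ c eW gC) (@ev_xancb _ _ c1 ta (XVar rC) _ c _ gC eW) /slot_ok /=.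
  by rewrite -[upd _ _ _ rU]/(g rU) -[upd _ _ _ rC]/(g rC) gU gC.
- exact: cJ cg.
rewrite (ev_xex (N := J) (P := fun i => [exists j, P2 i j])); first last.
- move=> i; have c1 : ctx (upd g 80 i) a by apply: ctx_upd.
  apply: ev_xex => [|j]; first exact: cJ c1.
  have c2 : ctx (upd (upd g 80 i) 81 j) a by apply: ctx_upd.
  rewrite !ev_xand ev_xnot ev_xeq (@ev_xancb _ _ c2 ta _ _ (ctopV c dg dt i) (ctopV c dg dt j)) //.
    by rewrite -aWE.
  by rewrite -aWE.
- exact: cJ cg.
have E3 : ev g a (XSum 80 rJ (XIte (xused (XVar 80)) (XAdd (XAdd (XLit 1) (xdbel (XVar 80))) (xdbes (XVar 80))) (XLit 0)))
    = \sum_(i < J | dused dg i) (1 + dbel J dg i + dbes J dg i).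
  rewrite (ev_xsum (N := J) (f := fun i : 'I_J => if dused dg i then 1 + dbel J dg i + dbes J dg i else 0)).
  - by rewrite -big_mkcond.
  - exact: cJ cg.
  - by move=> i; rewrite /= /upd /= -[g 3]/(g rJ) (cJ cg).
rewrite E3 -[ev g a (XVar rS)]/(g rS) gS.
split=> [/and3P[/existsPn h1 /existsPn h2 /eqP h3]|[h1 h2 h3]].
  split=> // [i ui|i j ui uj ij].
    by have := h1 i; rewrite /P1 ui negbK.
  by have := h2 i => /existsPn/(_ j); rewrite /P2 ui uj ij.
apply/and3P; split; last exact/eqP.
  by apply/existsPn => i; apply/negP => /andP[ui /negP]; apply; exact: h1.
apply/existsPn => i; apply/existsPn => j; apply/negP => /and4P[ui uj ij h].
by have := h2 i j ui uj ij; rewrite h.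
Qed.

End Valid.

End Guesses.

(** * Capacities and augmentation *)

Section Flow.
Variables (n : nat) (G : multigraph n.+1) (T : {set edge G}) (J lam : nat).
Local Notation V := 'I_n.+1.
Local Notation N := (n.+1).
Local Notation ctx := (ctx T J lam).
Local Notation treeok := (@treeok n G).
Variables (par : V -> V) (rk : V -> nat).
Hypothesis par0 : par ord0 = ord0.
Hypothesis rk_par : forall y, y != ord0 -> rk (par y) < rk y.
Hypothesis JN : J < N.
Local Notation anc := (ancp par).
Local Notation s1 := (@e1 n G).
Local Notation s2 := (@e2 n G).
Local Notation stat := (stat T J lam par).
Local Notation topV := (topv G lam par).
Local Notation vselV := (vself G par).
Local Notation leafV := (leaf topV vselV J).
Local Notation ctopV := (ctop topV vselV J).

Lemma eq_ordE m (x y : 'I_m) : ((x : nat) == (y : nat)) = (x == y).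
Proof. by []. Qed.

Lemma ev_xadd g a e f : ev g a (XAdd e f) = ev g a e + ev g a f. Proof. by []. Qed.

Lemma fill2 s x y a e (f : V -> V -> nat) : ctx (rg s) (ar s) -> x < 70 -> y < 70 ->
  (x \notin cregs) && (y \notin cregs) && (x != y) -> a \notin carrs ->
  (forall s' (u v : V), fr [:: x; y] [:: a] s s' -> rg s' x = u -> rg s' y = v -> evs s' e = f u v) ->
  let s' := run (CFor x rN (CFor y rN (CSto a (xidx (XVar x) (XVar y)) e))) s in
  forall u v : V, ar s' a (u * N + v) = f u v.
Proof.
move=> c x7 y7 /andP[/andP[xc yc] xy] ac h /=.
pose I i s' := forall u v : V, u < i -> ar s' a (u * N + v) = f u v.
suff : I N (run (CFor x rN (CFor y rN (CSto a (xidx (XVar x) (XVar y)) e))) s) by move=> H u v; exact: H.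
have ok z : z \in [:: x; y] -> z \notin cregs by rewrite in_cons mem_seq1 => /orP[]/eqP->.
have hasr : ~~ has (mem [:: x; y]) cregs.
  by apply/hasPn => z zc; apply/negP => /ok; rewrite zc.
have hasa : ~~ has (mem [:: a]) carrs.
  by apply/hasPn => z zc; rewrite /= mem_seq1; apply: contra ac => /eqP <-.
apply: (@run_for I _ _ _ _ _ (cN c)) => // i t iN ft ti It.
have ft' : fr [:: x; y] [:: a] s t := ft.
have ct : ctx (rg t) (ar t) by apply: ctx_fr ft' _ _ c.
pose K j s' := forall u v : V, (u < i) || (u == i :> nat) && (v < j) -> ar s' a (u * N + v) = f u v.
suff H : K N (run (CFor y rN (CSto a (xidx (XVar x) (XVar y)) e)) t).
  move=> u v; rewrite ltnS leq_eqVlt => ui; rewrite [LHS]H // ltn_ord andbT orbC //.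
apply: (@run_for K _ _ _ _ _ (cN ct)).
  by move=> u v; rewrite ltn0 andbF orbF => ui; exact: It.
move=> j t' jN ft2 tj Kj u v huv.
have ft2' : fr [:: x; y] [:: a] s t'.
  apply: fr_trans ft' _; apply: fr_sub ft2 _ _ => z //=.
  by rewrite !inE => ->; rewrite orbT.
have ct' : ctx (rg t') (ar t') by apply: ctx_fr ft2' _ _ c.
have ti' : rg t' x = i by rewrite ft2.1 // inE (negbTE xy).
pose oi := Ordinal iN; pose oj := Ordinal jN.
rewrite -[LHS]/(if (a == a) && (u * N + v == evs t' (xidx (XVar x) (XVar y))) then evs t' e else ar t' a (u * N + v)).
rewrite /evs (@ev_xidx _ _ _ _ _ _ _ ct' _ _ oi oj) // eqxx andTb idx2_inj.
have [/andP[/eqP -> /eqP ->]|ne] := boolP ((u == oi) && (v == oj)); first exact: h.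
apply: Kj; case/orP: huv => [->//|/andP[ui vj]]; rewrite ui /=.
have ev : u = oi by apply/val_inj/eqP.
move: ne; rewrite ev eqxx /= -val_eqE /= => ne.
by move: vj; rewrite ltnS leq_eqVlt (negbTE ne) /= => ->; rewrite orbT.
Qed.

(** For [s <= J] the hypothesis [JN] keeps [s * N + u] below [N * N], the range in which [aROW] is
    tabulated. *)
Definition Nix s (u v : V) := (s * N + u) * N + v.

Lemma ev_xN g a e f h ss (u v : V) : ctx g a -> ss <= J -> ev g a e = ss -> ev g a f = u -> ev g a h = v ->
  ev g a (xN e f h) = a aN (Nix ss u v).
Proof.
move=> c sJ he hf hh; rewrite -[LHS]/(a aN (a aROW (a aROW (ev g a e) + ev g a f) + ev g a h)) he hf hh.
have -> : a aROW ss = ss * N by rewrite (cROW c) //; nia.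
by rewrite (cROW c) //; have := ltn_ord u; nia.
Qed.

Section Cap.
Variables (c : V) (dg dt : nat -> nat) (AV : {set V}) (Nf : nat -> V -> V -> nat).
Let used i := dused dg i.
Let w i := ctopV c dg dt i.
Let x i := leafV c dg dt i.+1.
Definition psif i (v : V) := if v \in AV then
   (if (v == w i) && (dbes J dg i != 0) then lam.+1 else Nf (dbel J dg i) v v + Nf (dbes J dg i) (w i) v)
  else lam.+1.
Hypothesis wx : forall i, i < J -> used i -> anc (w i) (x i).
Hypothesis w_root : forall i, i < J -> used i -> w i != ord0.
Hypothesis w_anti : forall i j, i < J -> j < J -> used i -> used j -> i != j -> ~~ anc (w i) (w j).
Hypothesis dsm : forall i, i < J -> used i -> dbel J dg i <= J /\ dbes J dg i <= J.
Local Notation chnV := (chn anc J used w).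
Definition capV := capf s1 s2 anc ord0 par (@nat_of_ord N) J used w x c lam.+1 psif.

Let atot := @ancp_tot n par.

Record capst (s : st) : Prop := Capst {
  ksd : forall i, ar s aD2 i = dg i; ksC : rg s rC = c;
  ksX : forall i, i <= J -> ar s aX i = leafV c dg dt i;
  ksW : forall i, i < J -> ar s aW i = w i;
  ksA : forall v : V, (ar s aAV v != 0) = (v \in AV);
  ksN : forall ss (u v : V), ss <= J -> ar s aN (Nix ss u v) = Nf ss u v }.

Lemma capst_fr rs sa s s' : fr rs sa s s' -> rC \notin rs -> ~~ has (mem sa) [:: aD2; aX; aW; aAV; aN] ->
  capst s -> capst s'.
Proof.
move=> [f1 f2] h1 /hasPn h2 [*]; have h3 b : b \in [:: aD2; aX; aW; aAV; aN] -> b \notin sa by exact: h2.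
by split=> *; rewrite ?f1 ?f2 ?h3 ?inE ?eqxx ?orbT //; auto.
Qed.

Lemma ev_xCHe s (v : V) : stat s -> capst s ->
  forall g a, (forall r, r < 70 -> r != 33 -> g r = rg s r) -> (forall b i, b != aCH -> a b i = ar s b i) -> g 33 = v ->
  ev g a (XSum 80 rJ (XIte (xand (xused (XVar 80)) (xanc (xW (XVar 80)) (XVar 33))) (xsucc (XVar 80)) (XLit 0))) = chnV v.
Proof.
move=> [cs ts] k g a hg ha gv.
have cg : ctx g a.
  apply: ctx_ext cs => [r hr|b i hb]; last by apply: ha; apply: contraTneq hb => ->.
  by apply: hg; move: hr; rewrite !inE; lia.
have tg : treeok par a by case: ts => *; split=> *; rewrite ha.
apply: ev_xsum => [|i]; first exact: cJ cg.
have c1 : ctx (upd g 80 i) a by apply: ctx_upd.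
have eW : ev (upd g 80 i) a (xW (XVar 80)) = w i by rewrite -[LHS]/(a aW i) ha // (ksW k).
rewrite ev_ite ev_xand (@ev_xancb _ _ _ _ _ _ _ _ c1 tg _ (XVar 33) _ v eW) //.
rewrite -[ev _ _ (xused _)]/(a aD2 i) ha // (ksd k) -[ev _ _ (xsucc _)]/(i + 1) addn1.
by [].
Qed.

Lemma ev_xcap g a (u v : V) s : stat s -> capst s -> (forall v : V, ar s aCH v = chnV v) ->
  (forall r, r < 70 -> r \notin [:: 33; 34] -> g r = rg s r) -> (forall b i, b != aR -> a b i = ar s b i) ->
  g 33 = u -> g 34 = v -> ev g a (xcap (XVar 33) (XVar 34)) = capV u v.
Proof.
move=> [cs ts] k hC hg ha gu gv.
have cg : ctx g a.
  apply: ctx_ext cs => [r hr|b i hb]; last by apply: ha; apply: contraTneq hb => ->.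
  by apply: hg; move: hr; rewrite !inE; lia.
have tg : treeok par a by case: ts => *; split=> *; rewrite ha.
have eC g' e (z : V) : ev g' a e = z -> ev g' a (xCH e) = chnV z by move=> h; rewrite -[LHS]/(a aCH (ev g' a e)) h ha.
have eP g' e (z : V) : ev g' a e = z -> ev g' a (XArr aPAR e) = par z by move=> h; rewrite -[LHS]/(a aPAR (ev g' a e)) h (tP tg).
have gc : g rC = c by rewrite hg // (ksC k).
have same_ev g' e f (y z : V) : ctx g' a -> g' rC = c -> ev g' a e = y -> ev g' a f = z ->
    (ev g' a (xsame e f) != 0) = same anc c y z.
  move=> c1 gc1 h1 h2; rewrite ev_xeq (@ev_xanc _ _ _ _ _ _ _ _ c1 tg (XVar rC) _ c y) // (@ev_xanc _ _ _ _ _ _ _ _ c1 tg (XVar rC) _ c z) //.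
  by rewrite /same; case: (anc c y); case: (anc c z).
have eA e f (y z : V) : ev g a e = y -> ev g a f = z -> ev g a (xA e f) = mult s1 s2 y z.
  by move=> h1 h2; apply: (ev_xA cg).
rewrite /capV /capf /xcap ev_ite (eC _ (XVar 33) u) //.
rewrite if_neg; case: ifP => [//|/negbT nz]; rewrite !ev_xadd.
have [i [iJ ui wu ci]] := chnP atot w_anti nz.
have ci' : (chnV u).-1 = i by rewrite ci.
have eu : ev g a (XVar 33) = u by [].
have ev' : ev g a (XVar 34) = v by [].
have ei : ev g a (xpred (xCH (XVar 33))) = i.
  by rewrite -[LHS]/(ev g a (xCH (XVar 33)) - 1) (eC _ _ u) // ci subn1.
have eW : ev g a (xW (xpred (xCH (XVar 33)))) = w i.
  by rewrite -[LHS]/(a aW (ev g a (xpred (xCH (XVar 33))))) ei ha // (ksW k).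
have eX : ev g a (xX (xCH (XVar 33))) = x i.
  by rewrite -[LHS]/(a aX (ev g a (xCH (XVar 33)))) (eC _ _ u) // ci ha // (ksX k).
have gJ := cJ cg.
have ebel : ev g a (xdbel (xpred (xCH (XVar 33)))) = dbel J dg i.
  rewrite -[LHS]/(a aD2 (g rJ + (g rJ + (g rJ + (g rJ + ev g a (xpred (xCH (XVar 33)))))))) ei gJ ha //.
  by rewrite (ksd k).
have ebes : ev g a (xdbes (xpred (xCH (XVar 33)))) = dbes J dg i.
  rewrite -[LHS]/(a aD2 (g rJ + (g rJ + (g rJ + (g rJ + (g rJ + ev g a (xpred (xCH (XVar 33))))))))) ei gJ ha //.
  by rewrite (ksd k).
have [d1 d2] := dsm iJ ui.
congr (_ + _ + _ + _).
- rewrite ev_ite ev_xeq ev' (eP _ _ u) // eq_ordE; case: ifP => // _.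
  rewrite ev_ite (@ev_xancb _ _ _ _ _ _ _ _ cg tg _ _ u (x i)) // ci'; case: ifP => // _; last exact: cInf cg.
  rewrite /xpsi ev_ite -[ev g a (XArr aAV _)]/(a aAV (g 33)) gu ha // (ksA k) /psif; case: ifP => // _; last exact: cInf cg.
  rewrite ev_ite ev_xand ev_xeq eu eW ebes eq_ordE; case: ifP => // _; first exact: cInf cg.
  rewrite ev_xadd (@ev_xN _ _ _ _ _ (dbel J dg i) u u cg) // (@ev_xN _ _ _ _ _ (dbes J dg i) (w i) u cg) //.
  by rewrite !ha // !(ksN k).
- rewrite ev_ite ev_xand ev_xeq eu (eP _ _ v) // (eC _ (XVar 34) v) // eq_ordE; case: ifP => // _; exact: cInf cg.
- rewrite ev_ite ev_xand (same_ev _ _ _ u v) // !ev_xor ev_xeq ev_xlt ev_xnot (eC _ (XVar 33) u) // (eC _ (XVar 34) v) // eu ev'.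
  by rewrite negbK; case: ifP => // _; exact: eA.
- rewrite ev_ite ev_xnot ev' negbK (_ : (v == 0 :> nat) = (v == ord0)) //; case: ifP => // _.
  apply: ev_xsum => [|z]; first exact: cN cg.
  have c1 : ctx (upd g 80 z) a by apply: ctx_upd.
  rewrite ev_ite !ev_xand (same_ev _ _ _ u z) // ev_xnot ev_xeq ev_xlt (eC _ (XVar 33) u) // (eC _ (XVar 80) z) //.
  rewrite -[ev _ _ (XVar 33)]/(g 33) gu -[ev _ _ (XVar 80)]/(z : nat).
  by case: ifP => // _; apply: (ev_xA c1).
Qed.

Lemma cap_ok s : stat s -> capst s -> let s' := run cCap s in
  (forall v : V, ar s' aCH v = chnV v) /\ (forall u v : V, ar s' aR (u * N + v) = capV u v).
Proof.
move=> st0 k s'; rewrite {}/s' /cCap run_seq; set t := run (CFor 33 rN _) s.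
have ft : fr [:: 33] [:: aCH] s t by rewrite /t; apply: fr_of.
have stt : stat t by apply: stat_fr ft _ _ st0.
have kt : capst t by apply: capst_fr ft _ _ k.
have hC (v : V) : ar t aCH v = chnV v.
  pose f i := if insub i is Some v then chnV v else 0.
  suff H i : i < N -> ar t aCH i = f i by rewrite H // /f valK.
  move: i; apply: (@fill1 s 33 rN aCH _ N f (cN st0.1) isT) => s' i iN f' si.
  rewrite /f insubT; apply: (ev_xCHe (v := Sub i iN) st0 k) => //.
    by move=> r r7 r33; rewrite f'.1 // mem_seq1.
  by move=> b j hb; rewrite f'.2 // mem_seq1.
split=> [v|]; first by rewrite run_ar.
apply: (fill2 stt.1) => // s' u v f' su sv.
apply: (ev_xcap stt kt hC) => // [r _ hr|b j hb]; first by rewrite f'.1.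
by rewrite f'.2 // mem_seq1.
Qed.

Definition goodV := goodcut anc J used w x.

Definition resid s (R : V -> V -> nat) := forall u v : V, ar s aR (u * N + v) = R u v.

(** If a sink is visited, one unit is pushed along the search tree. The walk ends at a source, so
    every good cut contains that end but not the sink and loses one unit. Otherwise the visited set
    is itself a good cut, of residual value 0. *)
Lemma augment_ok s R : stat s -> capst s -> (forall v : V, ar s aCH v = chnV v) -> resid s R ->
  let s' := run cAugment s in exists R', [/\ resid s' R',
   rg s' 35 = rg s 35 -> exists2 S, goodV S & cutv R' S = 0,
   (rg s' 35 == rg s 35) || (rg s' 35 == (rg s 35).+1) &
   forall S, goodV S -> cutv R' S + rg s' 35 = cutv R S + rg s 35].
Proof.
move=> st0 k hC hR s'; rewrite {}/s' /cAugment !run_seqs run_seqs1.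
set src := fun y : V => (chnV y != 0) && anc (x (chnV y).-1) y.
set t := run (cSearch _ _ _ _) s; set t2 := run (CSet 37 _) t.
have ft : fr [:: 13; 14; 15] [:: aFP; aFV] s t by rewrite /t; apply: fr_of.
have stt : stat t by apply: stat_fr ft _ _ st0.
have [||vs [pr [rk' [[g1 g2 g3 g4 g5] cl]]]] := @search_ok n (fun u v => R u v != 0) src aFP aFV
    (XArr aR (xidx (XVar 13) (XVar 14)))
    (xand (xCH (XVar 14)) (xanc (xX (xCH (XVar 14))) (XVar 14))) s (cN st0.1) isT.
- move=> s' u v f' h1 h2; have c' : ctx (rg s') (ar s') by apply: ctx_fr f' _ _ st0.1.
  rewrite /evs -[ev _ _ (XArr aR _)]/(ar s' aR (ev (rg s') (ar s') (xidx (XVar 13) (XVar 14)))).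
  by rewrite (@ev_xidx _ _ _ _ _ _ _ c' _ _ u v) // f'.2 // hR.
- move=> s' y f' h; have st' : stat s' by apply: stat_fr f' _ _ st0.
  have eC : ev (rg s') (ar s') (xCH (XVar 14)) = chnV y.
    by rewrite -[LHS]/(ar s' aCH (rg s' 14)) h f'.2.
  rewrite /evs ev_xand eC /src; case E0: (chnV y == 0); first by [].
  have nz : chnV y != 0 by rewrite E0.
  rewrite andTb.
  have [i [iJ ui wu ci]] := chnP atot w_anti nz.
  apply: (ev_xancb st'.1 st'.2) => //.
  rewrite -[LHS]/(ar s' aX (ev (rg s') (ar s') (xCH (XVar 14)))) eC ci f'.2 //.
  by rewrite (ksX k).
rewrite -/t in g1 g2 cl.
have srcP y : src y <-> exists i, [/\ i < J, used i & anc (x i) y].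
  split=> [/andP[/(chnP atot w_anti)[i [iJ ui wu ci]]]|[i [iJ ui xy]]].
    by rewrite ci => xy; exists i.
  by rewrite /src (chnE atot w_anti iJ ui (@ancp_trans _ par _ _ _ (wx iJ ui) xy)).
have E37 : rg t2 37 = nthset (fun y : V => (y \in vs) && (chnV y == 0)) 0.
  have es g z (y : V) : (forall r, r < 80 -> g r = rg t r) -> g z = y -> (ev g (ar t) (xsink (XVar z)) != 0) = (y \in vs) && (chnV y == 0).
    move=> hg gz; rewrite ev_xand ev_xnot negbK -[ev _ _ (XArr aFV _)]/(ar t aFV (g z)) -[ev _ _ (xCH _)]/(ar t aCH (g z)).
    by rewrite gz g1 eqb0 negbK ft.2 // hC.
  rewrite -[LHS]/(ev (rg t) (ar t) (xnth xsink (XLit 0))).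
  apply: ev_xnth => [|y|y y'|] //; first exact: cN stt.1.
    by apply: es => // r r8; rewrite upd_lt //; lia.
  by apply: es => // r r8; rewrite !upd_lt //; lia.
set z := nthset _ 0 in E37.
have ft2 : fr [:: 37] [::] t t2 by rewrite /t2; apply: fr_of.
have eS : (evs t2 (xsink (XVar 37)) != 0) = (z \in vs) && (chnV z == 0).
  rewrite /evs ev_xand ev_xnot negbK -[ev _ _ (XArr aFV _)]/(ar t2 aFV (rg t2 37)) -[ev _ _ (xCH _)]/(ar t2 aCH (rg t2 37)).
  by rewrite E37 !ft2.2 // g1 eqb0 negbK ft.2 // hC.
rewrite run_when eS.
have good_vs : ~~ ((z \in vs) && (chnV z == 0)) -> goodV vs.
  move=> nz; split=> [i y iJ ui xy|y yv].
    by have /g3/andP[] : src y by apply/srcP; exists i.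
  apply: contra nz => y0.
  by apply: (@nthset0 n (fun y : V => (y \in vs) && (chnV y == 0)) y); rewrite yv y0.
have [/andP[zv z0]|nz] := boolP ((z \in vs) && (chnV z == 0)); last first.
  exists R; split.
  - by move=> u v; rewrite ft2.2 // ft.2.
  - move=> _; exists vs; first exact: good_vs.
    rewrite /cutv big1 // => -[u v] /= /andP[uv nv]; apply/eqP; apply: contraNT nv => Ruv.
    exact: cl uv Ruv.
  - by rewrite ft2.1 // ft.1 // eqxx.
  - by move=> S _; rewrite ft2.1 // ft.1.
rewrite run_seq; set t3 := run (CSet 35 _) t2; set W := CFor 39 rN _.
have ft3 : fr [:: 35] [::] t2 t3 by rewrite /t3; apply: fr_of.
have stt2 : stat t2 by apply: stat_fr ft2 _ _ stt.
have stt3 : stat t3 by apply: stat_fr ft3 _ _ stt2.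
pose I k' s' := rg s' 37 = (iter k' (wstep pr) (z, R)).1 /\ resid s' (iter k' (wstep pr) (z, R)).2.
have [_ hW] : I N (run W t3).
  apply: (@run_for I _ _ _ _ _ (cN stt3.1)).
    split; first by rewrite -[LHS]/(rg t2 37) E37.
    by move=> u v; rewrite -[LHS]/(ar t2 aR (u * N + v)) ft2.2 // ft.2.
  move=> j s' jN f' sj [I1 I2].
  have st' : stat s' by apply: stat_fr f' _ _ stt3.
  rewrite /I iterS; set zR := iter j (wstep pr) (z, R) in I1 I2 *.
  case: zR I1 I2 => y R' I1 I2; rewrite /= in I1 I2; set B := (X in run X s').
  suff : rg (run B s') 37 = pr y /\ resid (run B s') (wstep pr (y, R')).2 by [].
  rewrite {}/B run_seq.
  set q := run (CSet 40 _) s'.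
  have fq : fr [:: 40] [::] s' q by rewrite /q; apply: fr_of.
  have stq : stat q by apply: stat_fr fq _ _ st'.
  have q40 : rg q 40 = pr y.
    by rewrite -[LHS]/(ar s' aFP (rg s' 37)) I1 f'.2 // -[LHS]/(ar t2 aFP y) ft2.2.
  have q37 : rg q 37 = y by rewrite fq.1.
  have Rq (u v : V) : ar q aR (u * N + v) = R' u v by rewrite fq.2.
  have -> : run (CWhen (xnot (xeq (XVar 40) (XVar 37))) _) q = _ := run_when _ _ _.
  have -> : (evs q (xnot (xeq (XVar 40) (XVar 37))) != 0) = (pr y != y).
    by rewrite /evs ev_xnot ev_xeq; exact: (congr2 (fun i j => i != j) q40 q37).
  have [py|py] := eqVneq (pr y) y; first by rewrite /wstep /= py eqxx; split; [rewrite -[LHS]/(rg q 37) q37|].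
  rewrite !run_seqs run_seqs1; set q1 := run (CSto _ _ _) q; set q2 := run (CSto _ _ _) q1.
  have fq1 : fr [::] [:: aR] q q1 by rewrite /q1; apply: fr_of.
  have fq2 : fr [::] [:: aR] q1 q2 by rewrite /q2; apply: fr_of.
  have stq1 : stat q1 by apply: stat_fr fq1 _ _ stq.
  split; first by rewrite -[LHS]/(rg q2 40) fq2.1 // fq1.1.
  have R1 (u v : V) : ar q1 aR (u * N + v) = if (u == pr y) && (v == y) then R' u v - 1 else R' u v.
    rewrite -[LHS]/(if (aR == aR) && (u * N + v == ev (rg q) (ar q) (xidx (XVar 40) (XVar 37))) then
       ar q aR (ev (rg q) (ar q) (xidx (XVar 40) (XVar 37))) - 1 else ar q aR (u * N + v)).
    rewrite (@ev_xidx _ _ _ _ _ _ _ stq.1 _ _ (pr y) y) // eqxx andTb idx2_inj !Rq.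
    by case: ifP => // /andP[/eqP -> /eqP ->].
  move=> u v; rewrite -[LHS]/(ar q2 aR (u * N + v)).
  rewrite -[LHS]/(if (aR == aR) && (u * N + v == ev (rg q1) (ar q1) (xidx (XVar 37) (XVar 40))) then
       ar q1 aR (ev (rg q1) (ar q1) (xidx (XVar 37) (XVar 40))) + 1 else ar q1 aR (u * N + v)).
  rewrite (@ev_xidx _ _ _ _ _ _ _ stq1.1 _ _ y (pr y)) ?fq1.1 //.
  rewrite eqxx andTb idx2_inj !R1.
  have yp : (y == pr y) = false by rewrite eq_sym; apply/negbTE.
  rewrite /wstep /= (negbTE py) /push; case: ifP => [/andP[/eqP -> /eqP ->]|//].
  by rewrite yp.
have [w1 w2] : let zR := iter N (wstep pr) (z, R) in src zR.1 /\ forall S, cutv zR.2 S + (zR.1 \in S) = cutv R S + (z \in S).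
  apply: (@walk_ok _ pr rk' src (fun y => y \in vs)) => //.
  - by move=> y /g3/andP[].
  - by move=> y /g3/andP[_ /eqP].
  - by move=> y yv ny; have /and3P[h1 _ h2] := g4 y yv ny; rewrite h1 h2.
  - by apply: leq_trans (ltnW (g5 z zv)) _; rewrite -[X in _ <= X](card_ord N); exact: max_card.
  - by move=> y yv ny _; have /and3P[_ h _] := g4 y yv ny; rewrite lt0n.
have e35 : rg (run W t3) 35 = (rg s 35).+1.
  by rewrite run_rg // -[LHS]/(rg t2 35 + 1) ft2.1 // ft.1 // addn1.
exists (iter N (wstep pr) (z, R)).2; split.
- exact: hW.
- by rewrite e35 => /eqP; rewrite eqn_leq ltnn.
- by rewrite e35 eqxx orbT.
- move=> S [gS1 gS2]; have := w2 S; rewrite e35.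
  have -> : z \in S = false by apply: contraTF z0 => /gS2.
  have -> : (iter N (wstep pr) (z, R)).1 \in S by have /srcP[i [iJ ui h]] := w1; apply: gS1 iJ ui h.
  by lia.
Qed.

(** On each good cut, counter plus residual value is constant. A failed round exhibits a cut of
    residual value 0, so no later round can succeed and the counter is the minimum; if no round
    fails the counter ends at [lam.+1]. *)
Lemma flow_ok s : stat s -> capst s -> (forall v : V, ar s aCH v = chnV v) -> resid s capV ->
  let v := rg (run cFlow s) 35 in
  [/\ v <= lam.+1, forall S, goodV S -> v <= cutv capV S &
      v <= lam -> exists2 S, goodV S & cutv capV S = v].
Proof.
move=> st0 k hC hR; rewrite /cFlow run_seq; set t := run (CSet 35 _) s.
have ft : fr [:: 35] [::] s t by rewrite /t; apply: fr_of.
have stt : stat t by apply: stat_fr ft _ _ st0.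
have kt : capst t by apply: capst_fr ft _ _ k.
pose I i s' := exists R, [/\ resid s' R, rg s' 35 <= i,
   rg s' 35 < i -> exists2 S, goodV S & cutv R S = 0
   & forall S, goodV S -> cutv R S + rg s' 35 = cutv capV S].
have : I lam.+1 (run (CFor 36 rInf cAugment) t).
  apply: (@run_for I _ _ _ _ _ (cInf stt.1)).
    by exists capV; split=> // S _; rewrite -[rg _ 35]/0 addn0.
  move=> i s' iL f' si [R [r1 r2 r3 r4]].
  have st' : stat s' by apply: stat_fr f' _ _ stt.
  have k' : capst s' by apply: capst_fr f' _ _ kt.
  have hC' (v : V) : ar s' aCH v = chnV v by rewrite f'.2 // ft.2.
  have [R' [p1 p2 p3 p4]] := augment_ok st' k' hC' r1.
  exists R'; split=> //.
  - by rewrite -[rg _ 35]/(rg (run cAugment s') 35); case/orP: p3 => /eqP ->; [exact: leqW|].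
  - rewrite -[rg _ 35]/(rg (run cAugment s') 35); case/orP: p3 => /eqP e; first by move=> _; exact: p2.
    rewrite e ltnS => lt; have [S gS c0] := r3 lt.
    by have := p4 S gS; rewrite c0 e; lia.
  - by move=> S gS; rewrite -[rg _ 35]/(rg (run cAugment s') 35) p4 // r4.
move=> [R [r1 r2 r3 r4]]; set v := rg _ 35 in r2 r3 r4 *; split=> // [S gS|vl].
  by rewrite -(r4 S gS) leq_addl.
have [|S gS c0] := r3; first by rewrite ltnS.
by exists S => //; rewrite -(r4 S gS) c0.
Qed.

End Cap.
End Flow.

(** * The table of optimal values *)

Section Table.
Variables (n : nat) (G : multigraph n.+1) (T : {set edge G}) (J lam : nat).
Local Notation V := 'I_n.+1.
Local Notation N := (n.+1).
Local Notation ctx := (ctx T J lam).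
Local Notation treeok := (@treeok n G).
Variables (par : V -> V) (rk : V -> nat).
Hypothesis par0 : par ord0 = ord0.
Hypothesis rk_par : forall y, y != ord0 -> rk (par y) < rk y.
Hypothesis JN : J < N.
Local Notation anc := (ancp par).
Local Notation s1 := (@e1 n G).
Local Notation s2 := (@e2 n G).
Local Notation stat := (stat T J lam par).
Local Notation topV := (topv G lam par).
Local Notation vselV := (vself G par).
Local Notation leafV := (leaf topV vselV J).
Local Notation ctopV := (ctop topV vselV J).
Local Notation DXV := (DX s1 s2 anc).
Local Notation DD := (D s1 s2 anc).
Local Notation okV := (okv s1 s2 anc ord0 lam).
Local Notation CertV := (Cert s1 s2 anc ord0 lam topV vselV J).

Let arefl := ancp_refl par.
Let atrans := @ancp_trans n par.
Let aanti := ancp_anti par0 rk_par.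
Let atot := @ancp_tot n par.
Let aroot := ancp_root rk_par.
Let apar := @ancp_par n par.
Let alt := @ancp_lt n par rk par0 rk_par.

Variable A : {set V}.
Hypothesis Aok : {in A, forall v, okV v}.

Definition isN s u c x := [/\ x <= lam.+1,
  x <= lam -> exists X v, [/\ CertV s u c X v, X \subset A & v <= x] &
  forall X v, CertV s u c X v -> X \subset A -> x <= v].

Definition avail (s : st) := forall v : V, (ar s aAV v != 0) = (v \in A).

Lemma DXe_DX (X : {set V}) : DXe s1 s2 anc X = DXV X.
Proof.
apply/setP => e; rewrite inE; apply/exists_inP/bigcupP => [[f h1 h2]|[f h1 h2]]; exists f => //.
  by rewrite inE.
by move: h2; rewrite inE.
Qed.

Definition ofI (p : 'I_J -> V) i := if insub i is Some o then p o else ord0.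
Lemma ofIE p (i : 'I_J) : ofI p i = p i. Proof. by rewrite /ofI valK. Qed.

Lemma pfront_ofI dg p : pfront J (dused dg) (ofI p) = front dg p.
Proof. by apply: eq_imset => i; rewrite ofIE. Qed.

(* The certificates which a given guess accounts for. *)
Definition built s u c dg dt X v := exists p XB XG vB vG, [/\
  (forall i : 'I_J, dused dg i -> on_chain s1 s2 anc ord0 lam topV vselV J c dg dt i (p i)),
  (forall i : 'I_J, dused dg i -> CertV (dbel J dg i) (p i) (p i) (XB i) (vB i)),
  (forall i : 'I_J, dused dg i -> CertV (dbes J dg i) (ctopV c dg dt i) (p i) (XG i) (vG i)),
  valid anc ord0 topV vselV J s u c dg dt /\
  X = \bigcup_(i < J | dused dg i) (p i |: (XB i :|: XG i)) &
  v = #|DXV (front dg p) :\: DD c| + \sum_(i < J | dused dg i) (vB i + vG i)].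

(** A cut of value at most [lam] gives positions, and the smaller cells supply cuts below and beside
    them, together a certificate. Conversely a certificate for this guess gives a good cut that is
    not more expensive. *)
Lemma try_ok s ss (u c : V) : stat s -> avail s -> rg s rS = ss -> rg s rU = u -> rg s rC = c ->
  0 < ss -> ss < J ->
  guess_ok lam J (ar s aD2) (ar s aD3) ->
  (forall s' (u' c' : V), s' < ss -> anc u' c' -> isN s' u' c' (ar s aN (Nix s' u' c'))) ->
  let b := rg (run cTry s) rBest in
  [/\ b <= rg s rBest,
    b < rg s rBest -> b <= lam -> exists X v, [/\ CertV ss u c X v, X \subset A & v <= b] &
    forall X v, built ss u c (ar s aD2) (ar s aD3) X v -> X \subset A -> rg s rBest <= lam.+1 -> b <= v].
Proof.
move=> st0 av hS hU hC ss0 ssJ gd IH; rewrite /cTry run_seq.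
set dg := ar s aD2 in gd *; set dt := ar s aD3 in gd *.
have gdJ i : i < 6 * J -> dg i <= J by move=> /gd.1.
have [hX hW] := leaves_ok st0 hC gdJ.
set t := run cLeaves s in hX hW *.
have ft : fr [:: 27; 30; 31; 32] [:: aX; aW] s t by rewrite /t; apply: fr_of.
have stt : stat t by apply: stat_fr ft _ _ st0.
have tdg : ar t aD2 = dg by rewrite /t; case: ft => _ h; apply: functional_extensionality => i; rewrite h.
have tdt : ar t aD3 = dt by case: ft => _ h; apply: functional_extensionality => i; rewrite h.
have tB : rg t rBest = rg s rBest by rewrite ft.1.
have hv : (evs t xvalid != 0) <-> valid anc ord0 topV vselV J ss u c dg dt.
  rewrite -tdg -tdt; apply: (ev_xvalid stt.1 stt.2); rewrite ?ft.1 // tdg tdt //.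
rewrite run_when; case: ifP => [/hv va|nv]; last first.
  split; rewrite ?tB ?ltnn // => X v [p [XB [XG [vB [vG [_ _ _ [va _] _]]]]]].
  by move/hv: va; rewrite nv.
have [va1 va2 va3] := va.
pose w i := ctopV c dg dt i; pose x i := leafV c dg dt i.+1.
have wx i : i < J -> dused dg i -> anc (w i) (x i).
  by move=> iJ ui; have /and5P[] := va1 (Ordinal iJ) ui.
have w_root i : i < J -> dused dg i -> w i != ord0.
  by move=> iJ ui; have /and5P[] := va1 (Ordinal iJ) ui.
have w_anti i j : i < J -> j < J -> dused dg i -> dused dg j -> i != j -> ~~ anc (w i) (w j).
  by move=> iJ jJ ui uj ij; apply: (va2 (Ordinal iJ) (Ordinal jJ)).
have dlt i : i < J -> dused dg i -> dbel J dg i < ss /\ dbes J dg i < ss.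
  move=> iJ ui; rewrite -va3 (bigD1 (Ordinal iJ)) //=; lia.
have dsm i : i < J -> dused dg i -> dbel J dg i <= J /\ dbes J dg i <= J.
  by move=> iJ ui; have [] := dlt i iJ ui; lia.
pose Nf s' (u' v' : V) := ar s aN (Nix s' u' v').
have kt : capst G J lam par c dg dt A Nf t.
  split=> [i||i iJ|i iJ|v|*]; first by rewrite tdg.
  - by rewrite ft.1.
  - exact: hX.
  - exact: hW.
  - by rewrite ft.2.
  - by rewrite ft.2.
rewrite !run_seqs run_seqs1; set t1 := run cCap t; set t2 := run cFlow t1.
have ft1 : fr [:: 33; 34] [:: aCH; aR] t t1 by rewrite /t1; apply: fr_of.
have stt1 : stat t1 by apply: stat_fr ft1 _ _ stt.
have kt1 : capst G J lam par c dg dt A Nf t1 by apply: capst_fr ft1 _ _ kt.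
have [hCH hR] := cap_ok JN w_anti dsm stt kt.
have [v1 v2 v3] := flow_ok JN wx w_anti stt1 kt1 hCH hR.
rewrite -/t2 in v1 v2 v3.
set v := rg t2 35 in v1 v2 v3.
have t2B : rg t2 rBest = rg s rBest by rewrite -tB /t2 /t1 !run_rg.
have -> : rg (run (cMin rBest 35) t2) rBest = minn (rg s rBest) v.
  rewrite /cMin run_when /evs ev_xlt -[ev _ _ (XVar 35)]/v -[ev _ _ (XVar rBest)]/(rg t2 rBest) t2B.
  by case: ltnP => // _; rewrite -[LHS]/(rg t2 rBest) t2B.
split; first exact: geq_minl.
  have [_|vb _ vl] := leqP (rg s rBest) v; first by rewrite ltnn.
  have [S gS cS] := v3 vl.
  have cl : cutv (capV G J lam par c dg dt A Nf) S < lam.+1 by rewrite cS ltnS.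
  have [p [p1 p2 ES]] := cut_structure arefl atrans aanti atot aroot apar alt wx w_root w_anti (ltn0Sn lam) gS cl.
  move: cl cS; rewrite ES /capV (cut_positions _ _ arefl atrans aanti atot aroot apar alt val_inj _ _ w_root w_anti (ltn0Sn lam) p1 p2).
  rewrite DXe_DX => cl cS.
  pose q (i : 'I_J) := p i.
  have Eq : pfront J (dused dg) p = front dg q by apply: eq_imset.
  rewrite {}Eq in cl cS.
  (* A sum of at most [lam] leaves no room for an infinite term, so every position is available and
     not in the exceptional case of [psif]. *)
  have ps (i : 'I_J) : dused dg i -> psif G J lam par c dg dt A Nf i (q i) <= lam.
    by move=> ui; move: cl; rewrite (bigD1 i) //= ltnS; rewrite /q; lia.
  have qq (i : 'I_J) : dused dg i -> [/\ q i \in A, on_chain s1 s2 anc ord0 lam topV vselV J c dg dt i (q i) &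
      psif G J lam par c dg dt A Nf i (q i) = Nf (dbel J dg i) (q i) (q i) + Nf (dbes J dg i) (w i) (q i)].
    move=> ui; have := ps i ui; rewrite /psif; case: ifP; last by lia.
    move=> qA; case: ifP => [_|/negbT]; first by lia.
    rewrite negb_and negbK eq_sym => h _; split=> //.
    by rewrite /on_chain (p1 i) // (p2 i) // Aok.
  have ex (i : 'I_J) : exists XX : {set V} * {set V} * nat * nat, dused dg i ->
     [/\ CertV (dbel J dg i) (q i) (q i) XX.1.1.1 XX.1.2, CertV (dbes J dg i) (w i) (q i) XX.1.1.2 XX.2,
       q i |: (XX.1.1.1 :|: XX.1.1.2) \subset A & XX.1.2 + XX.2 <= psif G J lam par c dg dt A Nf i (q i)].
    have [ui|] := boolP (dused dg i); last by exists (set0, set0, 0, 0).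
    have [qA ch E] := qq i ui; have [d1 d2] := dlt i (ltn_ord i) ui.
    have le := ps i ui; rewrite E in le *.
    have [_ h1 _] := IH _ (q i) (q i) d1 (arefl _).
    have [_ h2 _] := IH _ (w i) (q i) d2 (p1 i (ltn_ord i) ui).
    have [|X1 [w1 [c1 b1 e1]]] := h1; first by rewrite -/(Nf _ _ _); lia.
    have [|X2 [w2 [c2 b2 e2]]] := h2; first by rewrite -/(Nf _ _ _); lia.
    exists (X1, X2, w1, w2) => _; split=> //=; last by rewrite leq_add.
    by rewrite !subUset sub1set qA b1 b2.
  have [f fP] := fin_all_exists ex.
  exists (\bigcup_(i < J | dused dg i) (q i |: ((f i).1.1.1 :|: (f i).1.1.2))),
    (#|DXV (front dg q) :\: DD c| + \sum_(i < J | dused dg i) ((f i).1.2 + (f i).2)); split.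
  - apply: (CertS (dg := dg) (dt := dt) (p := q)) => // i ui; first by have [_ ] := qq i ui.
      by have [] := fP i ui.
    by have [] := fP i ui.
  - by apply/bigcupsP => i ui; have [] := fP i ui.
  - by rewrite -cS addnC leq_add2r; apply: leq_sum => i ui; have [] := fP i ui.
move=> X v0 [p [XB [XG [vB [vG [pc cB cG [_ EX] ->]]]]]] XA _.
have p1 i : i < J -> dused dg i -> anc (w i) (ofI p i).
  by move=> iJ ui; have /and4P[h _ _ _] := pc (Ordinal iJ) ui; rewrite (ofIE p (Ordinal iJ)).
have p2 i : i < J -> dused dg i -> anc (ofI p i) (x i).
  by move=> iJ ui; have /and4P[_ h _ _] := pc (Ordinal iJ) ui; rewrite (ofIE p (Ordinal iJ)).
have gS := psub_good atrans atot w_anti p1 p2.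
apply: leq_trans (geq_minr _ _) _; apply: leq_trans (v2 _ gS) _.
rewrite /capV (cut_positions _ _ arefl atrans aanti atot aroot apar alt val_inj _ _ w_root w_anti (ltn0Sn lam) p1 p2).
rewrite addnC DXe_DX pfront_ofI; apply: leq_add; first by [].
apply: leq_sum => i ui; rewrite ofIE /psif.
have iX : p i |: (XB i :|: XG i) \subset A.
  by apply: subset_trans XA; rewrite EX; exact: (bigcup_sup i).
have /and4P[c1 c2 c3 c4] := pc i ui.
have [d1 d2] := dlt i (ltn_ord i) ui.
have pA : p i \in A by apply: (subsetP iX); rewrite in_setU1 eqxx.
rewrite pA eq_sym (negbTE (_ : ~~ ((ctopV c dg dt i == p i) && (dbes J dg i != 0)))); last first.
  by rewrite negb_and negbK.
have [_ _ h1] := IH _ (p i) (p i) d1 (arefl _).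
have [_ _ h2] := IH _ (ctopV c dg dt i) (p i) d2 c1.
apply: leq_add.
  apply: (h1 _ _ (cB i ui)); apply: subset_trans iX; apply/subsetP => y; rewrite !inE => ->; exact: orbT.
by apply: (h2 _ _ (cG i ui)); apply: subset_trans iX; apply/subsetP => y; rewrite !inE => ->; rewrite !orbT.
Qed.

(** The loop rule for enumerating all digit strings: the array holds the digits of m at turn m. *)
Lemma odometer (K : nat -> st -> Prop) x r d l b body s L B :
  rg s l = L -> rg s b = B -> rg s r = B ^ L ->
  [&& x != l, x != b, l \notin [:: 19; 20], b \notin [:: 19; 20], l \notin wrC body, b \notin wrC body & d \notin waC body] ->
  (forall i, i < L -> ar s d i = 0) -> K 0 (setr s x 0) ->
  (forall m s', m < B ^ L -> fr (x :: wrC (CSeq body (cInc d l b))) (waC (CSeq body (cInc d l b))) s s' -> rg s' x = m ->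
     (forall i, i < L -> ar s' d i = digit B m i) -> K m s' ->
     K m.+1 (setr (run (cInc d l b) (run body s')) x m.+1)) ->
  K (B ^ L) (run (CFor x r (CSeq body (cInc d l b))) s).
Proof.
move=> sl sb sr /and4P[xl xb]; rewrite !inE !negb_or => /andP[l1 l2] /and4P[/andP[b1 b2] lw bw dw] d0 K0 KS.
pose K' m s' := (forall i, i < L -> ar s' d i = digit B m i) /\ K m s'.
suff [] : K' (B ^ L) (run (CFor x r (CSeq body (cInc d l b))) s) by [].
apply: (@run_for K' x r _ s _ sr).
  by split=> // i iL; rewrite -[LHS]/(ar s d i) d0 // /digit div0n mod0n.
move=> m s' mM f' sx [hd hK]; split; last exact: KS.
move=> i iL; rewrite -[LHS]/(ar (run (cInc d l b) (run body s')) d i).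
have hn z : z \notin wrC body -> x != z -> z != 19 -> z != 20 -> z \notin (x :: wrC (CSeq body (cInc d l b))).
  by move=> h1 h2 h3 h4; rewrite inE eq_sym negb_or h2 /= mem_cat negb_or h1 /= !inE !negb_or h3 h4.
have LB : (L == 0) || (0 < B) by rewrite orbC -expn_gt0; case: (B ^ L) mM.
apply: (inc_ok (L := L) (B := B)) => //; rewrite ?run_rg ?f'.1 //; try exact: hn.
by move=> j jL; rewrite run_ar // hd.
Qed.

Section Cell.
Variables (ss : nat) (u c : V).
Hypothesis ss0 : 0 < ss.
Hypothesis ssJ : ss < J.

Record tst s : Prop := Tst { tst_stat : stat s; tst_av : avail s;
  tst_S : rg s rS = ss; tst_U : rg s rU = u; tst_C : rg s rC = c;
  tst_N : forall s' (u' c' : V), s' < ss -> anc u' c' -> isN s' u' c' (ar s aN (Nix s' u' c')) }.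

Lemma tst_fr rs sa s s' : fr rs sa s s' -> ~~ has (mem rs) (cregs ++ [:: rS; rU; rC]) ->
  ~~ has (mem sa) [:: aROW; aIN; aPAR; aANC; aDEG; aAV; aN] -> tst s -> tst s'.
Proof.
move=> f; rewrite has_cat negb_or => /andP[h1 /hasPn h2] h3 [a1 a2 a3 a4 a5 a6].
have /hasPn h3' := h3.
have rr r : r \in [:: rS; rU; rC] -> rg s' r = rg s r by move=> h; rewrite f.1 //; exact: h2.
have aa a i : a \in [:: aAV; aN] -> ar s' a i = ar s a i.
  by move=> h; rewrite f.2 //; apply: h3'; move: h; rewrite !inE => /orP[] ->; rewrite ?orbT.
split; rewrite ?rr //; last by move=> *; rewrite aa //; exact: a6.
  by apply: stat_fr f h1 _ a1; apply/hasPn => a ha; apply: h3'; rewrite -[[:: aROW; aIN; aPAR; aANC; aDEG; aAV; aN]]/([:: aROW; aIN; aPAR; aANC; aDEG] ++ [:: aAV; aN]) mem_cat ha.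
by move=> v; rewrite aa // a2.
Qed.

Definition good b := b <= lam.+1 /\ (b <= lam -> exists X v, [/\ CertV ss u c X v, X \subset A & v <= b]).

Lemma leaf_ext dg dg' dt dt' i : (forall i, i < 6 * J -> dg i = dg' i) -> (forall i, i < J -> dt i = dt' i) ->
  leafV c dg dt i = leafV c dg' dt' i.
Proof.
move=> hg ht; rewrite /leaf; congr nth.
suff H m : m <= J -> xsq topV vselV J c dg dt m = xsq topV vselV J c dg' dt' m by exact: H.
elim: m => //= m IH mJ; rewrite IH; last exact: ltnW.
rewrite /src /da /db ht // !hg //; lia.
Qed.

(** Transfers a certificate from arbitrary guess functions to the digits of the number that encodes
    them. *)
Lemma built_ext dg dg' dt dt' X v : (forall i, i < 6 * J -> dg i = dg' i) -> (forall i, i < J -> dt i = dt' i) ->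
  built ss u c dg dt X v -> built ss u c dg' dt' X v.
Proof.
move=> hg ht.
have eL := leaf_ext _ hg ht.
have eU (i : 'I_J) : dused dg i = dused dg' i by rewrite /dused hg //; have := ltn_ord i; lia.
have eB (i : 'I_J) : dbel J dg i = dbel J dg' i by rewrite /dbel hg //; have := ltn_ord i; lia.
have eG (i : 'I_J) : dbes J dg i = dbes J dg' i by rewrite /dbes hg //; have := ltn_ord i; lia.
have eW (i : 'I_J) : ctopV c dg dt i = ctopV c dg' dt' i.
  by rewrite /ctop !eL /dp hg //; have := ltn_ord i; lia.
move=> [p [XB [XG [vB [vG [h1 h2 h3 [[v1 v2 v3] ->] ->]]]]]].
exists p, XB, XG, vB, vG; split.
- by move=> i ui; have := h1 i; rewrite /on_chain eU eW eL eG; exact.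
- by move=> i ui; have := h2 i; rewrite eU eB; exact.
- by move=> i ui; have := h3 i; rewrite eU eG eW; exact.
- split; last by apply: eq_bigl.
  split.
  + by move=> i ui; have := v1 i; rewrite /slot_ok eU eW eL; exact.
  + by move=> i j ui uj; have := v2 i j; rewrite !eU !eW; exact.
  + by rewrite -v3; apply: eq_big => // i _; rewrite eB eG.
- congr (_ + _); last exact: eq_bigl.
  congr (#|DXV _ :\: _|); apply/setP => y; apply/imsetP/imsetP => -[i]; rewrite inE => ui ->; exists i => //.
    by rewrite inE -eU.
  by rewrite inE eU.
Qed.

Lemma inner_ok s : tst s -> (forall i, i < 6 * J -> ar s aD2 i < J.+1) -> good (rg s rBest) ->
  let b := rg (run (CSeq (cZero aD3 rJ) (CFor 42 rC3 (CSeq cTry (cInc aD3 rJ rTL)))) s) rBest in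
  [/\ good b, b <= rg s rBest & forall dt X v, (forall i, i < J -> dt i < 2 * lam) ->
    built ss u c (ar s aD2) dt X v -> X \subset A -> b <= v].
Proof.
move=> t0 hd gb; rewrite run_seq; set t := run (cZero _ _) s.
have ft : fr [:: 19] [:: aD3] s t by rewrite /t; apply: fr_of.
have tt : tst t by apply: tst_fr ft _ _ t0.
have ct := (tst_stat tt).1.
pose K m s' := [/\ good (rg s' rBest), rg s' rBest <= rg s rBest & forall m' dt X v, m' < m ->
   (forall i, i < J -> dt i = digit (2 * lam) m' i) -> built ss u c (ar s aD2) dt X v -> X \subset A -> rg s' rBest <= v].
have [] : K ((2 * lam) ^ J) (run (CFor 42 rC3 (CSeq cTry (cInc aD3 rJ rTL))) t).
- apply: (odometer (cJ ct) (cTL ct) (cC3 ct)); first by vm_compute.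
  + exact: zero_ok (cJ (tst_stat t0).1) _.
  + by split=> //; rewrite -[rg _ _]/(rg t rBest) ft.1.
  move=> m s' mM f' sx hdig [k1 k2 k3].
  have t' : tst s' by apply: tst_fr f' _ _ tt.
  have E2 i : ar s' aD2 i = ar s aD2 i by rewrite f'.2 // ft.2.
  have gd : guess_ok lam J (ar s' aD2) (ar s' aD3).
    split=> i iL; first by rewrite E2 hd.
    (* For [lam] equal to 0 the loop has no turn, since [J] is positive and the number of turns is
       [0 ^ J]. *)
    rewrite hdig // /digit ltn_mod; move: mM; case: (2 * lam) => //; rewrite exp0n //; lia.
  have [] := try_ok (tst_stat t') (tst_av t') (tst_S t') (tst_U t') (tst_C t') ss0 ssJ gd (tst_N t').
  set b := rg (run cTry s') rBest => b1 b2 b3.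
  have Eb : rg (setr (run (cInc aD3 rJ rTL) (run cTry s')) 42 m.+1) rBest = b.
    by rewrite -[LHS]/(rg (run (cInc aD3 rJ rTL) (run cTry s')) rBest) run_rg.
  rewrite /K Eb; have [k11 k12] := k1; split.
  - split; first exact: leq_trans b1 _.
    move: b1; rewrite leq_eqVlt => /orP[/eqP E|lt]; [by rewrite E|exact: b2].
  - exact: leq_trans b1 _.
  - move=> m' dt X v; rewrite ltnS leq_eqVlt => /orP[/eqP -> hdt hb XA|m'm hdt hb XA].
      apply: (b3 X v) => //; apply: built_ext hb => i iL; rewrite ?E2 //.
      by rewrite hdt // hdig.
    by apply: leq_trans b1 _; exact: k3 hdt hb XA.
- move=> k1 k2 k3 b; split=> // dt X v hdt hb XA.
  have [m' m'M hm] := digit_all hdt.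
  by apply: (k3 m' dt X v) => // i iJ; rewrite hm.
Qed.

Lemma guess_loop_ok s : tst s -> rg s rBest = lam.+1 -> isN ss u c (rg (run cGuess s) rBest).
Proof.
move=> t0 hB; rewrite /cGuess run_seq; set t := run (cZero _ _) s.
have ft : fr [:: 19] [:: aD2] s t by rewrite /t; apply: fr_of.
have tt : tst t by apply: tst_fr ft _ _ t0.
have ct := (tst_stat tt).1.
pose K m s' := good (rg s' rBest) /\ forall m' dg dt X v, m' < m ->
   (forall i, i < 6 * J -> dg i = digit J.+1 m' i) -> (forall i, i < J -> dt i < 2 * lam) ->
   built ss u c dg dt X v -> X \subset A -> rg s' rBest <= v.
have [] : K (J.+1 ^ (6 * J)) (run (CFor 41 rC2 (CSeq (CSeq (cZero aD3 rJ) (CFor 42 rC3 (CSeq cTry (cInc aD3 rJ rTL)))) (cInc aD2 rL2 rK))) t).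
- apply: (odometer (cL2 ct) (cK ct) (cC2 ct)); first by vm_compute.
  + exact: zero_ok (cL2 (tst_stat t0).1) _.
  + by split=> //; rewrite -[rg _ _]/(rg t rBest) ft.1 // hB /good ltnn.
  move=> m s' mM f' sx hdig [k1 k3].
  have t' : tst s' by apply: tst_fr f' _ _ tt.
  have hd i : i < 6 * J -> ar s' aD2 i < J.+1 by move=> iL; rewrite hdig // ltn_mod.
  have [] := inner_ok t' hd k1.
  set q := run _ s'; set b := rg q rBest => b1 b2 b3.
  have Eb : rg (setr (run (cInc aD2 rL2 rK) q) 41 m.+1) rBest = b.
    by rewrite -[LHS]/(rg (run (cInc aD2 rL2 rK) q) rBest) run_rg.
  rewrite /K Eb; split=> // m' dg dt X v; rewrite ltnS leq_eqVlt => /orP[/eqP -> hdg hdt hb XA|m'm hdg hdt hb XA].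
    apply: (b3 dt X v hdt _ XA); apply: built_ext hb => // i iL.
    by rewrite hdg // hdig.
  by apply: leq_trans b2 _; exact: k3 hdg hdt hb XA.
- move=> [k1 k2] k3; split=> // X v cX XA.
  suff [dg [dt [gd hb]]] : exists dg dt, guess_ok lam J dg dt /\ built ss u c dg dt X v.
    have [m' m'M hm] := digit_all gd.1.
    by apply: (k3 m' dg dt X v) => //; [move=> i iJ; rewrite hm|exact: gd.2].
  (* The indices become variables with equations, so that the case analysis does not lose them. *)
  have [s0 [u0 [c0 [E1 [E2 [E3 C0]]]]]] : exists s0 u0 c0, s0 = ss /\ u0 = u /\ c0 = c /\ CertV s0 u0 c0 X v.
    by exists ss, u, c.
  case: C0 E1 E2 E3 => [u1 c1 E1|s3 u3 c3 dg dt p XB XG vB vG h1 h2 h3 h4 h5 h6 E1 E2 E3].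
    by move: ss0; rewrite -E1.
  exists dg, dt; rewrite -E1 -E2 -E3; split=> //.
  by exists p, XB, XG, vB, vG.
Qed.

End Cell.

Definition bst s := stat s /\ avail s.
Lemma bst_fr rs sa s s' : fr rs sa s s' -> ~~ has (mem rs) cregs ->
  ~~ has (mem sa) [:: aROW; aIN; aPAR; aANC; aDEG; aAV] -> bst s -> bst s'.
Proof.
move=> f h1 /hasPn h2 [a1 a2]; split.
  by apply: stat_fr f h1 _ a1; apply/hasPn => a ha; apply: h2; rewrite -[[:: aROW; aIN; aPAR; aANC; aDEG; aAV]]/([:: aROW; aIN; aPAR; aANC; aDEG] ++ [:: aAV]) mem_cat ha.
by move=> v; rewrite f.2 //; apply: h2.
Qed.

(** Cells are filled in the order of [Nix], in which the size leads; a cell only needs cells of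
    smaller size. *)
Definition cells m s := forall s' (u v : V), s' < J -> Nix s' u v < m -> anc u v -> isN s' u v (ar s aN (Nix s' u v)).

Lemma isN0 u c : isN 0 u c 0.
Proof. by split=> // _; exists set0, 0; split=> //; [exact: Cert0|exact: sub0set]. Qed.

Lemma Nix_inj s u v s' u' v' : Nix s u v = Nix s' u' v' -> [/\ s = s', u = u' :> V & v = v' :> V].
Proof.
rewrite /Nix => E; have := ltn_ord u; have := ltn_ord v; have := ltn_ord u'; have := ltn_ord v'.
move=> v'N u'N vN uN.
have sep a b a' b' : b < N -> b' < N -> a * N + b = a' * N + b' -> a = a' /\ b = b'.
  move=> bN b'N e; have := congr1 (divn^~ N) e; have := congr1 (modn^~ N) e.
  by rewrite !modnMDl !modn_small // !divnMDl // !divn_small // !addn0.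
have [e1 e2] := sep _ _ _ _ vN v'N E; have [e3 e4] := sep _ _ _ _ uN u'N e1.
by split=> //; exact: val_inj.
Qed.

Lemma cell_ok s ss (u c : V) : bst s -> ss < J -> rg s rS = ss -> rg s rU = u -> rg s rC = c ->
  cells (Nix ss u c) s -> cells (Nix ss u c).+1 (run (CSeqs [::
  CSet rBest (XIte (XVar rS) (XVar rInf) (XLit 0));
  CWhen (xand (XVar rS) (xanc (XVar rU) (XVar rC))) cGuess;
  CSto aN (XAdd (XArr aROW (XAdd (XArr aROW (XVar rS)) (XVar rU))) (XVar rC)) (XVar rBest)]) s).
Proof.
move=> b0 sJ eS eU eC IH; rewrite !run_seqs run_seqs1.
set t := run (CSet _ _) s; set t2 := run (CWhen _ _) t.
have ft : fr [:: rBest] [::] s t by rewrite /t; apply: fr_of.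
have bt : bst t by apply: bst_fr ft _ _ b0.
have tB : rg t rBest = if ss != 0 then lam.+1 else 0.
  by rewrite -[LHS]/(if rg s rS != 0 then rg s rInf else 0) eS (cInf b0.1.1).
have h2 : anc u c -> isN ss u c (rg t2 rBest).
  move=> uc; rewrite /t2 run_when /evs ev_xand -[ev _ _ (XVar rS)]/(rg t rS) ft.1 // eS.
  have -> : (ev (rg t) (ar t) (xanc (XVar rU) (XVar rC)) != 0) = anc u c.
    by apply: (ev_xancb bt.1.1 bt.1.2); rewrite -[LHS]/(rg t _) ft.1.
  rewrite uc andbT; move: tB; case: eqP => [-> /= ->|/eqP ss0 tB]; first exact: isN0.
  apply: guess_loop_ok => //; first by rewrite lt0n.
  split; rewrite ?ft.1 //; [exact: bt.1|exact: bt.2|].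
  move=> s' u' c' s's uc'; rewrite ft.2 //; apply: IH => //; first lia.
  by rewrite /Nix; have := ltn_ord u'; have := ltn_ord c'; nia.
have f2 : fr (rBest :: wrC cGuess) (waC cGuess) s t2.
  apply: (@fr_trans _ _ _ t); first by apply: fr_sub ft _ _ => z // h; rewrite in_cons -mem_seq1 h.
  rewrite /t2 run_when; case: ifP => _; last exact: fr_refl.
  by apply: fr_sub (fr_run _ _) _ _ => z // h; rewrite inE h orbT.
have bt2 : bst t2 by apply: bst_fr f2 _ _ b0.
move=> s' u' v' s'J; rewrite ltnS leq_eqVlt => h uv'.
rewrite -[ar _ _ _]/(if (aN == aN) && (Nix s' u' v' == ev (rg t2) (ar t2) (XAdd (XArr aROW (XAdd (XArr aROW (XVar rS)) (XVar rU))) (XVar rC)))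
  then rg t2 rBest else ar t2 aN (Nix s' u' v')).
have -> : ev (rg t2) (ar t2) (XAdd (XArr aROW (XAdd (XArr aROW (XVar rS)) (XVar rU))) (XVar rC)) = Nix ss u c.
  rewrite -[LHS]/(ar t2 aROW (ar t2 aROW (rg t2 rS) + rg t2 rU) + rg t2 rC) !f2.1 // eS eU eC.
  have cR := cROW bt2.1.1.
  have -> : ar t2 aROW ss = ss * N by rewrite cR //; nia.
  by rewrite cR //; have := ltn_ord u; nia.
rewrite eqxx andTb; case: eqP => [/Nix_inj[e1 e2 e3]|ne].
  by move: uv'; rewrite e1 e2 e3.
by rewrite f2.2 //; apply: IH => //; case/orP: h => // /eqP.
Qed.

Lemma table_ok s : bst s -> cells (J * N * N) (run cTable s).
Proof.
move=> b0; pose I0 i := cells (i * N * N).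
apply: (@run_for I0 _ _ _ _ _ (cJ b0.1.1)) => [s' u v _|i t iJ ft ti It]; first by rewrite ltn0.
have bt : bst t by apply: bst_fr ft _ _ b0.
pose I1 j := cells ((i * N + j) * N).
set B1 := (X in run X t); suff H1 : I1 N (run B1 t).
  by move=> s' u v h1 h2; apply: H1 => //; move: h2; rewrite mulSn addnC.
apply: (@run_for I1 _ _ _ _ _ (cN bt.1.1)) => [|j q jN fq qj Iq]; first by rewrite /I1 addn0.
have bq : bst q by apply: bst_fr fq _ _ bt.
pose I2 k := cells ((i * N + j) * N + k).
set B2 := (X in run X q); suff H2 : I2 N (run B2 q).
  by move=> s' u v h1 h2; apply: H2 => //; move: h2; lia.
apply: (@run_for I2 _ _ _ _ _ (cN bq.1.1)) => [|k r kN fr' rk' Ir]; first by rewrite /I2 addn0.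
have br : bst r by apply: bst_fr fr' _ _ bq.
rewrite /I2 addnS; apply: (@cell_ok r i (Ordinal jN) (Ordinal kN)) => //.
  by rewrite fr'.1 // fq.1.
by rewrite fr'.1.
Qed.

(** A component is determined by its entry [c], the number of cuts below [c], and certificates for
    both parts; the rest is beside [c] in the whole tree, whence the cell with [u] the root. *)
Lemma best_ok s sz : bst s -> rg s rSz = sz -> sz <= J ->
  is_best s1 s2 anc ord0 lam topV vselV J sz A (rg (run cBest s) rVal).
Proof.
move=> b0 eSz szJ; rewrite /cBest !run_seqs run_seqs1.
set t := run cTable s; set t2 := run (CSet _ _) t.
have ft : fr (wrC cTable) (waC cTable) s t := fr_run _ _.
have bt : bst t by apply: bst_fr ft _ _ b0.
have ft2 : fr [:: rVal] [::] t t2 by rewrite /t2; apply: fr_of.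
have bt2 : bst t2 by apply: bst_fr ft2 _ _ bt.
have tab : cells (J * N * N) t := table_ok b0.
pose cand (c : V) i := #|DD c| + (ar t aN (Nix i c c) + ar t aN (Nix (sz.-1 - i) ord0 c)).
pose goodQ x := (sz = 0 -> x = 0) /\ (x <= lam.+1 /\ (x <= lam ->
  exists Q v, [/\ CertQ s1 s2 anc ord0 lam topV vselV J sz Q v, Q \subset A & v <= x])).
pose I m s' := goodQ (rg s' rVal) /\ forall (c : V) i, c < m -> c \in A -> i < sz -> rg s' rVal <= cand c i.
have ltNix i (u v : V) : i < J -> Nix i u v < J * N * N.
  by rewrite /Nix; have := ltn_ord u; have := ltn_ord v; nia.
have tabN i u v : i < J -> anc u v -> isN i u v (ar t aN (Nix i u v)).
  by move=> iJ uv; apply: tab => //; exact: ltNix.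
set B := (X in run X t2); have [] : I N (run B t2); last first.
- move=> [g0 [g1 g2]] g3; split=> // Q v cQ QA; case: cQ => [[s0 _ _]|[c [i [j [X1 [X2 [v1 [v2 [cok C1 C2 [Es EQ ->]]]]]]]]]].
    by rewrite g0.
  have cA : c \in A by apply: (subsetP QA); rewrite EQ in_setU1 eqxx.
  have iS : i < sz by rewrite Es; lia.
  apply: leq_trans (g3 c i (ltn_ord c) cA iS) _.
  have [_ _ n1] := tabN i c c (leq_trans iS szJ) (arefl c).
  have jJ : sz.-1 - i < J by lia.
  have [_ _ n2] := tabN _ ord0 c jJ (aroot c).
  have Ej : sz.-1 - i = j by rewrite Es; lia.
  rewrite /cand leq_add2l; apply: leq_add.
    by apply: n1 C1 _; apply: subset_trans QA; rewrite EQ; apply/subsetP => y; rewrite !inE => ->; exact: orbT.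
  rewrite Ej in n2 *; apply: n2 C2 _; apply: subset_trans QA; rewrite EQ; apply/subsetP => y; rewrite !inE => ->; by rewrite !orbT.
- apply: (@run_for I _ _ _ _ _ (cN bt2.1.1)).
    split=> //; rewrite -[rg _ _]/(if rg t rSz != 0 then rg t rInf else 0) ft.1 // eSz (cInf bt.1.1).
    have [z0|nz] := eqVneq sz 0; last by split; [move=> e; rewrite e in nz|split=> //; rewrite ltnn].
    by split=> //; split=> // _; rewrite z0; exists set0, 0; split=> //; [left|exact: sub0set].
  move=> k q kN fq qk [Ig Ic].
  have bq : bst q by apply: bst_fr fq _ _ bt2.
  pose c : V := Ordinal kN.
  pose K j s' := [/\ goodQ (rg s' rVal), rg s' rVal <= rg q rVal & c \in A -> forall i, i < j -> i < sz -> rg s' rVal <= cand c i].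
  set B' := (X in run X q); have [] : K J (run B' q); last first.
    move=> K1 K2 K3; split=> // c' i; rewrite ltnS leq_eqVlt => /orP[/eqP e|lt] c'A iS.
      by have ec : c' = c by [apply: val_inj]; rewrite ec in c'A *; apply: K3 => //; lia.
    by apply: leq_trans K2 _; exact: Ic.
  apply: (@run_for K _ _ _ _ _ (cJ bq.1.1)); first by split.
  move=> j r jJ fr' rj [K1 K2 K3].
  have br : bst r by apply: bst_fr fr' _ _ bq.
  have rS' : rg r rSz = sz by rewrite fr'.1 // fq.1 // ft2.1 // ft.1.
  have r45 : rg r 45 = c by rewrite fr'.1 // qk.
  set B'' := (X in run X r); suff : K j.+1 (run B'' r) by [].
  rewrite /B'' run_when /evs ev_xand ev_xlt -[ev _ _ (XVar 46)]/(rg r 46) -[ev _ _ (XVar rSz)]/(rg r rSz) rj rS'.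
  have -> : (ev (rg r) (ar r) (XArr aAV (XVar 45)) != 0) = (c \in A).
    by rewrite -[ev _ _ _]/(ar r aAV (rg r 45)) r45 br.2.
  case: ifP => [/andP[cA jS]|h]; last first.
    split=> // cA i; rewrite ltnS leq_eqVlt => /orP[/eqP ->|]; last exact: K3.
    by move: h; rewrite cA /= => ->.
  rewrite run_seq; set r1 := run (CSet 47 _) r.
  have e47 : rg r1 47 = cand c j.
    have -> : rg r1 47 = ev (rg r) (ar r) (XAdd (XArr aDEG (XVar 45)) (XAdd (xN (XVar 46) (XVar 45) (XVar 45))
        (xN (XSub (xpred (XVar rSz)) (XVar 46)) (XLit 0) (XVar 45)))) by [].
    rewrite !ev_xadd (@ev_xN n G T J lam JN _ _ _ _ _ j c c br.1.1) //; [|lia].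
    rewrite (@ev_xN n G T J lam JN _ _ _ _ _ (sz.-1 - j) ord0 c br.1.1) //; first last.
    - by rewrite -[LHS]/(rg r rSz - 1 - rg r 46) rS' rj subn1.
    - lia.
    rewrite -[ev _ _ (XArr aDEG _)]/(ar r aDEG (rg r 45)) r45 (tD br.1.2).
    by rewrite !fr'.2 // !fq.2 // !ft2.2.
  rewrite /K; have -> : rg (run (cMin rVal 47) r1) rVal = minn (rg r rVal) (cand c j).
    rewrite /cMin run_when /evs ev_xlt -[ev _ _ (XVar 47)]/(rg r1 47) -[ev _ _ (XVar rVal)]/(rg r rVal) e47.
    by case: ltnP => // _.
  have [iS kS] : j < sz /\ sz.-1 - j < J by lia.
  split.
  - case: K1 => k1 [k2 k3]; split; first by lia.
    split; first by apply: leq_trans (geq_minl _ _) k2.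
    rewrite minnC; case: (leqP (cand c j) (rg r rVal)) => [_|lt] xl; last exact: k3.
    have [_ n1 _] := tabN j c c jJ (arefl c); have [_ n2 _] := tabN _ ord0 c kS (aroot c).
    move: xl; rewrite /cand => xl.
    have [|X1 [v1 [C1 A1 l1]]] := n1; first lia.
    have [|X2 [v2 [C2 A2 l2]]] := n2; first lia.
    exists (c |: (X1 :|: X2)), (#|DD c| + (v1 + v2)); split.
    + right; exists c, j, (sz.-1 - j), X1, X2, v1, v2; split=> //; first exact: Aok.
      by split=> //; lia.
    + by rewrite !subUset sub1set cA A1.
    + by rewrite leq_add2l leq_add.
  - by apply: leq_trans (geq_minl _ _) K2.
  - move=> _ i; rewrite ltnS leq_eqVlt => /orP[/eqP -> _|lt iz]; first exact: geq_minr.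
    by apply: leq_trans (geq_minl _ _) _; exact: K3.
Qed.

End Table.

(** * Deletion and packing on the machine *)

Section Packing.
Variables (n : nat) (G : multigraph n.+1) (T : {set edge G}) (J lam : nat).
Local Notation V := 'I_n.+1.
Local Notation N := (n.+1).
Variables (par : V -> V) (rk : V -> nat).
Hypothesis par0 : par ord0 = ord0.
Hypothesis rk_par : forall y, y != ord0 -> rk (par y) < rk y.
Hypothesis JN : J < N.
Local Notation anc := (ancp par).
Local Notation s1 := (@e1 n G).
Local Notation s2 := (@e2 n G).
Local Notation stat := (stat T J lam par).
Local Notation bst := (bst T J lam par).
Local Notation topV := (topv G lam par).
Local Notation vselV := (vself G par).
Local Notation DXV := (DX s1 s2 anc).
Local Notation okV := (okv s1 s2 anc ord0 lam).
Variable Vf : nat -> {set V} -> nat.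
Hypothesis VfP : forall j A, is_best s1 s2 anc ord0 lam topV vselV J j A (Vf j A).
Local Notation elimV := (elimin Vf).

Definition qself (Q : {set V}) q : V := nthset (mem Q) q.
Lemma qself_ok (Q : {set V}) y : y \in Q -> exists2 q, q < #|Q| & qself Q q = y.
Proof. by move=> yQ; have [q] := @nthset_ex n (mem Q) y yQ; exists q. Qed.

Local Notation prunV := (prun s1 s2 anc ord0 lam J Vf qself).
Local Notation pstepV := (pstep s1 s2 anc ord0 lam J Vf qself).

Let arefl := ancp_refl par.
Let atrans := @ancp_trans n par.
Let aanti := ancp_anti par0 rk_par.
Let atot := @ancp_tot n par.
Let aroot := ancp_root rk_par.

Lemma fr_setr s x i : fr [:: x] [::] s (setr s x i).
Proof. by split=> // r; rewrite mem_seq1 => /negbTE h; rewrite /= /upd h. Qed.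

Lemma run_if e c d s : run (CIf e c d) s = if evs s e != 0 then run c s else run d s.
Proof. by []. Qed.

Lemma best_val s (A : {set V}) sz : {in A, forall v, okV v} -> bst A s -> rg s rSz = sz -> sz <= J ->
  rg (run cBest s) rVal = Vf sz A.
Proof.
by move=> Aok b0 e sJ; apply: is_best_uniq (VfP sz A); exact: (best_ok par0 rk_par JN Aok b0 e sJ).
Qed.

Lemma elim_ok s (A : {set V}) sz : {in A, forall v, okV v} -> bst A s -> rg s rSz = sz -> sz <= J ->
  let s' := run cElim s in bst (elimV sz A) s' /\ rg s' 48 = Vf sz A.
Proof.
move=> Aok b0 eS sJ; rewrite /cElim !run_seqs run_seqs1.
set t := run cBest s; set t2 := run (CSet _ _) t.
have ft : fr (wrC cBest) (waC cBest) s t := fr_run _ _.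
have bt : bst A t by apply: bst_fr ft _ _ b0.
have ft2 : fr [:: 48] [::] t t2 by rewrite /t2; apply: fr_of.
have bt2 : bst A t2 by apply: bst_fr ft2 _ _ bt.
have e48 : rg t2 48 = Vf sz A by rewrite -[LHS]/(rg t rVal) (best_val Aok b0 eS sJ).
set B := (X in run X t2).
pose Ai i := foldl (estep Vf sz (Vf sz A)) A (take i (enum 'I_N)).
have AiA i : Ai i \subset A.
  by have [] := foldl_estep VfP (take i (enum 'I_N)) (leqnn (Vf sz A)).
suff [H1 H2] : avail (Ai N) (run B t2) /\ rg (run B t2) 48 = Vf sz A.
  split=> //; split; first by apply: stat_fr (fr_run _ _) _ _ bt2.1.
  by move: H1; rewrite /Ai take_oversize // size_enum_ord.
pose I i s' := avail (Ai i) s' /\ rg s' 48 = Vf sz A.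
apply: (@run_for I _ _ _ _ _ (cN bt2.1.1)); first by split; [rewrite /Ai take0; exact: bt2.2|exact: e48].
move=> i r iN fr' ri [Ia I48].
have Ib : bst (Ai i) r by split=> //; apply: stat_fr fr' _ _ bt2.1.
pose v : V := Ordinal iN.
have AS : Ai i.+1 = estep Vf sz (Vf sz A) (Ai i) v.
  rewrite /Ai (take_nth ord0) ?size_enum_ord // -cats1 foldl_cat /=.
  by congr estep; apply: val_inj; rewrite /= nth_enum_ord.
have rS : rg r rSz = sz by rewrite fr'.1 // ft2.1 // ft.1.
set B2 := (X in run X r); suff : I i.+1 (run B2 r) by [].
rewrite /I AS /estep /B2 run_when.
have -> : (evs r (XArr aAV (XVar 49)) != 0) = (v \in Ai i).
  by rewrite -[evs _ _]/(ar r aAV (rg r 49)) ri; exact: (Ib.2 v).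
have [vA|nvA] := boolP (v \in Ai i); rewrite ?andTb ?andFb //.
rewrite !run_seqs run_seqs1; set q := run (CSto _ _ _) r; set q2 := run cBest q.
have fq : fr [::] [:: aAV] r q by rewrite /q; apply: fr_of.
have fq2 : fr (wrC cBest) (waC cBest) q q2 := fr_run _ _.
have bq : bst (Ai i :\ v) q.
  split; first by apply: stat_fr fq _ _ Ib.1.
  move=> w; rewrite -[ar q _ _]/(if (aAV == aAV) && (w == rg r 49 :> nat) then 0 else ar r aAV w) ri eqxx andTb.
  rewrite in_setD1 -Ib.2 (_ : (w == i :> nat) = (w == v)) //.
  by case: (w == v).
have okq : {in Ai i :\ v, forall v, okV v}.
  by move=> w; rewrite in_setD1 => /andP[_ /(subsetP (AiA i))]; exact: Aok.
have bq2 : bst (Ai i :\ v) q2 by apply: bst_fr fq2 _ _ bq.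
have e48' : rg q2 48 = Vf sz A by rewrite fq2.1 // fq.1.
have eV : rg q2 rVal = Vf sz (Ai i :\ v) by apply: best_val okq bq _ sJ; rewrite fq.1.
rewrite run_when /evs ev_xlt -[ev _ _ (XVar 48)]/(rg q2 48) -[ev _ _ (XVar rVal)]/(rg q2 rVal) e48' eV.
case: ltnP => [lt|//]; last by split=> //; exact: bq2.2.
set q3 := run (CSto _ _ _) q2.
have fq3 : fr [::] [:: aAV] q2 q3 by rewrite /q3; apply: fr_of.
have r49 : rg q2 49 = i by rewrite fq2.1 // fq.1.
split; last by rewrite fq3.1.
move=> w; rewrite -[ar q3 _ _]/(if (aAV == aAV) && (w == rg q2 49 :> nat) then 1 else ar q2 aAV w) r49 eqxx andTb.
rewrite (_ : (w == i :> nat) = (w == v)) //; case: (w =P v) => [->|/eqP ne]; first by rewrite vA.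
by rewrite bq2.2 in_setD1 ne.
Qed.

Record prel (dd : nat -> nat) (p : pst V) (s : st) : Prop := Prel {
  prS : stat s; prD : forall i, ar s aD1 i = dd i;
  prSel : forall v : V, (ar s aSEL v != 0) = (v \in psel p);
  prLab : forall v : V, ar s aLAB v = plab p v;
  prCur : rg s rCi = pcur p; prTot : rg s rTot = ptot p }.

Lemma prel_fr dd p rs sa s s' : fr rs sa s s' -> ~~ has (mem rs) (cregs ++ [:: rCi; rTot]) ->
  ~~ has (mem sa) [:: aROW; aIN; aPAR; aANC; aDEG; aD1; aSEL; aLAB] -> prel dd p s -> prel dd p s'.
Proof.
move=> f; rewrite has_cat negb_or => /andP[h1 /hasPn h2] /hasPn h3 [a1 a2 a3 a4 a5 a6].
split=> *; rewrite ?(f.1 rCi) ?(f.1 rTot) ?f.2 //; try by [apply: h3|apply: h2].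
by apply: stat_fr f h1 _ a1; apply/hasPn => a ha; apply: h3; rewrite -[[:: aROW; aIN; aPAR; aANC; aDEG; aD1; aSEL; aLAB]]/([:: aROW; aIN; aPAR; aANC; aDEG] ++ [:: aD1; aSEL; aLAB]) mem_cat ha.
Qed.

Lemma step_ok dd p s t : prel dd p s -> (forall i, i < 5 * J -> dd i <= J) -> 0 < pcur p -> rg s 52 = t ->
  prel dd (pstepV (psz J dd (pcur p)) (dd t) (dd (J + J + t)) p) (run cStep s).
Proof.
move=> p0 ddJ c0 e52; rewrite /cStep run_when /pstep.
have -> : (evs s (XSub (xsucc vJ) (XVar rCi)) != 0) = (pcur p <= J).
  rewrite -[evs _ _]/(rg s rJ + 1 - rg s rCi) (cJ (prS p0).1) (prCur p0); lia.
case: ifP => // cJ'; rewrite !run_seqs run_seqs1.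
set t1 := run (CSet rSz _) s; set t2 := run (CFor 33 rN _) t1; set t3 := run cElim t2; set t4 := run (CSet 53 _) t3.
have f1 : fr [:: rSz] [::] s t1 by rewrite /t1; apply: fr_of.
have f2 : fr [:: 33] [:: aAV] t1 t2 by rewrite /t2; apply: fr_of.
have f3 : fr (wrC cElim) (waC cElim) t2 t3 := fr_run _ _.
have f4 : fr [:: 53] [::] t3 t4 by rewrite /t4; apply: fr_of.
have p1 : prel dd p t1 by apply: prel_fr f1 _ _ p0.
have p2 : prel dd p t2 by apply: prel_fr f2 _ _ p1.
have p3 : prel dd p t3 by apply: prel_fr f3 _ _ p2.
have p4 : prel dd p t4 by apply: prel_fr f4 _ _ p3.
set A := pavail s1 s2 anc ord0 lam p; set sz := psz J dd (pcur p).
have szJ : sz <= J by rewrite /sz /psz; apply: ddJ; move: c0 cJ'; clear; case: (pcur p) => // m _ mJ; rewrite -pred_Sn; lia.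
have eSz : rg t1 rSz = sz.
  rewrite -[LHS]/(ar s aD1 (((rg s rJ + rg s rJ) + (rg s rJ + rg s rJ)) + (rg s rCi - 1))) (prD p0) (prCur p0).
  by rewrite (cJ (prS p0).1) subn1.
have b2 : bst A t2.
  split; first exact: prS p2.
  move=> v; pose f i := if insub i is Some v then nat_of_bool ((v : V) \in A) else 0.
  suff H i : i < N -> ar t2 aAV i = f i by rewrite H // /f valK eqb0 negbK.
  move: i; apply: (@fill1 t1 33 rN aAV _ N f (cN (prS p1).1) isT) => s' i iN f' si.
  rewrite /f insubT; set w : V := Sub i iN.
  have p' : prel dd p s' by apply: prel_fr f' _ _ p1.
  rewrite /evs ev_xbool ev_xand (@ev_xok n G T J lam par _ _ (prS p').1 (prS p').2 _ w) //.
  rewrite ev_xand ev_xnot ev_xor ev_xnot ev_xeq -[ev _ _ (XArr aSEL _)]/(ar s' aSEL (rg s' 33)).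
  rewrite -[ev _ _ (XArr aLAB _)]/(ar s' aLAB (rg s' 33)) -[ev _ _ (XVar rCi)]/(rg s' rCi) si.
  rewrite (prSel p' w) (prLab p' w) (prCur p') negbK.
  by rewrite inE.
have Aok : {in A, forall v, okV v} by move=> v; rewrite inE => /and3P[].
have [b3 e48] : bst (elimV sz A) t3 /\ rg t3 48 = Vf sz A.
  by apply: elim_ok Aok b2 _ szJ; rewrite f2.1.
set Q := elimV sz A in b3 *.
have b4 : bst Q t4 by apply: bst_fr f4 _ _ b3.
have e53 : rg t4 53 = dd t.
  by rewrite -[LHS]/(ar t3 aD1 (rg t3 52)) (prD p3) f3.1 // f2.1 // f1.1 // e52.
rewrite run_if -[evs _ _]/(rg t4 53) e53 if_neg.
case: eqP => [d0|/eqP d0]; last first.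
  rewrite run_seq; set q := run (CSet 54 _) t4; set q2 := run (CSto _ _ _) q.
  have fq : fr [:: 54] [::] t4 q by rewrite /q; apply: fr_of.
  have q54 : rg q 54 = qself Q (dd (J + J + t)).
    have -> : dd (J + J + t) = evs t4 (XArr aD1 (XAdd (XAdd vJ vJ) (XVar 52))).
      rewrite -[RHS]/(ar t4 aD1 (rg t4 rJ + rg t4 rJ + rg t4 52)) (prD p4) (cJ (prS p4).1).
      by rewrite f4.1 // f3.1 // f2.1 // f1.1 // e52.
    rewrite -[LHS]/(ev (rg t4) (ar t4) (xnth (fun y => XArr aAV y) (XArr aD1 (XAdd (XAdd vJ vJ) (XVar 52))))).
    apply: ev_xnth => //; first exact: cN (prS p4).1.
      by move=> i; exact: b4.2.
    by move=> i j; exact: b4.2.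
  have pq : prel dd p q by apply: prel_fr fq _ _ p4.
  have fq2 : fr [::] [:: aLAB] q q2 by rewrite /q2; apply: fr_of.
  split; [by apply: stat_fr fq2 _ _ (prS pq)|exact: prD pq|exact: prSel pq| |exact: prCur pq|exact: prTot pq].
  move=> v; rewrite -[LHS]/(if (aLAB == aLAB) && (v == rg q 54 :> nat) then rg q 53 else ar q aLAB v) q54 eqxx andTb.
  by rewrite eq_ordE fq.1 // e53 (prLab pq).
rewrite !run_seqs run_seqs1; set q1 := run (CFor 33 rN _) t4; set q2 := run (CSet rTot _) q1; set q3 := run (CSet rCi _) q2.
have fq1 : fr [:: 33] [:: aSEL] t4 q1 by rewrite /q1; apply: fr_of.
have fq2 : fr [:: rTot] [::] q1 q2 by rewrite /q2; apply: fr_of.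
have fq3 : fr [:: rCi] [::] q2 q3 by rewrite /q3; apply: fr_of.
have hsel (v : V) : (ar q1 aSEL v != 0) = (v \in psel p :|: Q).
  pose I m s' := forall v : V, (ar s' aSEL v != 0) = (v \in psel p) || ((v < m) && (v \in Q)).
  suff H : I N q1 by rewrite H ltn_ord in_setU.
  apply: (@run_for I _ _ _ _ _ (cN (prS p4).1)); first by move=> w; rewrite orbF; exact: prSel p4 w.
  move=> i r iN fr' ri Ir w.
  have hA (z : V) : (ar r aAV z != 0) = (z \in Q) by rewrite fr'.2 //; exact: b4.2.
  set B := (X in run X r); rewrite -[ar _ _ _]/(ar (run B r) aSEL w) /B run_when -[evs _ _]/(ar r aAV (rg r 33)) ri.
  rewrite (hA (Ordinal iN)) ltnS leq_eqVlt; case: ifP => [iQ|iQ].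
    rewrite -[ar _ _ _]/(if (aSEL == aSEL) && (w == rg r 33 :> nat) then 1 else ar r aSEL w) ri eqxx andTb.
    case: (w =P i :> nat) => [e|ne]; last by rewrite Ir.
    by rewrite (_ : w = Ordinal iN) ?iQ ?orbT //; exact: val_inj.
  rewrite Ir; case: (w =P i :> nat) => [e|ne]; last by [].
  by rewrite (_ : w = Ordinal iN) ?iQ ?andbF //; exact: val_inj.
split.
- by apply: stat_fr fq3 _ _ (stat_fr fq2 _ _ (stat_fr fq1 _ _ (prS p4))).
- by move=> i; rewrite fq3.2 // fq2.2 // fq1.2 // (prD p4).
- by move=> v; rewrite fq3.2 // fq2.2 //; exact: hsel.
- by move=> v; rewrite fq3.2 // fq2.2 // fq1.2 // (prLab p4).
- by rewrite -[LHS]/(rg q2 rCi + 1) fq2.1 // fq1.1 // (prCur p4) addn1.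
- rewrite fq3.1 // -[LHS]/(rg q1 rTot + rg q1 48) !fq1.1 // (prTot p4) f4.1 //.
  by rewrite e48.
Qed.

(** All J slots have been accepted and their sizes sum to J; other guesses are ignored. *)
Definition success dd := [/\ pcur (prunV dd (J + J)) = J.+1 & \sum_(1 <= c < J.+1) psz J dd c = J].

Lemma pack_ok s : stat s -> (forall i, i < 5 * J -> ar s aD1 i <= J) ->
  let dd := ar s aD1 in let p := prunV dd (J + J) in let s' := run cPack s in
  (success dd /\ ptot p < rg s rBtot /\ rg s' rBtot = ptot p /\ (forall v : V, (ar s' aBSEL v != 0) = (v \in psel p))) \/
  (~ (success dd /\ ptot p < rg s rBtot) /\ rg s' rBtot = rg s rBtot /\ (forall v : V, ar s' aBSEL v = ar s aBSEL v)).
Proof.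
move=> st0 hd dd p; rewrite /cPack !run_seqs run_seqs1.
set t1 := run (CFor 33 rN _) s; set t2 := run (CSet rCi _) t1; set t3 := run (CSet rTot _) t2; set t4 := run (CFor 52 _ _) t3.
have f1 : fr [:: 33] [:: aSEL; aLAB] s t1 by rewrite /t1; apply: fr_of.
have f2 : fr [:: rCi] [::] t1 t2 by rewrite /t2; apply: fr_of.
have f3 : fr [:: rTot] [::] t2 t3 by rewrite /t3; apply: fr_of.
have st3 : stat t3 by apply: stat_fr f3 _ _ (stat_fr f2 _ _ (stat_fr f1 _ _ st0)).
have p3 : prel dd (prunV dd 0) t3.
  have H : forall v : V, ar t1 aSEL v = 0 /\ ar t1 aLAB v = 0.
    pose I m s' := forall v : V, v < m -> ar s' aSEL v = 0 /\ ar s' aLAB v = 0.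
    suff H : I N t1 by move=> v; exact: H.
    apply: (@run_for I _ _ _ _ _ (cN st0.1)) => // i r iN fr' ri Ir w; rewrite ltnS leq_eqVlt.
    set B := (X in run X r); rewrite -[ar _ aSEL _]/(ar (run B r) aSEL w) -[ar _ aLAB _]/(ar (run B r) aLAB w).
    rewrite -[ar (run B r) aSEL w]/(if (aSEL == aSEL) && (w == rg r 33 :> nat) then 0 else ar r aSEL w).
    rewrite -[ar (run B r) aLAB w]/(if (aLAB == aLAB) && (w == rg r 33 :> nat) then 0 else ar r aLAB w).
    by rewrite !eqxx !andTb ri; case: eqP => // _ /= /Ir.
  split=> //.
  - by move=> i; rewrite f3.2 // f2.2 // f1.2.
  - by move=> v; rewrite f3.2 // f2.2 // (H v).1 inE.
  - by move=> v; rewrite f3.2 // f2.2 // (H v).2.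
have f4 : fr (wrC (CFor 52 rJJ cStep)) (waC (CFor 52 rJJ cStep)) t3 t4 := fr_run _ _.
have st4 : stat t4 by apply: stat_fr f4 _ _ st3.
have [p4 B4] : (prel dd p t4) /\ rg t4 rBtot = rg s rBtot.
  split; last by rewrite f4.1 // f3.1 // f2.1 // f1.1.
  pose I i s' := prel dd (prunV dd i) s'.
  apply: (@run_for I _ _ _ _ _ (cJJ st3.1)).
    exact: (prel_fr (fr_setr t3 52 0)).
  move=> i r iJ fr' ri Ir.
  apply: (prel_fr (fr_setr (run cStep r) 52 i.+1)) => //.
  by apply: step_ok => //; exact: prun_cur.
have hs : (evs t4 (xand (xeq (XVar rCi) (xsucc vJ)) (xand (xeq (XSum 80 rJ (xdsz (XVar 80))) vJ) (xlt (XVar rTot) (XVar rBtot)))) != 0)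
   <-> (success dd /\ ptot p < rg s rBtot).
  rewrite /evs !ev_xand !ev_xeq ev_xlt -[ev _ _ (XVar rCi)]/(rg t4 rCi) -[ev _ _ (XVar rTot)]/(rg t4 rTot) -[ev _ _ (XVar rBtot)]/(rg t4 rBtot).
  rewrite -[ev _ _ vJ]/(rg t4 rJ) -[ev _ _ (xsucc vJ)]/(rg t4 rJ + 1) (cJ st4.1) (prCur p4) (prTot p4) B4 addn1.
  rewrite (ev_xsum (N := J) (f := fun i => psz J dd i.+1)); first last.
  - move=> i; rewrite -[LHS]/(ar t4 aD1 (((rg t4 rJ + rg t4 rJ) + (rg t4 rJ + rg t4 rJ)) + i)) (cJ st4.1) (prD p4) /psz.
    by [].
  - exact: cJ st4.1.
  rewrite -(big_mkord xpredT (fun i => psz J dd i.+1)) -(big_add1 _ _ 0 J.+1 xpredT (psz J dd)).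
  by split=> [/and3P[/eqP h1 /eqP h2 h3]|[[h1 h2] h3]]; [split|rewrite h1 h2 h3 !eqxx].
rewrite run_when; case: ifP => [/hs h|h]; last first.
  right; split; first by move=> H; move/hs: H; rewrite h.
  split; first exact: B4.
  by move=> v; rewrite f4.2 // f3.2 // f2.2 // f1.2.
left; have [h1 h2] := h; split=> //; split=> //; rewrite run_seq.
set q := run (CSet rBtot _) t4; set q2 := run (CFor _ _ _) q.
have fq : fr [:: rBtot] [::] t4 q by rewrite /q; apply: fr_of.
have stq : stat q by apply: stat_fr fq _ _ st4.
have fq2 : fr [:: 33] [:: aBSEL] q q2 by rewrite /q2; apply: fr_of.
split; first by rewrite fq2.1 // -[LHS]/(rg t4 rTot) (prTot p4).
move=> v; rewrite -(prSel p4 v) (_ : ar q2 aBSEL v = ar t4 aSEL v) //.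
apply: (@fill1 q 33 rN aBSEL _ N (fun i => ar t4 aSEL i) (cN stq.1) isT) => // s' i iN f' si.
by rewrite -[LHS]/(ar s' aSEL (rg s' 33)) si f'.2.
Qed.
End Packing.

(** * Enumeration of outer guesses and output labels *)

Section Outer.
Variables (n : nat) (G : multigraph n.+1) (T : {set edge G}) (J lam : nat).
Local Notation V := 'I_n.+1.
Local Notation N := (n.+1).
Variables (par : V -> V) (rk : V -> nat).
Hypothesis par0 : par ord0 = ord0.
Hypothesis rk_par : forall y, y != ord0 -> rk (par y) < rk y.
Hypothesis JN : J < N.
Local Notation anc := (ancp par).
Local Notation s1 := (@e1 n G).
Local Notation s2 := (@e2 n G).
Local Notation stat := (stat T J lam par).
Local Notation topV := (topv G lam par).
Local Notation vselV := (vself G par).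
Local Notation DXV := (DX s1 s2 anc).
Local Notation okV := (okv s1 s2 anc ord0 lam).

Let arefl := ancp_refl par.
Let atrans := @ancp_trans n par.
Let aanti := ancp_anti par0 rk_par.
Let atot := @ancp_tot n par.
Let aroot := ancp_root rk_par.

(** Existence of the optimum is shown classically, so choice names it; uniqueness identifies it with
    the computed value. *)
Definition Vf j (A : {set V}) := proj1_sig (constructive_indefinite_description _
  (is_best_ex s1 s2 anc ord0 lam topV vselV J j A)).
Lemma VfP j (A : {set V}) : is_best s1 s2 anc ord0 lam topV vselV J j A (Vf j A).
Proof. exact: (proj2_sig (constructive_indefinite_description _ _)). Qed.

Local Notation prunV := (prun s1 s2 anc ord0 lam J Vf (@qself n)).
Local Notation success := (@success n G J lam par Vf).

Definition bestset s : {set V} := [set v : V | ar s aBSEL v != 0].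

Lemma prun_digits dd dd' : (forall i, i < 5 * J -> dd' i = dd i) -> success dd ->
  success dd' /\ prunV dd' (J + J) = prunV dd (J + J).
Proof.
move=> h [h1 h2]; have hs c : 0 < c <= J -> psz J dd' c = psz J dd c.
  by move=> /andP[c0 cJ]; rewrite /psz h //; case: c c0 cJ => // c _ cJ; rewrite -pred_Sn; lia.
have E : prunV dd' (J + J) = prunV dd (J + J).
  by apply: prun_ext => // i iJ; rewrite !h //; lia.
split=> //; split; first by rewrite E.
by rewrite -[RHS]h2; apply: eq_big_nat => c /andP[c0 cJ]; apply: hs; rewrite c0.
Qed.

(** Any successful guess of total at most [lam] selects a certified set, and by [packing_exists]
    some guess does not exceed the cost of [F]. *)
Lemma outer_ok s : stat s -> let s' := run cOuter s in
  (rg s' rBtot <= lam -> [/\ #|bestset s'| = J, {in bestset s', forall v, okV v} & #|DXV (bestset s')| <= rg s' rBtot]) /\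
  (forall F : {set V}, #|F| = J -> {in F, forall f, okV f} -> #|DXV F| <= lam -> rg s' rBtot <= #|DXV F|).
Proof.
move=> st0; rewrite /cOuter !run_seqs run_seqs1.
set t1 := run (CSet _ _) s; set t2 := run (CFor 33 _ _) t1; set t3 := run (cZero _ _) t2.
have f1 : fr [:: rBtot] [::] s t1 by rewrite /t1; apply: fr_of.
have f2 : fr [:: 33] [:: aBSEL] t1 t2 by rewrite /t2; apply: fr_of.
have f3 : fr [:: 19] [:: aD1] t2 t3 by rewrite /t3; apply: fr_of.
have st2 : stat t2 by apply: stat_fr f2 _ _ (stat_fr f1 _ _ st0).
have st3 : stat t3 by apply: stat_fr f3 _ _ st2.
have ct := st3.1.
pose good s' := rg s' rBtot <= lam -> [/\ #|bestset s'| = J, {in bestset s', forall v, okV v} & #|DXV (bestset s')| <= rg s' rBtot].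
pose K m s' := good s' /\ forall m' dd, m' < m -> (forall i, i < 5 * J -> dd i = digit J.+1 m' i) -> success dd ->
  rg s' rBtot <= ptot (prunV dd (J + J)).
set B := (X in run X t3).
suff [H1 H2] : K (J.+1 ^ (5 * J)) (run B t3).
  split; first exact: H1.
  move=> F FJ Fok Fl.
  have [dd [d1 d2 d3 d4]] := packing_exists arefl atrans aanti atot (topv_ok par0 rk_par) (@vself_ok _ _ _ _) aroot VfP (@qself_ok n) FJ Fok Fl.
  have [m mB hm] := @digit_all J.+1 (5 * J) dd (fun i _ => d1 i).
  by apply: leq_trans d4; apply: (H2 m) => // i iJ; rewrite hm.
apply: (odometer (cL1 ct) (cK ct) (cC1 ct)); first by vm_compute.
- exact: zero_ok (cL1 st2.1) _.
- split=> //; rewrite /good -[rg _ _]/(rg t3 rBtot) f3.1 // f2.1 // -[rg _ _]/(rg s rInf) (cInf st0.1) ltnn.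
  by [].
move=> m s' mM f' sx hdig [k1 k2].
have st' : stat s' by apply: stat_fr f' _ _ st3.
have hd i : i < 5 * J -> ar s' aD1 i <= J by move=> iL; rewrite hdig // -ltnS ltn_mod.
set q := run cPack s'.
have Eb : rg (setr (run (cInc aD1 rL1 rK) q) 56 m.+1) rBtot = rg q rBtot.
  by rewrite -[LHS]/(rg (run (cInc aD1 rL1 rK) q) rBtot) run_rg.
have ES : bestset (setr (run (cInc aD1 rL1 rK) q) 56 m.+1) = bestset q.
  apply/setP => v; rewrite !inE -[ar (setr _ _ _) _ _]/(ar (run (cInc aD1 rL1 rK) q) aBSEL v) run_ar //.
rewrite /K /good Eb ES.
have := pack_ok par0 rk_par JN VfP st' hd; cbv zeta; rewrite -/q.
set p := prunV _ _; case=> [[h1 [h2 [h3 h4]]]|[h1 [h2 h3]]].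
  have ESp : bestset q = psel p by apply/setP => v; rewrite inE h4.
  rewrite h3 ESp; split.
    move=> pl; have [g1 g2 g3] := prun_sound arefl atrans atot aroot VfP pl.
    by split=> //; rewrite g1 h1.1 h1.2.
  move=> m' dd; rewrite ltnS leq_eqVlt => /orP[/eqP -> hdd sdd|m'm hdd sdd].
    have [|_ E] := @prun_digits dd (ar s' aD1) _ sdd; first by move=> i iJ; rewrite hdd // hdig.
    by rewrite -E.
  by apply: leq_trans (ltnW h2) _; exact: k2 hdd sdd.
have ESp : bestset q = bestset s' by apply/setP => v; rewrite !inE h3.
rewrite h2 ESp; split=> // m' dd; rewrite ltnS leq_eqVlt => /orP[/eqP -> hdd sdd|m'm hdd sdd]; last exact: k2 hdd sdd.
have [|sd E] := @prun_digits dd (ar s' aD1) _ sdd; first by move=> i iJ; rewrite hdd // hdig.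
by rewrite -E leqNgt; apply/negP => lt; apply: h1.
Qed.

Lemma label_ok s : stat s -> let s' := run cLabel s in
  forall x y : V, (ar s' aOUT x == ar s' aOUT y) = (sig par (bestset s) x == sig par (bestset s) y).
Proof.
move=> st0 s' x y; rewrite {}/s'.
pose P (z : V) : pred V := fun u => sig par (bestset s) u == sig par (bestset s) z.
pose f i := if insub i is Some v then nat_of_ord (nthset (P v) 0) else 0.
have H (z : V) : ar (run cLabel s) aOUT z = nthset (P z) 0.
  suff H i : i < N -> ar (run cLabel s) aOUT i = f i by rewrite H // /f valK.
  move: i; apply: (@fill1 s 33 rN aOUT _ N f (cN st0.1) isT) => s' i iN f' si.
  rewrite /f insubT; set w : V := Sub i iN.
  have st' : stat s' by apply: stat_fr f' _ _ st0.
  have hsig g e (u : V) : ctx T J lam g (ar s') -> g 33 = w -> (forall z, ev (upd g 82 z) (ar s') e = u) ->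
      (ev g (ar s') (xsigeq e (XVar 33)) != 0) = P w u.
    move=> cg g33 ge; rewrite ev_xnot (ev_xex (N := N) (P := fun v => (v \in bestset s) && (anc v u != anc v w))); first last.
    - move=> v; have cv : ctx T J lam (upd g 82 v) (ar s') by apply: ctx_upd.
      rewrite ev_xand ev_xnot ev_xeq -[ev _ _ (XArr aBSEL _)]/(ar s' aBSEL v) f'.2 // inE.
      rewrite (@ev_xanc _ _ _ _ _ _ _ _ cv st'.2 (XVar 82) e v u) // (@ev_xanc _ _ _ _ _ _ _ _ cv st'.2 (XVar 82) (XVar 33) v w) //.
      by case: (anc v u); case: (anc v w).
    - exact: cN cg.
    rewrite negb_exists /P; apply/forallP/eqP => [h|h v].
      apply/setP => v; rewrite !inE; have := h v; rewrite inE; case: (ar s aBSEL v != 0) => //=.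
      by rewrite negbK => /eqP ->.
    rewrite negb_and negbK; have /setP/(_ v) := h; rewrite !inE.
    by case: (ar s aBSEL v != 0) => //= ->.
  apply: ev_xnth => //; first exact: cN st'.1.
  - by move=> u; apply: hsig => //; apply: ctx_upd st'.1.
  - by move=> u v; apply: hsig => //; do 2 apply: ctx_upd => //; exact: st'.1.
have PP z : P z (nthset (P z) 0) by apply: (@nthset0 _ _ z); exact: eqxx.
rewrite !H eq_ordE; apply/eqP/eqP => [E|E].
  by have := PP x; rewrite E => /eqP <-; have /eqP := PP y.
by congr nthset; apply: functional_extensionality => u; rewrite /P E.
Qed.

End Outer.

Lemma preim_partition_eq (X : finType) (A B : eqType) (f : X -> A) (g : X -> B) (D : {set X}) :
  (forall x y, (f x == f y) = (g x == g y)) -> preim_partition f D = preim_partition g D.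
Proof.
move=> fg; rewrite /preim_partition /equivalence_partition.
by apply: eq_imset => x; apply/setP => y; rewrite !inE /= fg.
Qed.

Lemma kcut_le n k (P : {set {set 'I_n}}) : is_kcut k P -> k <= n.
Proof.
move=> /andP[pP /eqP <-]; suff : #|P| <= #|[set: 'I_n]| by rewrite cardsT card_ord.
rewrite (card_partition pP) -sum1_card; apply: leq_sum => A AP; rewrite lt0n cards_eq0.
by apply: contraTneq AP => ->; have /and3P[_ _] := pP.
Qed.

(** By tightness [P] is induced by J tree edges, each of which is crossed by at most [lam] edges
    because their union is the cut. The outer loop finds a set that is no more expensive. *)
Lemma main_ok n (G : multigraph n.+1) (T : {set edge G}) J lam s :
  ctx T J lam (rg s) (ar s) -> J < n.+1 -> (forall u v, connect (adjacent T) u v) ->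
  (exists P, [/\ is_min_kcut G J.+1 P, #|crossing T P| <= J & cut_size G P <= lam]) ->
  is_min_kcut G J.+1 (preim_partition (fun v : 'I_n.+1 => ar (run cMain s) aOUT v) [set: 'I_n.+1]).
Proof.
move=> c0 JN Tc [P [[kP mP] TP lP]].
have [par [rk [par0 rk_par par_T hP]]] := tree_ok c0 Tc.
rewrite /cMain !run_seqs run_seqs1.
set t1 := run cTree s in hP *; set t2 := run cAnc t1; set t3 := run cDeg t2; set t4 := run cOuter t3; set t5 := run cLabel t4.
have c1 : ctx T J lam (rg t1) (ar t1) by apply: ctx_fr (fr_run _ _) _ _ c0.
have c2 : ctx T J lam (rg t2) (ar t2) by apply: ctx_fr (fr_run _ _) _ _ c1.
have c3 : ctx T J lam (rg t3) (ar t3) by apply: ctx_fr (fr_run _ _) _ _ c2.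
have hP2 x : ar t2 aPAR (nat_of_ord x) = par x by rewrite run_ar.
have st3 : stat T J lam par t3.
  by split=> //; apply: (deg_ok c2 hP2); apply: anc_ok c1 hP.
have st4 : stat T J lam par t4 by apply: stat_fr (fr_run _ _) _ _ st3.
have [H1 H2] := outer_ok par0 rk_par JN st3; rewrite -/t4 in H1 H2.
have [F [F0 FJ FD]] := tight_cut par0 rk_par par_T kP TP.
have Fok : {in F, forall f, okv (@e1 n G) (@e2 n G) (ancp par) ord0 lam f}.
  move=> f fF; rewrite /okv; apply/andP; split; first by apply: contraNneq F0 => <-.
  apply: leq_trans (subset_leq_card _) (leq_trans (eq_leq FD) lP).
  exact: (bigcup_sup f).
have Bl := H2 F FJ Fok (leq_trans (eq_leq FD) lP).
have [B1 B2 B3] := H1 (leq_trans Bl (leq_trans (eq_leq FD) lP)).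
have B0 : ord0 \notin bestset n t4 by apply/negP => /B2; rewrite /okv eqxx.
have [kB cB] := sig_kcut G par0 rk_par B0 B1.
rewrite (preim_partition_eq _ (label_ok st4)); split=> // Q kQ.
by rewrite cB; apply: leq_trans (mP Q kQ); rewrite -FD; apply: leq_trans B3 _.
Qed.

(** * Running time *)

(* Loops over the registers in [special] count towards the product [\prod_(l <- L) ro l],
   all other loops cost a factor M only. *)
Definition special := [:: rInf; rTL; rC1; rC2; rC3].

Fixpoint szE (e : ex) : nat :=
  match e with
  | XLit _ | XVar _ => 1
  | XArr _ i => (szE i).+1
  | XAdd e1 e2 | XSub e1 e2 => (szE e1 + szE e2).+1
  | XIte e1 e2 e3 => (szE e1 + szE e2 + szE e3).+1
  | XSum _ _ b => (szE b).+1
  end.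

Fixpoint szC (c : cmd) : nat :=
  match c with
  | CNop => 1
  | CSet _ e => (szE e).+1
  | CSto _ i e => (szE i + szE e).+1
  | CSeq c1 c2 => (szC c1 + szC c2).+1
  | CIf e c1 c2 => (szE e + szC c1 + szC c2).+1
  | CFor _ _ b => (szC b).+1
  end.

(** Along a nesting of loops each special limit is used at most as often as it occurs in [L]; sums
    may not use one at all. *)
Fixpoint nested (L : seq nat) (c : cmd) : bool :=
  match c with
  | CNop => true
  | CSet _ e => all (fun l => l \notin special) (limsE e)
  | CSto _ i e => all (fun l => l \notin special) (limsE i ++ limsE e)
  | CSeq c1 c2 => nested L c1 && nested L c2
  | CIf e c1 c2 => [&& all (fun l => l \notin special) (limsE e), nested L c1 & nested L c2]
  | CFor _ l b => if l \in special then (l \in L) && nested (rem l L) b else nested L b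
  end.

Section Time.
Variables (ro : nat -> nat) (M : nat).
Hypothesis M0 : 0 < M.
Hypothesis roM : forall l, l \notin special -> ro l <= M.
Hypothesis ro0 : forall l, l \in special -> 0 < ro l.
(** Each node of the syntax tree is paid by one factor X, in which 64 absorbs the additive constants
    of [tE] and [tC]. *)
Let X := 64 * M.

Lemma X64 : 64 <= X. Proof. by rewrite /X; lia. Qed.

Lemma Xge s : 64 <= X ^ s.+1.
Proof.
have X0 : 0 < X ^ s by rewrite expn_gt0 (leq_trans _ X64).
by rewrite expnS (leq_trans X64) // leq_pmulr.
Qed.

Lemma XD a b : X ^ a.+1 + X ^ b.+1 + 64 <= X ^ (a.+1 + b.+1).
Proof. rewrite expnD; have := Xge a; have := Xge b; nia. Qed.

Lemma szE_gt0 e : 0 < szE e. Proof. by case: e. Qed.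
Lemma szC_gt0 c : 0 < szC c. Proof. by case: c. Qed.

Lemma Xsum a b k : 0 < a -> 0 < b -> k <= 64 -> X ^ a + X ^ b + k <= X ^ (a + b).
Proof. by case: a => // a; case: b => // b _ _ k64; apply: leq_trans (XD a b); rewrite leq_add2l. Qed.

Lemma Xs a : X ^ a.+1 = 64 * M * X ^ a. Proof. by rewrite expnS. Qed.

Lemma tE_le e : all (fun l => l \notin special) (limsE e) -> tE ro e <= X ^ szE e.
Proof.
have X2 := X64.
elim: e => //=.
- by move=> _ _; rewrite expn1; lia.
- by move=> _ _; rewrite expn1; lia.
- by move=> _ i IH /IH h; rewrite Xs; have := szE_gt0 i; case: (szE i) h => // s h _; have := Xge s; nia.
- move=> e1 IH1 e2 IH2; rewrite all_cat => /andP[/IH1 h1 /IH2 h2]; rewrite Xs.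
  by have := @Xsum (szE e1) (szE e2) 4 (szE_gt0 _) (szE_gt0 _) isT; nia.
- move=> e1 IH1 e2 IH2; rewrite all_cat => /andP[/IH1 h1 /IH2 h2]; rewrite Xs.
  by have := @Xsum (szE e1) (szE e2) 4 (szE_gt0 _) (szE_gt0 _) isT; nia.
- move=> e1 IH1 e2 IH2 e3 IH3; rewrite !all_cat => /and3P[/IH1 h1 /IH2 h2 /IH3 h3]; rewrite Xs.
  have := @Xsum (szE e1) (szE e2) 4 (szE_gt0 _) (szE_gt0 _) isT.
  have s0 : 0 < szE e1 + szE e2 by have := szE_gt0 e1; lia.
  by have := @Xsum (szE e1 + szE e2) (szE e3) 4 s0 (szE_gt0 _) isT; nia.
- move=> _ l b IH /andP[/roM lM /IH h]; rewrite Xs.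
  have := szE_gt0 b; case: (szE b) h => // s h _; have := Xge s.
  have : ro l * (tE ro b + 12) <= M * (X ^ s.+1 + 12) by apply: leq_mul => //; rewrite leq_add2r.
  nia.
Qed.

Let ar1 t Y Q k : 64 <= Y -> 0 < Q -> t <= Y -> k <= 64 -> t + k <= 64 * (Y * Q).
Proof. by move=> y q h k64; have := leq_pmulr Y q; lia. Qed.

Let ar2 t1 t2 Y1 Y2 Y Q : t1 <= Y1 * Q -> t2 <= Y2 * Q -> Y1 + Y2 <= Y -> t1 + t2 <= 64 * (Y * Q).
Proof. by move=> h1 h2 h; have := leq_mul h (leqnn Q); rewrite mulnDl; lia. Qed.

Let ar3 t0 t1 t2 Y0 Y1 Y2 Y Q : 0 < Q -> t0 <= Y0 -> t1 <= Y1 * Q -> t2 <= Y2 * Q -> Y0 + Y1 + Y2 + 2 <= Y ->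
  t0 + t1 + t2 + 2 <= 64 * (Y * Q).
Proof.
move=> q h0 h1 h2 h; have := leq_mul h (leqnn Q); have := leq_pmulr Y0 q; rewrite !mulnDl; lia.
Qed.

(** Powers of X dominate sums, so sequencing adds exponents; the degree in M is the size of the
    program text. *)
Lemma tC_le L c : {subset L <= special} -> nested L c -> tC ro c <= X ^ szC c * \prod_(l <- L) ro l.
Proof.
have P0 L' : {subset L' <= special} -> 0 < \prod_(l <- L') ro l.
  move=> sL; rewrite big_seq; elim/big_ind: _ => //; first by move=> x y; rewrite muln_gt0 => -> ->.
  by move=> l /sL; exact: ro0.
have X2 := X64.
have big a Y Q : a <= 64 * (Y * Q) -> a <= 64 * M * Y * Q.
  by move=> h; apply: leq_trans h _; rewrite -!mulnA leq_mul2l leq_pmull.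
elim: c L => //=.
- by move=> L sL _; rewrite Xs; apply: big; rewrite expn0 mul1n muln_gt0 P0.
- move=> _ e L sL /tE_le h; rewrite Xs; apply/big/ar1 => //; last exact: P0.
  by have := szE_gt0 e; case: (szE e) => // s _; exact: Xge.
- move=> _ i e L sL; rewrite all_cat => /andP[/tE_le h1 /tE_le h2]; rewrite Xs; apply/big/ar1 => //; last 2 first.
  + exact: P0.
  + by have := @Xsum (szE i) (szE e) 0 (szE_gt0 _) (szE_gt0 _) isT; lia.
  by have := szE_gt0 i; case: (szE i) => // s _; exact: Xge.
- move=> c1 IH1 c2 IH2 L sL /andP[/(IH1 L sL) h1 /(IH2 L sL) h2]; rewrite Xs; apply: big; apply: ar2 h1 h2 _.
  by have := @Xsum (szC c1) (szC c2) 0 (szC_gt0 _) (szC_gt0 _) isT; rewrite addn0.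
- move=> e c1 IH1 c2 IH2 L sL /and3P[/tE_le h0 /(IH1 L sL) h1 /(IH2 L sL) h2]; rewrite Xs; apply: big.
  apply: ar3 (P0 L sL) h0 h1 h2 _.
  have s0 : 0 < szE e + szC c1 by have := szE_gt0 e; lia.
  apply: leq_trans (@Xsum (szE e + szC c1) (szC c2) 2 s0 (szC_gt0 _) isT).
  rewrite !leq_add2r.
  by have := @Xsum (szE e) (szC c1) 0 (szE_gt0 _) (szC_gt0 _) isT; rewrite addn0.
move=> _ l b IH L sL; case: ifP => [ls /andP[lL nb]|/negbT /roM lM nb]; rewrite Xs.
  have sL' : {subset rem l L <= special} by move=> z /mem_rem; exact: sL.
  have := IH _ sL' nb; have := P0 _ sL'; have l0 := ro0 ls.
  rewrite (perm_big _ (perm_to_rem lL)) big_cons; set Q := \prod_(_ <- _) _ => Q0 h.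
  have X3 : 64 <= X ^ szC b by have := szC_gt0 b; case: (szC b) => // s _; exact: Xge.
  have h2 : ro l * (tC ro b + 8) <= ro l * (X ^ szC b * Q + 8) by rewrite leq_mul2l leq_add2r h orbT.
  have h3 : ro l * (X ^ szC b * Q) = X ^ szC b * (ro l * Q) by rewrite mulnCA.
  have h4 : ro l <= X ^ szC b * (ro l * Q).
    by apply: leq_trans (leq_pmulr _ Q0) _; apply: leq_pmull; lia.
  have h5 : 64 <= X ^ szC b * (ro l * Q).
    by apply: leq_trans X3 _; apply: leq_pmulr; rewrite muln_gt0 l0.
  apply: big; rewrite [Z in _ <= Z]mulnDr h3 in h2.
  by move: h2 h4 h5; move: (X ^ szC b * _) (ro l * (_ + 8)) => Y Z; lia.
have := IH L sL nb; have := P0 _ sL; set Q := \prod_(_ <- _) _ => Q0 h.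
have X3 : 64 <= X ^ szC b by have := szC_gt0 b; case: (szC b) => // s _; exact: Xge.
have h2 : ro l * (tC ro b + 8) <= M * (X ^ szC b * Q + 8) by apply: leq_mul => //; rewrite leq_add2r.
have h4 : 64 <= X ^ szC b * Q by apply: leq_trans X3 _; apply: leq_pmulr.
have -> : 64 * M * X ^ szC b * Q = M * (64 * (X ^ szC b * Q)) by rewrite -!mulnA mulnCA.
have h5 : M * (X ^ szC b * Q + 8) + M * 6 <= M * (64 * (X ^ szC b * Q)).
  by rewrite -mulnDr leq_mul2l; apply/orP; right; move: h4; move: (X ^ szC b * _) => Y; lia.
by move: h2 h5 M0; move: (M * (_ + 8)) (M * (64 * _)) (ro l * _) => Y Z W; lia.
Qed.
End Time.

(** Outer guesses, inner guesses in base k, leaf indices and augmentations: the only nested loops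
    not bounded by a polynomial in n. *)
Definition mainL := [:: rC1; rC2; rC3; rInf].
Lemma nested_main : nested mainL cMain. Proof. by vm_compute. Qed.
Lemma nested_pows : nested [:: rTL] cPows. Proof. by vm_compute. Qed.
Lemma nested_const : nested [::] cConst. Proof. by vm_compute. Qed.
Lemma nested_square : nested [::] cSquare. Proof. by vm_compute. Qed.
Lemma nested_row : nested [::] cRow. Proof. by vm_compute. Qed.

(** * The machine program *)

(* The array i of the programs above occupies the addresses congruent to i modulo 32, so
   the input is first moved to array aIN, from the last entry to the first. *)
Definition pCopy := While (Reg 14) (Seq (Set_ 14 (Defs.Sub (Reg 14) (Lit 1)))
  (Seq (Set_ 100 (Reg 14)) (Seq (mul32 100) (Store (Add (Reg 100) (Lit aIN)) (Read (Reg 14)))))).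
Definition pOut := Seq (Set_ 15 (Lit 0)) (While (Defs.Sub (Reg 0) (Reg 15))
  (Seq (Set_ 100 (Reg 15)) (Seq (mul32 100) (Seq (Store (Reg 15) (Read (Add (Reg 100) (Lit aOUT))))
    (Set_ 15 (Add (Reg 15) (Lit 1))))))).
Definition TreeCut := Seq (codeC cConst) (Seq (codeC cSquare) (Seq pCopy (Seq (codeC cRow)
  (Seq (codeC cPows) (Seq (codeC cMain) pOut))))).

(** Entry j moves up to 32 j + 1. Going downwards, the entries still to be moved lie below every
    address written so far. *)
Lemma copy_ok m M : reg m 14 = M -> runs pCopy m (2 + M * 34) (fun m' =>
  (forall r, r < 70 -> r != 14 -> reg m' r = reg m r) /\ forall j, j < M -> Defs.mem m' (32 * j + aIN) = Defs.mem m j).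
Proof.
move=> eM; pose I i (m' : state) := [/\ reg m' 14 = M - i, forall r, r < 70 -> r != 14 -> reg m' r = reg m r,
  forall j, j < M - i -> Defs.mem m' j = Defs.mem m j & forall j, M - i <= j < M -> Defs.mem m' (32 * j + 1) = Defs.mem m j].
apply: (@runs_weak _ _ (2 + M * (32 + 2)) _ (I M)) => //; last first.
  by move=> m' [h1 h2 h3 h4]; split=> // j jM; apply: h4; lia.
apply: (@runs_for _ _ _ _ _ I).
- by split=> //; rewrite ?subn0 // => j; lia.
- by move=> i m' [h1 _ _ _].
move=> i m' iM [h1 h2 h3 h4]; rewrite -[32]/(4 + (2 + (20 + 6))).
apply: (runs_seq (Q := fun q => [/\ reg q 14 = M - i.+1, forall r, r != 14 -> reg q r = reg m' r & Defs.mem q = Defs.mem m'])).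
  by apply: runs_set; split=> //= [|r /negbTE h]; rewrite /upd ?eqxx ?h //= h1; lia.
move=> q [q1 q2 q3].
apply: (runs_seq (Q := fun q' => [/\ reg q' 100 = M - i.+1, forall r, r != 100 -> reg q' r = reg q r & Defs.mem q' = Defs.mem q])).
  by apply: runs_set; split=> //= r /negbTE h; rewrite /upd h.
move=> q' [p1 p2 p3].
apply: (runs_seq (Q := fun r' => [/\ reg r' 100 = 32 * (M - i.+1), forall r, r != 100 -> reg r' r = reg q' r & Defs.mem r' = Defs.mem q'])).
  by apply: runs_mul32 => r' e1 e2; split=> //=; rewrite e1 p1.
move=> r' [e1 e2 e3]; apply: runs_store; split=> /=.
- by rewrite e2 // p2.
- by move=> r r70 r14; rewrite e2 ?p2 ?q2 ?h2 //; apply/eqP; lia.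
- move=> j jM; rewrite /upd /aIN e1 e3 p3 q3; case: eqP => [|_]; first by lia.
  by apply: h3; lia.
- move=> j jM; rewrite /upd /aIN e1 (e2 14) // (p2 14) // q1 e3 p3 q3.
  case: eqP => [E|ne]; first by rewrite h3; [congr (Defs.mem m _); lia|lia].
  by apply: h4; lia.
Qed.

(** Going upwards, label i is read at an address not below i, while only addresses below i have been
    overwritten. *)
Lemma out_ok m n : reg m 0 = n -> runs pOut m (2 + (4 + n * 36)) (fun m' =>
  forall j, j < n -> Defs.mem m' j = Defs.mem m (32 * j + aOUT)).
Proof.
move=> en; pose I i (m' : state) := [/\ reg m' 15 = i, reg m' 0 = n,
  forall j, j < i -> Defs.mem m' j = Defs.mem m (32 * j + aOUT) & forall j, i <= j -> Defs.mem m' j = Defs.mem m j].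
apply: (runs_seq (Q := I 0)); first by apply: runs_set; split.
move=> m0 I0; apply: (@runs_weak _ _ (4 + n * (32 + 4)) _ (I n)) => //; last by move=> m' [].
apply: (@runs_for _ _ _ _ _ I) => //.
- by move=> i m' [h1 h2 _ _] /=; rewrite h1 h2.
move=> i m' iM [h1 h2 h3 h4]; rewrite -[32]/(2 + (20 + (6 + 4))).
apply: (runs_seq (Q := fun q => [/\ reg q 100 = i, forall r, r != 100 -> reg q r = reg m' r & Defs.mem q = Defs.mem m'])).
  by apply: runs_set; split=> //= r /negbTE h; rewrite /upd h.
move=> q [q1 q2 q3].
apply: (runs_seq (Q := fun r' => [/\ reg r' 100 = 32 * i, forall r, r != 100 -> reg r' r = reg q r & Defs.mem r' = Defs.mem q])).
  by apply: runs_mul32 => r' e1 e2; split=> //=; rewrite e1 q1.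
move=> r' [e1 e2 e3].
apply: (runs_seq (Q := fun q' => [/\ reg q' 15 = i, reg q' 0 = n & Defs.mem q' = upd (Defs.mem m') i (Defs.mem m (32 * i + aOUT))])).
  apply: runs_store; split=> /=; [by rewrite e2 // q2|by rewrite e2 // q2|].
  by rewrite e1 e2 // q2 // h1 e3 q3 h4 //; lia.
move=> q' [p1 p2 p3]; apply: runs_set; split=> //=.
- by rewrite /upd eqxx p1 addn1.
- by move=> j ji; rewrite p3 /upd; case: eqP => [->//|ne]; apply: h3; lia.
- by move=> j ji; rewrite p3 /upd; case: eqP => [|ne]; [lia|apply: h4; lia].
Qed.

Lemma nth_allpairs (A B C : Type) (f : A -> B -> C) (s : seq A) (t : seq B) a0 b0 c0 i j :
  i < size s -> j < size t -> nth c0 [seq f a b | a <- s, b <- t] (i * size t + j) = f (nth a0 s i) (nth b0 t j).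
Proof.
move=> + jt; elim: s i => // a s IH [|i] il /=.
  by rewrite nth_cat size_map jt (nth_map b0).
by rewrite nth_cat size_map mulSn -addnA ltnNge leq_addr /= addKn IH.
Qed.

Section Input.
Variables (n : nat) (G : multigraph n.+1).
Local Notation V := 'I_n.+1.
Local Notation N := n.+1.

Lemma size_adjacency (F : {set edge G}) : size (adjacency F) = N * N.
Proof. by rewrite size_allpairs size_enum_ord. Qed.

Lemma nth_adjacency (F : {set edge G}) (x y : V) : nth 0 (adjacency F) (x * N + y) = #|[set e in F | joins e x y]|.
Proof.
have H := @nth_allpairs V V nat (fun u v => #|[set e in F | joins e u v]|) (enum V) (enum V) ord0 ord0 0 x y.
by rewrite size_enum_ord !nth_ord_enum in H; rewrite /adjacency H.
Qed.

Lemma card_joins (x y : V) : #|[set e in [set: edge G] | joins e x y]| = mult (@e1 n G) (@e2 n G) x y.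
Proof.
apply: eq_card => e; rewrite !inE /joins /e1 /e2; case: (ends e) => a b.
by rewrite !xpair_eqE.
Qed.

Lemma card_joinsT (T : {set edge G}) (x y : V) : (#|[set e in T | joins e x y]| != 0) = adjacent T x y.
Proof.
rewrite cards_eq0; apply/set0Pn/exists_inP => [[e]|[e eT j]]; last by exists e; rewrite inE eT.
by rewrite inE => /andP[eT j]; exists e.
Qed.
End Input.

Lemma square_ok s n : rg s rN = n -> rg (run cSquare s) rSq = n * n /\ rg (run cSquare s) 14 = n * n + n * n.
Proof.
move=> sn; rewrite /cSquare !run_seqs run_seqs1; set t := run (CSet _ _) s; set t2 := run (CFor _ _ _) t.
have tn : rg t rN = n by [].
suff H : rg t2 rSq = n * n by rewrite -[rg (run _ _) 14]/(rg t2 rSq + rg t2 rSq) -[rg (run _ _) rSq]/(rg t2 rSq) H.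
apply: (@run_for (fun i s' => rg s' rSq = i * n) _ _ _ _ _ tn) => // i s' iN f' si Is.
by rewrite -[LHS]/(rg s' rSq + rg s' rN) Is f'.1 // tn mulSn addnC.
Qed.

Lemma row_ok s n : rg s rN = n -> rg s rSq = n * n -> forall i, i < n * n -> ar (run cRow s) aROW i = i * n.
Proof.
move=> sn sq; rewrite /cRow !run_seqs run_seqs1; set t := run (CSet _ _) s.
pose I m s' := rg s' 14 = m * n /\ forall i, i < m -> ar s' aROW i = i * n.
suff [] : I (n * n) (run (CFor 13 rSq (CSeq (CSto aROW (XVar 13) (XVar 14)) (CSet 14 (XAdd (XVar 14) (XVar rN))))) t) by [].
apply: (@run_for I _ _ _ _ _ (sq : rg t rSq = n * n)) => // i s' iN f' si [I1 I2].
set B := (X in run X s'); have e14 : rg (run B s') 14 = i.+1 * n.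
  by rewrite -[LHS]/(rg s' 14 + rg s' rN) I1 f'.1 // mulSn addnC -sn.
split=> // j; rewrite ltnS leq_eqVlt -[ar _ _ _]/(if (aROW == aROW) && (j == rg s' 13) then rg s' 14 else ar s' aROW j).
by rewrite si eqxx andTb I1; case: eqP => [->//|_] /= /I2.
Qed.

(** * Assembly of the program and its total time *)

Section Machine.
Variables (n : nat) (G : multigraph n.+1) (T : {set edge G}) (J lam : nat).
Local Notation V := 'I_n.+1.
Local Notation N := n.+1.
Hypothesis JN : J < N.

(** The guards [maxn 1] keep special bounds positive when [lam] is 0, as an empty loop still costs
    its test. All other limits are at most [6 * (N * N)], the largest small ones being [N * N] and 6
    J. *)
Definition roV l := if l == rInf then lam.+1 else if l == rTL then maxn 1 (2 * lam) else
  if l == rC1 then J.+1 ^ (5 * J) else if l == rC2 then J.+1 ^ (6 * J) else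
  if l == rC3 then maxn 1 ((2 * lam) ^ J) else 6 * (N * N).

Definition mainW := J.+1 ^ (5 * J) * (J.+1 ^ (6 * J) * (maxn 1 ((2 * lam) ^ J) * lam.+1)).
Definition sizes := szC cConst + szC cSquare + szC cRow + szC cPows + szC cMain.

Lemma sizes_ge : [/\ szC cConst <= sizes, szC cSquare <= sizes, szC cRow <= sizes, szC cPows <= sizes & szC cMain <= sizes] /\ 0 < sizes.
Proof.
rewrite /sizes; have := szC_gt0 cConst; move: (szC cConst) (szC cSquare) (szC cRow) (szC cPows) (szC cMain) => a b c d e a0.
by split; [split|]; lia.
Qed.

Definition totalV := tC roV cConst + (tC roV cSquare + ((2 + (N * N + N * N) * 34) + (tC roV cRow + (tC roV cPows + (tC roV cMain + (2 + (4 + N * 36))))))).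

(** Seven terms: five compiled programs, and two that absorb the moving of input and output. *)
Lemma total_le : totalV <= 7 * ((64 * (6 * (N * N))) ^ sizes * (2 * mainW)).
Proof.
rewrite /totalV.
pose M := 6 * (N * N).
have M0 : 0 < M by rewrite /M; lia.
have roM l : l \notin special -> roV l <= M.
  by rewrite !inE !negb_or => /and5P[/negbTE h1 /negbTE h2 /negbTE h3 /negbTE h4 /negbTE h5]; rewrite /roV h1 h2 h3 h4 h5.
have ro0 l : l \in special -> 0 < roV l.
  by rewrite !inE => /or4P[|||/orP[]] /eqP ->; rewrite /roV /= ?expn_gt0 //; lia.
have W0 : 0 < mainW by rewrite /mainW !muln_gt0 !expn_gt0 /=; lia.
have pM : \prod_(l <- mainL) roV l = mainW by rewrite /mainL !big_cons big_nil muln1.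
have pP : \prod_(l <- [:: rTL]) roV l <= 2 * mainW.
  rewrite big_cons big_nil muln1 -[roV rTL]/(maxn 1 (2 * lam)).
  have : lam.+1 <= mainW by rewrite /mainW !mulnA leq_pmull // !muln_gt0 !expn_gt0 /=; lia.
  lia.
pose Y := (64 * M) ^ sizes.
have YC c : szC c <= sizes -> (64 * M) ^ szC c <= Y by move=> h; apply: leq_pexp2l => //; lia.
have [[z1 z2 z3 z4 z5] z0] := sizes_ge.
have tY L c : {subset L <= special} -> nested L c -> szC c <= sizes -> \prod_(l <- L) roV l <= 2 * mainW ->
    tC roV c <= Y * (2 * mainW).
  by move=> sL nL sz pL; apply: leq_trans (tC_le M0 roM ro0 sL nL) (leq_mul (YC _ sz) pL).
have nilS : {subset [::] <= special} by [].
have nil1 : \prod_(l <- [::]) roV l <= 2 * mainW by rewrite big_nil; lia.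
have tc := tY _ _ nilS nested_const z1 nil1.
have tq := tY _ _ nilS nested_square z2 nil1.
have tr := tY _ _ nilS nested_row z3 nil1.
have TLs : {subset [:: rTL] <= special} by move=> l; rewrite mem_seq1 => /eqP ->.
have tp := tY _ _ TLs nested_pows z4 pP.
have mLs : {subset mainL <= special} by apply/allP.
have pM2 : \prod_(l <- mainL) roV l <= 2 * mainW by rewrite pM; lia.
have tm := tY _ _ mLs nested_main z5 pM2.
have tX : 64 * M <= Y * (2 * mainW).
  apply: (@leq_trans Y); last by apply: leq_pmulr; lia.
  by rewrite -{1}(expn1 (64 * M)); apply: leq_pexp2l => //; lia.
have : 2 + (N * N + N * N) * 34 + (2 + (4 + N * 36)) <= 2 * (64 * M) by rewrite /M; nia.
rewrite -/M -/Y.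
move: (tC roV cConst) (tC roV cSquare) (tC roV cRow) (tC roV cPows) (tC roV cMain) (Y * _) tc tq tr tp tm tX => t1 t2 t3 t4 t5 Z *.
lia.
Qed.

Lemma machine_runs : runs TreeCut (input J.+1 lam T) totalV (fun m => (forall u v, connect (adjacent T) u v) ->
    (exists P, [/\ is_min_kcut G J.+1 P, #|crossing T P| <= J & cut_size G P <= lam]) ->
    is_min_kcut G J.+1 (output N m)).
Proof.
pose M := 6 * (N * N).
have roJ l v : l \notin special -> v <= M -> v <= roV l.
  rewrite !inE !negb_or => /and5P[/negbTE h1 /negbTE h2 /negbTE h3 /negbTE h4 /negbTE h5].
  by rewrite /roV h1 h2 h3 h4 h5.
have NM : N <= M by rewrite /M; nia.
have JM : 6 * J <= M by rewrite /M; nia.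
have KM : J.+1 <= M by lia.
have SM : N * N <= M by rewrite /M; lia.
set m0 := input J.+1 lam T.
(* Any memory can be read as 32 interleaved arrays, so the simulation holds at the start whatever
   the input is. *)
pose s0 := St (reg m0) (fun a i => Defs.mem m0 (32 * i + a)).
have sim0 : sim s0 m0 by split.
pose s1 := run cConst s0.
have f1 : fr (wrC cConst) (waC cConst) s0 s1 := fr_run _ _.
pose s2 := run cSquare s1.
have f2 : fr (wrC cSquare) (waC cSquare) s1 s2 := fr_run _ _.
have N1 : rg s1 rN = N by rewrite f1.1.
have [Sq2 M2] := square_ok N1; rewrite -/s2 in Sq2 M2.
have E r : r \notin wrC cSquare -> rg s2 r = rg s1 r by exact: f2.1.
have [q1 q2 q3 q4] : [/\ rg s2 rN = N, rg s2 rK = J.+1, rg s2 rL = lam & rg s2 rJ = J].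
  by rewrite !E // N1; split=> //; rewrite -[LHS]/(J.+1 - 1) subn1.
have [q5 q6 q7 q8 q9] : [/\ rg s2 rInf = lam.+1, rg s2 rTL = 2 * lam, rg s2 rL1 = 5 * J, rg s2 rL2 = 6 * J & rg s2 rJJ = J + J].
  rewrite !E //; split.
  - by rewrite -[LHS]/(lam + 1) addn1.
  - by rewrite -[LHS]/(lam + lam); lia.
  - by rewrite -[LHS]/((J.+1 - 1 + (J.+1 - 1)) + ((J.+1 - 1 + (J.+1 - 1)) + (J.+1 - 1))); lia.
  - by rewrite -[LHS]/(((J.+1 - 1 + (J.+1 - 1)) + ((J.+1 - 1 + (J.+1 - 1)) + (J.+1 - 1))) + (J.+1 - 1)); lia.
  - by rewrite -[LHS]/(J.+1 - 1 + (J.+1 - 1)) subn1.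
have q10 : rg s2 rJ1 = J.+1 by rewrite E // -[LHS]/((J.+1 - 1) + 1); lia.
rewrite /TreeCut; have l1 l : l \in limsC cConst -> rg s0 l <= roV l by rewrite (_ : limsC cConst = [::]).
apply: (runs_seq (okC_ok okC_const sim0 l1)) => m1 sim1.
have l2 l : l \in limsC cSquare -> rg s1 l <= roV l.
  by rewrite (_ : limsC cSquare = [:: rN]) // mem_seq1 => /eqP ->; rewrite N1; exact: roJ.
apply: (runs_seq (okC_ok okC_square sim1 l2)) => m2 [sr2 sa2].
have mem2 j : Defs.mem m2 j = Defs.mem m0 j.
  rewrite (divn_eq j 32) mulnC; have j32 : j %% 32 < 32 by rewrite ltn_mod.
  by rewrite sa2 // -[run _ _]/s2 f2.2 // f1.2.
apply: (runs_seq (copy_ok _)) => [|m3 [r3 h3]]; first by rewrite sr2.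
(* Memory is read afresh after the copy. Other arrays may contain leftovers of the input; only [aIN]
   is known. *)
pose s3 := St (reg m3) (fun a i => Defs.mem m3 (32 * i + a)).
have sim3 : sim s3 m3 by split.
have R3 r : r < 70 -> r != 14 -> rg s3 r = rg s2 r by move=> h h'; rewrite -[LHS]/(reg m3 r) r3 // sr2.
pose s4 := run cRow s3; pose s5 := run cPows s4.
have f4 : fr (wrC cRow) (waC cRow) s3 s4 := fr_run _ _.
have f5 : fr (wrC cPows) (waC cPows) s4 s5 := fr_run _ _.
have R4 r : r < 70 -> r \notin [:: 13; 14] -> rg s4 r = rg s2 r.
  rewrite !inE negb_or => h /andP[h1 h2].
  by rewrite f4.1 ?R3 // (_ : wrC cRow = [:: 14; 13; 14]) // !inE !negb_or h1 h2.
have l3 l : l \in limsC cRow -> rg s3 l <= roV l.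
  by rewrite (_ : limsC cRow = [:: rSq]) // mem_seq1 => /eqP ->; rewrite R3 // Sq2; exact: roJ.
apply: (runs_seq (okC_ok okC_row sim3 l3)) => m4 sim4.
have l4 l : l \in limsC cPows -> rg s4 l <= roV l.
  move=> hl; have : l \in [:: rK; rTL; rL1; rJ; rL2] by move: l hl; apply/allP.
  rewrite !inE => /or4P[|||/orP[]] /eqP ->; rewrite R4 // ?q2 ?q6 ?q7 ?q4 ?q8; try by apply: roJ => //; lia.
  by rewrite -[roV rTL]/(maxn 1 (2 * lam)); lia.
apply: (runs_seq (okC_ok okC_pows sim4 l4)) => m5 sim5.
have R5 r : r < 70 -> r \notin [:: 13; 14; 9; 10; 11; 19; 21; 22] -> rg s5 r = rg s2 r.
  move=> h h'; rewrite f5.1 ?R4 //; first by apply: contra h'; rewrite !inE => /orP[] ->; rewrite ?orbT.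
  by apply: contra h' => h'; move: r h' {h}; apply/allP.
have R5C : [/\ rg s5 rC1 = J.+1 ^ (5 * J), rg s5 rC2 = J.+1 ^ (6 * J) & rg s5 rC3 = (2 * lam) ^ J].
  rewrite /s5 /cPows !run_seqs run_seqs1; set u1 := run (cPow _ _ _) s4; set u2 := run (cPow _ _ _) u1; set u3 := run (cPow _ _ _) u2.
  have g1 : fr [:: rC1; 19; 21; 22] [::] s4 u1 by rewrite /u1; apply: fr_of.
  have g2 : fr [:: rC2; 19; 21; 22] [::] u1 u2 by rewrite /u2; apply: fr_of.
  have g3 : fr [:: rC3; 19; 21; 22] [::] u2 u3 by rewrite /u3; apply: fr_of.
  have e1 : rg u1 rC1 = J.+1 ^ (5 * J) by apply: pow_ok => //; rewrite R4.
  have e2 : rg u2 rC2 = J.+1 ^ (6 * J) by apply: pow_ok => //; rewrite g1.1 // R4.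
  have e3 : rg u3 rC3 = (2 * lam) ^ J by apply: pow_ok => //; rewrite g2.1 // g1.1 // R4.
  by rewrite g3.1 // g2.1 // e1 g3.1 // e2 e3.
have A5 a i : ar s5 a i = ar s4 a i by rewrite f5.2.
have IN j : j < N * N + N * N -> ar s5 aIN j = nth 0 (adjacency [set: edge G] ++ adjacency T) j.
  by move=> jN; rewrite A5 f4.2 // -[LHS]/(Defs.mem m3 (32 * j + aIN)) h3 // mem2.
have c5 : ctx T J lam (rg s5) (ar s5).
  have [e1 e2 e3] := R5C.
  split; rewrite ?e1 ?e2 ?e3 ?R5 //.
  - by move=> i iN; rewrite A5; apply: row_ok iN; rewrite R3.
  - by move=> x y; rewrite IN ?nth_cat ?size_adjacency ?idx2_lt ?nth_adjacency ?card_joins //; have := idx2_lt x y; lia.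
  - move=> x y; rewrite IN ?nth_cat ?size_adjacency; last by rewrite ltn_add2l idx2_lt.
    by rewrite ltnNge leq_addr /= addKn nth_adjacency card_joinsT.
have l5 l : l \in limsC cMain -> rg s5 l <= roV l.
  move=> hl.
  have : l \in [:: rN; rJ; rInf; rJ1; rL1; rL2; rK; rTL; rC1; rC2; rC3; rJJ] by move: l hl; apply/allP; vm_compute.
  have [e1 e2 e3] := R5C.
  rewrite !inE; do 11? case/orP; move=> /eqP ->; rewrite ?e1 ?e2 ?e3 ?R5 // ?q1 ?q2 ?q4 ?q5 ?q6 ?q7 ?q8 ?q9 ?q10;
    try by apply: roJ => //; lia.
  - exact: leqnn.
  - exact: leq_maxr.
  - exact: leq_maxr.
apply: (runs_seq (okC_ok okC_main sim5 l5)) => m6 [sr6 sa6].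
have e0 : reg m6 0 = N.
  rewrite (sr6 0 isT) (@run_rg cMain s5 0 isT) R5 //; exact: q1.
apply: (runs_weak (out_ok e0) (leqnn _)).
move=> m7 h7 Tc hP; have := main_ok c5 JN Tc hP.
rewrite /output; congr (is_min_kcut G J.+1 _); apply: preim_partition_eq => x y.
by rewrite !h7 // !sa6.
Qed.
End Machine.

(** * Final estimates *)

Lemma little_o_const c : little_o_id (fun=> c).
Proof. by move=> d; exists (d * c) => k. Qed.

(** The 5 J and 6 J digits, and J more for bounding [2 ^ J], give 12 J. The exponent J + 1 of [lam]
    is J leaf indices and one factor for the augmentations, with lam + 1 at most 2 lam. *)
Lemma mainW_le J lam : 0 < lam -> mainW J lam <= J.+1 ^ (12 * J.+1) * (2 * lam ^ J.+1).
Proof.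
move=> l0; have k0 : 0 < J.+1 by [].
have mx : maxn 1 ((2 * lam) ^ J) = (2 * lam) ^ J by apply/maxn_idPr; rewrite expn_gt0 muln_gt0 l0.
rewrite /mainW mx expnMn.
have h2 : 2 ^ J <= J.+1 ^ J by case: (J) => // j; rewrite leq_exp2r.
apply: (@leq_trans (J.+1 ^ (5 * J) * (J.+1 ^ (6 * J) * (J.+1 ^ J * lam ^ J * (2 * lam))))).
  rewrite leq_mul2l; apply/orP; right; rewrite leq_mul2l; apply/orP; right.
  by apply: leq_mul; [rewrite leq_mul2r h2 orbT|lia].
have -> : J.+1 ^ (5 * J) * (J.+1 ^ (6 * J) * (J.+1 ^ J * lam ^ J * (2 * lam))) = J.+1 ^ (12 * J) * (2 * lam ^ J.+1).
  have -> : 12 * J = 5 * J + (6 * J + J) by lia.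
  rewrite !expnD expnSr; lia.
rewrite leq_mul2r; apply/orP; right; apply: leq_pexp2l => //; lia.
Qed.

(** 28 is 7 times the factor 2 of [total_le] times the factor 2 of [mainW_le], and 384 is 64 times
    6. *)
Lemma time_le S N J lam : 0 < N -> 0 < lam ->
  7 * ((64 * (6 * (N * N))) ^ S * (2 * mainW J lam)) <=
  (12 + 28 * 384 ^ S) * J.+1 ^ ((12 + 28 * 384 ^ S) * J.+1) * lam ^ J.+1 * N ^ (2 * S).
Proof.
move=> N0 l0; have := mainW_le J l0; move: (mainW J lam) => W hW.
have -> : (64 * (6 * (N * N))) ^ S = 384 ^ S * N ^ (2 * S).
  by rewrite expnM -expnMn -mulnn mulnA.
move: (384 ^ S) (N ^ (2 * S)) (lam ^ J.+1) hW => c Y L hW.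
have h : J.+1 ^ (12 * J.+1) <= J.+1 ^ ((12 + 28 * c) * J.+1).
  by apply: leq_pexp2l => //; rewrite leq_mul2r leq_addr orbT.
apply: (@leq_trans (7 * (c * Y * (2 * (J.+1 ^ ((12 + 28 * c) * J.+1) * (2 * L)))))).
  rewrite leq_mul2l /= leq_mul2l; apply/orP; right; rewrite leq_mul2l /=.
  by apply: leq_trans hW _; rewrite leq_mul2r h orbT.
move: (J.+1 ^ _) => K.
have -> : 7 * (c * Y * (2 * (K * (2 * L)))) = 28 * c * (K * L * Y) by lia.
by rewrite -!mulnA !mulnA -!(mulnA _ K) -!(mulnA _ (K * L)) leq_mul2r leq_addl orbT.
Qed.

Theorem theorem3p1 :
  exists (TreeCut : prog) (C : nat) (g : nat -> nat),
    little_o_id g /\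
    forall (n k lam : nat) (G : multigraph n) (T : {set edge G}),
      0 < k ->
      is_tight_T_tree k T ->
      exists (t : nat) (s : state),
        [/\ exec TreeCut (input k lam T) t s,
            (exists P, is_min_kcut G k P /\ cut_size G P <= lam) ->
              is_min_kcut G k (output n s)
          & 0 < lam -> t <= C * k ^ (C * k) * lam ^ k * n ^ g k].
Proof.
(* The exponent of n is twice the total size of the compiled programs, as their loop bound M is
   quadratic in n. *)
exists TreeCut, (12 + 28 * 384 ^ sizes), (fun=> 2 * sizes); split; first exact: little_o_const.
(* The empty vertex set has no k-cut with positive k; in all other cases vertex 0 exists and can
   serve as the root. *)
move=> [|n] k lam G T k0 [[Tc _] [P [[kP mP] TP]]].
  by have := kcut_le kP; lia.
have kn := kcut_le kP; case: k k0 kn kP mP TP => // J _ kn kP mP TP.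
have [t [s [h1 h2 h3]]] := machine_runs T lam kn.
exists t, s; split.
- exact: h1.
- move=> [Q [mQ lQ]]; apply: h3; first exact: Tc.
  exists P; split; [by split|exact: TP|].
  by apply: leq_trans lQ; apply: mP; have [] := mQ.
- move=> l0; apply: leq_trans h2 (leq_trans (total_le lam kn) _).
  exact: time_le.
Qed.
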